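(* Let $q\in\mathbb N_1$, $\theta>0$ and let $\nu$ be a Borel probability measure on $\Delta^{q-1}$ with $\nu(\mathring\Delta^{q-1})>0$. Let $(A_k)_k\subset\mathcal A^{(q)}_\cup$ with $A_k\to\infty$ (i.e. $(A_k)_k$ eventually leaves every finite subset of $\mathcal A^{(q)}_\cup$). Then the following are equivalent: (i) $(A_k)_k$ converges to the Martin boundary of the polychromatic Hoppe chain (PHC) with parameters $\theta,\nu$; (ii) $(\mathbf X(A_k))_k$ converges in $(\boldsymbol\nabla^{(q)}_0,\tau_* )$. When this is the case, denoting by $\mathbf x$ the limit in (ii), $$\lim_{k\to\infty}K(B,A_k)=K(B,\mathbf x),\qquad B\in\mathcal A^{(q)}_\cup,$$ and two sequences converging to the Martin boundary are equivalent if and only if the corresponding limits in (ii) coincide. Furthermore, the map $\Theta\colon\boldsymbol\nabla^{(q)}_0\to\mathscr M$, $\Theta(\mathbf x)=K(\cdot,\mathbf x)$, is a homeomorphism; that is, the Martin boundary $\mathscr M$ of the PHC is homeomorphic to $(\boldsymbol\nabla^{(q)}_0,\tau_* )$.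
   Context: Notation: $\mathbb N_1=\{1,2,\dots\}$, $\mathbb N_0=\{0,1,\dots\}$, $[q]=\{1,\dots,q\}$, $\mathbb N^q_*=\mathbb N_0^q\setminus\{\mathbf 0\}$, $0^0=1$; $|\mathbf a|=\sum_j|a_j|$, $\mathbf a!=\prod_ja_j!$, $\mathbf x^{\mathbf a}=\prod_jx_j^{a_j}$, $\binom{|\mathbf a|}{\mathbf a}=|\mathbf a|!/\mathbf a!$; $\mathbf e_j$ canonical basis vectors; $\langle\theta\rangle_n=\theta(\theta+1)\cdots(\theta+n-1)$; $\Delta^{q-1}=\{\mathbf u\in[0,1]^q:|\mathbf u|=1\}$, relative interior $\mathring\Delta^{q-1}$; $m_{\mathbf a}(\nu)=\int\mathbf u^{\mathbf a}d\nu(\mathbf u)$. A $q$-chromatic partition of $n$ is a finitely supported map $A\colon\mathbb N^q_*\to\mathbb N_0$ with $\sum_{\mathbf a}A(\mathbf a)|\mathbf a|=n$; $\mathcal A^{(q)}_n$ is the set of these ($\mathcal A^{(q)}_0=\{0\}$), $\mathcal A^{(q)}_\cup=\bigcup_n\mathcal A^{(q)}_n$; $\mathbf 1_{\mathbf a}$ is the multiset with single element $\mathbf a$; operations, $\le$ pointwise; $s(A)=\sum_{\mathbf a} A(\mathbf a)$. Kingman simplex: $\mathbf s<_{\mathrm{sl}}\mathbf t$ iff $(|\mathbf s|,s_1,\dots,s_q)<(|\mathbf t|,t_1,\dots,t_q)$ lexicographically. $\boldsymbol\nabla^{(q)}_0$ is the set of sequences $\mathbf x=(\mathbf x_i)_{i\ge0}$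 in $[0,\infty)^q$ with $\mathbf x_i\ge_{\mathrm{sl}}\mathbf x_{i+1}$ for $i\ge1$, $\sum_{i\ge0}|\mathbf x_i|=1$. With $\Sigma^q=\{\mathbf t\in[0,1]^q:|\mathbf t|\le1\}$, $\tau_*$ is the pull-back topology via the injective map $\mathbf x\mapsto(\sum_{i\ge0}\mathbf x_i,\ |\mathbf x_0|\delta_{\mathbf 0}+\sum_{i\ge1}|\mathbf x_i|\delta_{\mathbf x_i})\in\Delta^{q-1}\times\mathscr P(\Sigma^q)$, with $\mathscr P(\Sigma^q)$ (Borel probability measures) carrying the weak topology. For $A\in\mathcal A^{(q)}_n$ its enumeration $(\mathbf a_h)_{h\in[s(A)]}$ lists all $\mathbf a\in\mathrm{supp}A$ with multiplicity $A(\mathbf a)$, decreasingly in shortlex order. For $n\ge1$ set $\mathbf X(A)_0=\mathbf 0$, $\mathbf X(A)_i=\mathbf a_i/n$ for $i\in[s(A)]$, $\mathbf X(A)_i=\mathbf 0$ for $i>s(A)$; then $\mathbf X(A)\in\boldsymbol\nabla^{(q)}_0$. With $T_r$ the set of injective maps $[r]\to\mathbb N_1$ ($T_0=\{\varnothing\}$): $\varphi_0\equiv1$, $\varphi_A(\mathbf x)=n!\big(\prod_{\mathbf a\in\mathrm{supp}A}\frac1{\mathbf a!^{A(\mathbf a)}A(\mathbf a)!}\big)\sum_{\iota\in T_{s(A)}}\prod_{h=1}^{s(A)}\mathbf x_{\iota(h)}^{\mathbf a_h}$; with $\mathrm{dust}(\mathbf m)=\sum_jm_j\mathbf 1_{\mathbf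 e_j}$: $\psi_0\equiv1$, $\psi_A(\mathbf x)=n!\sum_{\mathbf m\in\mathbb N_0^q,\,\mathrm{dust}(\mathbf m)\le A}\frac{\mathbf x_0^{\mathbf m}}{\mathbf m!(n-|\mathbf m|)!}\varphi_{A-\mathrm{dust}(\mathbf m)}(\mathbf x)$. pESF: $\mathscr E^n_{\theta,\nu}[A]=\frac{n!}{\langle\theta\rangle_n}\prod_{\mathbf a\in\mathrm{supp}A}\frac1{A(\mathbf a)!}\big(\frac{\theta}{|\mathbf a|}\binom{|\mathbf a|}{\mathbf a}m_{\mathbf a}(\nu)\big)^{A(\mathbf a)}$, $A\in\mathcal A^{(q)}_n$ (positive under the assumption on $\nu$). PHC: the Markov chain $(\mathscr A_t)_t$ on $\mathcal A^{(q)}_\cup$ which from $B\in\mathcal A^{(q)}_m$ moves to $B+\mathbf 1_{\mathbf e_j}$ with probability $\frac{\theta\,m_{\mathbf e_j}(\nu)}{\theta+m}$ and to $B-\mathbf 1_{\mathbf b}+\mathbf 1_{\mathbf b+\mathbf e_j}$ with probability $\frac{|\mathbf b|B(\mathbf b)}{\theta+m}\frac{m_{\mathbf b+\mathbf e_j}(\nu)}{m_{\mathbf b}(\nu)}$ ($\mathbf b\in\mathrm{supp}B$, $j\in[q]$). Potential kernel: $F(B,A)=\sum_{t\ge0}P^B[\tau^A=t]$, with $P^B$ the law of the chain started at $B$ and $\tau^A$ the first hitting time of $A$. Martin kernel: $K(B,A)=F(B,A)/F(0,A)$, $A,B\in\mathcal A^{(q)}_\cup$. Extended Martin kernel: $K(B,\mathbf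 x)=\psi_B(\mathbf x)/\mathscr E^m_{\theta,\nu}[B]$ for $B\in\mathcal A^{(q)}_m$, $\mathbf x\in\boldsymbol\nabla^{(q)}_0$. A sequence $(A_k)_k$ converges to the Martin boundary if $A_k\to\infty$ and $K(\cdot,A_k)$ converges pointwise on $\mathcal A^{(q)}_\cup$; two such sequences are equivalent if the limits coincide everywhere. $\mathscr M$ is the set of equivalence classes, identified with the set of limit functions and endowed with the topology of pointwise convergence. *)

(* Defs.v *)
From HB Require Import structures.
From mathcomp Require Import all_boot all_order all_algebra.
From mathcomp Require Import finmap multiset.
From mathcomp Require Import all_classical all_reals all_analysis.

Set Implicit Arguments.
Unset Strict Implicit.
Unset Printing Implicit Defensive.

Import Order.TTheory GRing.Theory Num.Theory.
Import numFieldNormedType.Exports.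

Local Open Scope classical_set_scope.
Local Open Scope ring_scope.

(** ** Multi-indices and chromatic partitions *)

Notation mindex q := {ffun 'I_q -> nat}.

Definition nzindex (q : nat) := {a : mindex q | a != 0}.

(* A finitely supported map from nonzero multi-indices to nat.  Each one is a
   q-chromatic partition of exactly one n, namely [psize A], so that this type
   is the union over n of the sets of q-chromatic partitions of n; the empty
   partition is [mset0]. *)
Notation cpart q := {mset (nzindex q)}%mset.

Section multi_indices.
Context {q : nat}.
Implicit Types (a : mindex q) (j : 'I_q).

Definition msum_idx a : nat := (\sum_(j < q) a j)%N.

Definition mfact a : nat := (\prod_(j < q) (a j)`!)%N.

Definition unit_idx j : mindex q := [ffun k => (k == j) : nat].

Lemma addidx_neq0 a j : a + unit_idx j != 0.
Proof.
by apply/negP => /eqP/ffunP/(_ j); rewrite !ffunE eqxx/= natrDE addn1.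
Qed.

Lemma unit_idx_neq0 j : unit_idx j != 0.
Proof. by rewrite -[unit_idx j]add0r addidx_neq0. Qed.

Definition nz_unit j : nzindex q := exist _ (unit_idx j) (unit_idx_neq0 j).

Definition nz_incr (b : nzindex q) j : nzindex q :=
  exist _ (val b + unit_idx j) (addidx_neq0 (val b) j).

Definition shortlex_idx a : seqlexi nat :=
  msum_idx a :: [seq a j | j <- enum 'I_q].

Implicit Types A B : cpart q.

Definition psize A : nat := (\sum_(b <- finsupp A) A b * msum_idx (val b))%N.

(* the enumeration of A; its h-th part, counted from 1, is [nth 0 (parts A) h.-1] *)
Definition parts A : seq (mindex q) :=
  [seq val b | b <- sort (fun b c : nzindex q =>
     (shortlex_idx (val c) <= shortlex_idx (val b))%O) (enum_mset A)].

Definition dust (m : mindex q) : cpart q :=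
  (\big[msetD/mset0]_(j < q) msetn (m j) (nz_unit j))%mset.

End multi_indices.

(** ** Simplices *)

Definition borel (T : ptopologicalType) := g_sigma_algebraType (@open T).

Section simplices.
Variables (R : realType) (q : nat).
Implicit Types u : 'rV[R]_q.

(* the l1 norm; the library's norm on row vectors is the max norm *)
Definition l1 u : R := \sum_(j < q) `|u 0 j|.

Definition simplex : set 'rV[R]_q :=
  [set u : 'rV[R]_q | (forall j, 0 <= u 0 j <= 1) /\ l1 u = 1].

(* relative to the affine hull, the hyperplane of coordinate sum 1 *)
Definition simplex_relint : set 'rV[R]_q :=
  [set u : 'rV[R]_q | simplex u /\
    nbhs u [set v : 'rV[R]_q | \sum_(j < q) v 0 j = 1 -> simplex v]].

Definition corner : set 'rV[R]_q :=
  [set u : 'rV[R]_q | (forall j, 0 <= u 0 j <= 1) /\ l1 u <= 1].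

End simplices.

Arguments simplex R q : clear implicits.
Arguments simplex_relint R q : clear implicits.
Arguments corner R q : clear implicits.

Section corner_pointed.
Variables (R : realType) (q : nat).

Lemma corner0 : (0 : 'rV[R]_q) \in corner R q.
Proof.
apply/mem_set; split=> [j|]; first by rewrite mxE lexx ler01.
by rewrite /l1 big1 ?ler01// => j _; rewrite mxE normr0.
Qed.

Definition cornerT : Type := set_type (corner R q).
HB.instance Definition _ := Topological.copy cornerT (set_type (corner R q)).
HB.instance Definition _ := isPointed.Build cornerT (exist _ 0 corner0).

End corner_pointed.

(** ** Weak topology on Borel probability measures *)

Section weak_topology.
Variables (R : realType) (T : ptopologicalType).

Definition bcfun : Type :=
  {f : T -> R | continuous f /\ bounded_fun f}.

Definition expectations (mu : probability (borel T) R) : {ptws bcfun -> R} :=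
  fun f => \int[mu]_t (sval f : borel T -> R) t.

Definition wprob : Type := initial_topology expectations.
HB.instance Definition _ := Topological.on wprob.

End weak_topology.

(** ** The Kingman simplex *)

Lemma mscale_diracT (R : realType) d (T : sigmaRingType d) (r : {nonneg R}) (a : T) :
  mscale r (dirac a) setT = (r%:num)%:E.
Proof. by rewrite /mscale/= diracT mule1. Qed.

Section kingman_simplex.
Variables (R : realType) (q : nat).
Implicit Types (s t u : 'rV[R]_q).

Definition shortlex s : seqlexi R := l1 s :: [seq s 0 j | j <- enum 'I_q].

Definition kingman_set : set (nat -> 'rV[R]_q) :=
  [set x : nat -> 'rV[R]_q | [/\ forall i j, 0 <= x i 0 j,
      forall i, (1 <= i)%N -> (shortlex (x i.+1) <= shortlex (x i))%O
    & (\sum_(0 <= i <oo) (l1 (x i))%:E = 1)%E]].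

Definition kingman_seq : Type := set_type kingman_set.
HB.instance Definition _ := Choice.on kingman_seq.

Lemma l1_ge0 u : 0 <= l1 u.
Proof. by apply: sumr_ge0. Qed.

Lemma coord_le_l1 u j : `|u 0 j| <= l1 u.
Proof. by rewrite /l1 (bigD1 j)//= lerDl sumr_ge0. Qed.

Lemma kingmanP (x : kingman_seq) : kingman_set (sval x).
Proof. exact/set_mem/(valP x). Qed.

Lemma kingman_corner (x : kingman_seq) i : sval x i \in corner R q.
Proof.
have [x0 _ x1] := kingmanP x.
have l1i : l1 (sval x i) <= 1.
  rewrite -lee_fin -x1 (@nneseries_split _ _ 0 i.+1); last first.
    by move=> k _; rewrite lee_fin l1_ge0.
  rewrite add0n big_nat_recr//= -[leLHS]add0e -addeA; apply: leeD.
    by apply: sume_ge0 => k _; rewrite lee_fin l1_ge0.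
  rewrite leeDl// nneseries_ge0// => k _ _.
  by rewrite lee_fin l1_ge0.
apply/mem_set; split => // j; rewrite x0/=.
by apply: le_trans l1i; apply: le_trans (coord_le_l1 _ j); exact: ler_norm.
Qed.

Definition katom (x : kingman_seq) i : borel (cornerT R q) :=
  exist _ (sval x i) (kingman_corner x i).

Definition kweight (x : kingman_seq) i : {nonneg R} := NngNum (l1_ge0 (sval x i)).

Definition kmeasure (x : kingman_seq) : set (borel (cornerT R q)) -> \bar R :=
  measure_add
    (mscale (kweight x 0) (dirac (exist _ 0 (corner0 R q) : borel (cornerT R q))))
    (mseries (fun i => mscale (kweight x i) (dirac (katom x i))) 1).
HB.instance Definition _ x := Measure.on (kmeasure x).

Lemma kmeasureT x : kmeasure x setT = 1%E.
Proof.
have [_ _ <-] := kingmanP x.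
rewrite /kmeasure measure_addE (@nneseries_split _ _ 0 1); last first.
  by move=> k _; rewrite lee_fin l1_ge0.
rewrite add0n big_nat1; congr (_ + _)%E.
  exact: mscale_diracT.
by apply: eq_eseriesr => i _; exact: mscale_diracT.
Qed.
HB.instance Definition _ x :=
  Measure_isProbability.Build _ _ _ (kmeasure x) (kmeasureT x).

Definition kmass (x : kingman_seq) : 'rV[R]_q :=
  \row_j fine (\sum_(0 <= i <oo) (sval x i 0 j)%:E)%E.

Lemma kmass_simplex x : kmass x \in simplex R q.
Proof.
have [x0 _ x1] := kingmanP x.
have s0 j : (0 <= \sum_(0 <= i <oo) (sval x i 0 j)%:E)%E.
  by apply: nneseries_ge0 => k _ _; rewrite lee_fin.
have s1 : (\sum_(j < q) \sum_(0 <= i <oo) (sval x i 0 j)%:E = 1)%E.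
  rewrite -nneseries_sum; last by move=> j i _; rewrite lee_fin.
  rewrite -x1; apply: eq_eseriesr => i _.
  by rewrite sumEFin; congr (_%:E); apply: eq_bigr => j _; rewrite ger0_norm.
have sle1 j : (\sum_(0 <= i <oo) (sval x i 0 j)%:E <= 1)%E.
  by rewrite -s1 (bigD1 j)//= leeDl// sume_ge0.
have sfin j : (\sum_(0 <= i <oo) (sval x i 0 j)%:E)%E \is a fin_num.
  by rewrite ge0_fin_numE// (le_lt_trans (sle1 j))// ltry.
apply/mem_set; split=> [j|].
  by rewrite mxE fine_ge0//= -lee_fin fineK.
apply: EFin_inj; rewrite -[RHS]s1 /l1 -sumEFin; apply: eq_bigr => j _.
by rewrite mxE ger0_norm ?fine_ge0// fineK.
Qed.

Definition tau_map (x : kingman_seq) :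
    (set_type (simplex R q) * wprob R (cornerT R q))%type :=
  (exist _ (kmass x) (kmass_simplex x),
   (kmeasure x : probability (borel (cornerT R q)) R)).

Definition kingman : Type := initial_topology tau_map.
HB.instance Definition _ := Topological.on kingman.

Definition kseq (x : kingman) : nat -> 'rV[R]_q := sval (x : kingman_seq).

End kingman_simplex.

(** ** Embedding of partitions in the Kingman simplex *)

Section embedding.
Variables (R : realType) (q : nat).
Implicit Types A : cpart q.

(* [nth] is 0 past the last part *)
Definition part_seq A (i : nat) : 'rV[R]_q :=
  if i is h.+1 then \row_j (((nth 0 (parts A) h) j)%:R / (psize A)%:R) else 0.

Lemma lexi_map_scale (c : R) (s t : seq nat) : 0 < c ->
  ((s : seqlexi nat) <= t)%O ->
  (([seq n%:R * c | n <- s] : seqlexi R) <= [seq n%:R * c | n <- t])%O.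
Proof.
move=> c0; elim: s t => [|m s IH] [|n t]//=.
rewrite !lexi_cons => /andP[]; rewrite !leEnat => mn /implyP nms.
by rewrite !ler_pM2r// !ler_nat mn/=; apply/implyP => /nms; exact: IH.
Qed.

Lemma l1_part_seq A h :
  l1 (part_seq A h.+1) = (msum_idx (nth 0 (parts A) h))%:R / (psize A)%:R.
Proof.
rewrite /l1 /msum_idx natr_sum mulr_suml; apply: eq_bigr => j _.
by rewrite mxE ger0_norm// divr_ge0.
Qed.

Lemma shortlex_part_seq A h : shortlex (part_seq A h.+1) =
  [seq n%:R / (psize A)%:R | n <- shortlex_idx (nth 0 (parts A) h)].
Proof.
rewrite /shortlex l1_part_seq /shortlex_idx map_cons -map_comp; congr cons.
by apply: eq_map => j; rewrite /= mxE.
Qed.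

Lemma shortlex_idx_ge0 (a : mindex q) : (shortlex_idx (0 : mindex q) <= shortlex_idx a)%O.
Proof.
rewrite /shortlex_idx lexi_cons leEnat; apply/andP; split.
  by apply: leq_sum => j _; rewrite ffunE.
apply/implyP => _; elim: (enum 'I_q) => //= j s IH.
by rewrite lexi_cons ffunE leEnat leq0n/= IH implybT.
Qed.

Lemma parts_sorted A h :
  (shortlex_idx (nth 0 (parts A) h.+1) <= shortlex_idx (nth 0 (parts A) h))%O.
Proof.
have [ltn|leqn] := ltnP h.+1 (size (parts A)); last first.
  by rewrite [nth _ _ h.+1]nth_default// shortlex_idx_ge0.
have /(sortedP 0) : sorted
    (fun a b : mindex q => (shortlex_idx b <= shortlex_idx a)%O) (parts A).
  rewrite /parts sorted_map; apply: sort_sorted => a b /=.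
  by rewrite le_total.
exact.
Qed.

Lemma sum_parts A : (\sum_(a <- parts A) msum_idx a = psize A)%N.
Proof.
rewrite /parts big_map (perm_big (enum_mset A)); last by rewrite perm_sort.
rewrite EnumMset.E big_flatten big_map; apply: eq_bigr => b _.
by rewrite big_nseq iter_addn_0 mulnC.
Qed.

Lemma part_seq_kingman A : (0 < psize A)%N -> kingman_set (part_seq A).
Proof.
move=> A0; split.
- by case=> [|h] j; rewrite mxE// divr_ge0.
- case=> // h _; rewrite !shortlex_part_seq; apply: lexi_map_scale.
    by rewrite invr_gt0 ltr0n.
  exact: parts_sorted.
- rewrite (@nneseries_split _ _ 0 (size (parts A)).+1); last first.
    by move=> k _; rewrite lee_fin l1_ge0.
  rewrite eseries0 ?adde0; last first.
    case=> // h; rewrite add0n ltnS => lth _; rewrite l1_part_seq.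
    by rewrite nth_default// /msum_idx big1 ?mul0r// => j _; rewrite ffunE.
  rewrite add0n big_nat_recl//= {1}/l1 big1 ?add0e; last first.
    by move=> j _; rewrite mxE normr0.
  under eq_bigr do rewrite l1_part_seq.
  rewrite sumEFin -mulr_suml -natr_sum.
  rewrite -(big_nth 0 xpredT (fun a => msum_idx a)) sum_parts divff//.
  by rewrite pnatr_eq0 -lt0n.
Qed.

Variable hq : (0 < q)%N.

Definition dust_vertex (i : nat) : 'rV[R]_q :=
  if i == 0%N then \row_j (j == Ordinal hq)%:R else 0.

Lemma dust_vertex_kingman : kingman_set dust_vertex.
Proof.
split.
- by case=> [|h] j; rewrite mxE// ler0n.
- by case=> // h _.
- rewrite (@nneseries_split _ _ 0 1); last first.
    by move=> k _; rewrite lee_fin l1_ge0.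
  rewrite eseries0 ?adde0; last first.
    by case=> // h _ _; rewrite /l1 big1// => j _; rewrite mxE normr0.
  rewrite add0n big_nat1 /l1 (bigD1 (Ordinal hq))//= big1 ?addr0.
    by rewrite mxE eqxx normr1.
  by move=> j /negbTE jq; rewrite mxE jq normr0.
Qed.

(* The empty partition, which has no natural image, goes to [dust_vertex]; by
   [kseq_embed] all others go to their normalised [part_seq]. *)
Definition embed A : kingman R q :=
  insubd (exist _ dust_vertex (mem_set dust_vertex_kingman) : kingman_seq R q)
    (part_seq A).

Lemma kseq_embed A : (0 < psize A)%N -> kseq (embed A) = part_seq A.
Proof.
move=> /part_seq_kingman/mem_set A0; rewrite /kseq/= -[LHS]/(val _).
by rewrite val_insubd A0.
Qed.

End embedding.

(** ** Monomial functions of the Kingman simplex *)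

Section kingman_polynomials.
Variables (R : realType) (q : nat).
Implicit Types (A B : cpart q) (x : nat -> 'rV[R]_q).

Definition mono (u : 'rV[R]_q) (a : mindex q) : R := \prod_(j < q) u 0 j ^+ a j.

(* [iota] maps the index h of a part, here counted from 0, to a positive index *)
Definition pos_injections (r : nat) : set {ffun 'I_r -> nat} :=
  [set iota | injective iota /\ forall h, (0 < iota h)%N].

Definition phi A x : R :=
  (psize A)`!%:R *
  (\prod_(a <- finsupp A) ((mfact (val a))%:R ^+ A a * (A a)`!%:R)^-1) *
  fine (\esum_(iota in @pos_injections (size (parts A)))
    (\prod_h mono (x (iota h)) (nth 0 (parts A) h))%:E)%E.

Definition psi A x : R :=
  (psize A)`!%:R *
  \sum_(m \in [set m : mindex q | (dust m `<=` A)%mset])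
    mono (x 0%N) m / ((mfact m)%:R * (psize A - msum_idx m)`!%:R) *
    phi (A `\` dust m)%mset x.

End kingman_polynomials.

(** ** The polychromatic Hoppe chain and its Martin kernel *)

Section hoppe.
Variables (R : realType) (q : nat) (theta : R).
(* a Borel measure on R^q, to be used with [nu (simplex R q) = 1]: measurable
   types are pointed, and the simplex is empty for q = 0 *)
Variable nu : probability (borel 'rV[R]_q) R.
Implicit Types (A B C : cpart q).

Definition moment (a : mindex q) : R := \int[nu]_(u in simplex R q) mono u a.

Definition esf A : R :=
  (psize A)`!%:R / (\prod_(i < psize A) (theta + i%:R)) *
  \prod_(a <- finsupp A) ((A a)`!%:R^-1 *
    (theta / (msum_idx (val a))%:R *
     ((msum_idx (val a))`!%:R / (mfact (val a))%:R) * moment (val a)) ^+ A a).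

Definition hoppe_step B C : R :=
  \sum_(j < q) theta * moment (unit_idx j) / (theta + (psize B)%:R) *
    (C == B `+` [mset nz_unit j])%mset%:R +
  \sum_(b <- finsupp B) \sum_(j < q)
    (msum_idx (val b) * B b)%:R / (theta + (psize B)%:R) *
    (moment (val (nz_incr b j)) / moment (val b)) *
    (C == (B `\` [mset b]) `+` [mset nz_incr b j])%mset%:R.

Definition extended_kernel B (x : kingman R q) : R := psi B (kseq x) / esf B.

(* [P B] is the law of the chain started at [B]; the last clause is the Markov
   property along the path c *)
Definition is_hoppe_chain d (Omega : measurableType d)
    (P : cpart q -> probability Omega R) (X : nat -> Omega -> cpart q) : Prop :=
  [/\ forall t C, measurable (X t @^-1` [set C]),
      forall B, P B (X 0%N @^-1` [set B]) = 1%E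
    & forall B t (c : nat -> cpart q),
        P B [set w | forall s, (s <= t.+1)%N -> X s w = c s] =
        (P B [set w | forall s, (s <= t)%N -> X s w = c s] *
         (hoppe_step (c t) (c t.+1))%:E)%E].

End hoppe.

Section martin.
Variables (R : realType) (q : nat).

Section kernel.
Variables (d : measure_display) (Omega : measurableType d).
Variables (P : cpart q -> probability Omega R) (X : nat -> Omega -> cpart q).

(* the event that the first hitting time of A is t; the start counts as a hit *)
Definition first_hit (A : cpart q) (t : nat) : set Omega :=
  [set w | X t w = A /\ forall s, (s < t)%N -> X s w <> A].

Definition potential (B A : cpart q) : \bar R :=
  (\sum_(0 <= t <oo) P B (first_hit A t))%E.

Definition martin_kernel (B A : cpart q) : R :=
  fine (potential B A) / fine (potential mset0 A).

End kernel.

Variable K : cpart q -> cpart q -> R.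
Implicit Types (A : nat -> cpart q).

Definition to_infinity A : Prop :=
  forall D : set (cpart q), finite_set D -> \forall k \near \oo, ~ D (A k).

Definition martin_convergent A : Prop :=
  to_infinity A /\ forall B, cvg (K B (A k) @[k --> \oo]).

(* meant for two martin_convergent sequences *)
Definition martin_equiv A A' : Prop :=
  forall B, lim (K B (A k) @[k --> \oo]) = lim (K B (A' k) @[k --> \oo]).

Definition martin_boundary : set {ptws cpart q -> R} :=
  [set f | exists2 A, martin_convergent A &
    forall B, f B = lim (K B (A k) @[k --> \oo])].

End martin.

Definition homeomorphism (T U : topologicalType) (f : T -> U) : Prop :=
  continuous f /\
  exists g : U -> T, [/\ cancel f g, cancel g f & continuous g].

(* Main.v *)
Require Import Defs.
From HB Require Import structures.
From mathcomp Require Import all_boot all_order all_algebra.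
From mathcomp Require Import finmap multiset.
From mathcomp Require Import all_classical all_reals all_analysis.
From mathcomp Require Import measurable_realfun.

Set Implicit Arguments.
Unset Strict Implicit.
Unset Printing Implicit Defensive.

Import Order.TTheory GRing.Theory Num.Theory.
Import numFieldNormedType.Exports.

Local Open Scope classical_set_scope.
Local Open Scope ring_scope.

(** The proof rests on one kind of sum ([isum]): the members of a list are placed
    on pairwise distinct indices, except that the index 0, which stands for the
    dust, may be used by several of them.

    For a partition [A] the sum [fsum A l] counts the ordered samples drawn
    without replacement from [A] whose classes have the compositions listed in
    [l].  A sample grows by one element, either inside a class already met or in
    a new one ([fsum_grow]).  After multiplication by suitable constants this is
    one step of the Hoppe chain, so that [hfun A] is harmonic below the size of
    [A] ([hfun_harmonic]); at that size it vanishes except at [A], since a sample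
    which exhausts [A] is [A] ([fsum_full]).  The chain is graded by the size, so
    it can only be in [A] at one known time, and [hfun A] is the probability of
    hitting [A] up to a factor independent of the starting point ([trans_hfun]).
    Its value at the empty partition is 1, whence K(B, A) = hfun A B
    ([martin_kernelE]).

    The extended kernel is given by the same sums, with falling factorials
    replaced by monomials: summing over the subsets of singletons taken from the
    dust amounts to letting the singletons use the index 0 ([isum_dust], [psiE]).
    Sampling with and without replacement differ by O(1/|A|), therefore
    K(B, A_k) - K(B, X(A_k)) tends to 0 as A_k goes to infinity ([kernel_asymp]).

    Resolving the collisions of indices one at a time ([isum_cons_collision])
    turns K(B, x) into a polynomial in the power sums of x ([isum_power_poly]);
    conversely the power sum of exponent b is, up to a positive constant, the
    kernel at the partition with the single part b.  So the kernels converge if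
    and only if all power sums do, and it remains to compare this with the
    topology of the Kingman simplex.

    In one direction, the power sum of an exponent a is a coordinate of the total
    mass if |a| = 1, and otherwise the expectation, under the measure attached to
    x, of the continuous function u^a / |u| ([powersum_expectation]).

    In the other direction, forget the order of the terms of x.  The sequences
    that remain form a compact space ([zspace_compact]) with uniformly small
    tails, on which the sums over i of |x_i| h(x_i) are continuous whenever h is
    continuous with h(0) = 0 ([zsum_cvg]).  A sequence of this space can be sorted
    into a point of the simplex without changing these sums ([resort]).  Moreover
    the power sums determine the point ([powersum_inj]): they give the
    expectations of all polynomials, hence the mass of every single atom, as the
    limit of the expectations of the powers of a polynomial which peaks there;
    hence the sorted atoms, and finally the dust, which is the missing mass.  By
    compactness a limit of power sums is then attained ([powersum_realized]), and
    the convergence of the power sums implies that of the points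
    ([powersum_cvg_kingman]).

    Rounding the terms of k x down to integers shows that every point is a limit
    of partitions ([dense_embed]), so that every extended kernel belongs to the
    boundary; continuity in both directions is the equivalence above, read along
    the neighbourhood filters instead of sequences. *)

(** * Sums over injective choices of indices *)

(** The indices still available once those of [D] are taken; the index 0, that of
    the dust, is treated apart and never blocked. *)
Definition live (D : seq nat) (i : nat) := (0 < i)%N && (i \notin D).

Section injective_sums.
Context {R : realType} {T : Type}.
Variable w : T -> nat -> R.
Implicit Types (a b c : T) (l : seq T) (D : seq nat).

(** The sum over all placements of [l] on indices outside [D], pairwise distinct
    unless 0, of the product of the weights.  It is defined by recursion rather than
    as a sum over functions so that [D] can record the choices already made. *)
Fixpoint isum l D : \bar R :=
  if l is a :: l' then
    ((w a 0%N)%:E * isum l' D +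
     \sum_(0 <= i <oo | live D i) (w a i)%:E * isum l' (i :: D))%E
  else 1%E.

Lemma eq_live D D' : D =i D' -> live D =1 live D'.
Proof. by move=> DD' i; rewrite /live DD'. Qed.

Lemma eq_isum l D D' : D =i D' -> isum l D = isum l D'.
Proof.
elim: l D D' => //= a l IH D D' DD'; rewrite (IH _ _ DD'); congr (_ + _)%E.
rewrite (@eq_eseriesl _ _ (live D') _ _ (eq_live DD')); apply: eq_eseriesr => i _.
by rewrite (IH (i :: D) (i :: D'))// => j; rewrite !inE DD'.
Qed.

Hypothesis w_ge0 : forall a i, 0 <= w a i.

Lemma isum_ge0 l D : (0 <= isum l D)%E.
Proof.
elim: l D => //= a l IH D; rewrite adde_ge0 ?mule_ge0 ?lee_fin//.
by apply: nneseries_ge0 => i _ _; rewrite mule_ge0 ?lee_fin.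
Qed.
Hint Resolve isum_ge0 : core.

Lemma isum_term_ge0 a l D i : (0 <= (w a i)%:E * isum l D)%E.
Proof. by rewrite mule_ge0// lee_fin. Qed.
Hint Resolve isum_term_ge0 : core.

Lemma live_series_ge0 a l D D' :
  (0 <= \sum_(0 <= i <oo | live D i) (w a i)%:E * isum l (i :: D'))%E.
Proof. by apply: nneseries_ge0 => i _ _. Qed.
Hint Resolve live_series_ge0 : core.

(** Only pairs of distinct indices are visited, in either order. *)
Lemma live_interchange (u : nat -> nat -> \bar R) D :
  (forall i j, (0 <= u i j)%E) ->
  (\sum_(0 <= i <oo | live D i) \sum_(0 <= j <oo | live (i :: D) j) u i j =
   \sum_(0 <= j <oo | live D j) \sum_(0 <= i <oo | live (j :: D) i) u i j)%E.
Proof.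
move=> u0.
have E (v : nat -> nat -> \bar R) (i : nat) : (\sum_(0 <= j <oo | live (i :: D) j) v i j =
    \sum_(0 <= j <oo | live D j) if i != j then v i j else 0)%E.
  rewrite eseries_mkcond [RHS]eseries_mkcond; apply: eq_eseriesr => j _.
  by rewrite /live inE negb_or [j == i]eq_sym; case: (0 < j)%N; case: eqP => //= _;
     case: (j \in D).
rewrite (eq_eseriesr (fun i _ => E u i)).
rewrite nneseries_interchange; last by move=> i j; case: ifP.
apply: eq_eseriesr => j _; rewrite (E (fun j i => u i j)).
by apply: eq_eseriesr => i _; rewrite eq_sym.
Qed.

(** The double series over distinct positive indices is symmetric by
    [live_interchange]; the terms where one of the two entries sits at 0 are
    exchanged. *)
Lemma isum_swap a b l D : isum [:: a, b & l] D = isum [:: b, a & l] D.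
Proof.
have E c d : isum [:: c, d & l] D =
    ((w c 0)%:E * ((w d 0)%:E * isum l D) +
     (\sum_(0 <= j <oo | live D j) (w c 0)%:E * ((w d j)%:E * isum l (j :: D)) +
     (\sum_(0 <= i <oo | live D i) (w c i)%:E * ((w d 0)%:E * isum l (i :: D)) +
      \sum_(0 <= i <oo | live D i) \sum_(0 <= j <oo | live (i :: D) j)
        (w c i)%:E * ((w d j)%:E * isum l (j :: i :: D)))))%E.
  rewrite [LHS]/=.
  rewrite [X in (X + _)%E = _]ge0_muleDr// -addeA; congr (_ + _)%E.
  rewrite -nneseriesZl//; congr (_ + _)%E.
  rewrite -nneseriesD; last 2 first.
  - by move=> i _ _; rewrite mule_ge0 ?lee_fin.
  - by move=> i _ _; apply: nneseries_ge0 => j _ _; rewrite mule_ge0 ?lee_fin.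
  apply: eq_eseriesr => i _.
  by rewrite ge0_muleDr// -nneseriesZl.
rewrite !E; congr (_ + _)%E; first by rewrite muleCA.
rewrite addeCA; congr (_ + (_ + _))%E.
- by apply: eq_eseriesr => i _; rewrite muleCA.
- by apply: eq_eseriesr => i _; rewrite muleCA.
- rewrite live_interchange; last by move=> i j; rewrite mule_ge0 ?lee_fin.
  apply: eq_eseriesr => i _; apply: eq_eseriesr => j _.
  rewrite muleCA; congr (_ * (_ * _))%E; apply: eq_isum => k.
  by rewrite !inE orbCA.
Qed.

Lemma isum_cons a l l' : (forall D, isum l D = isum l' D) ->
  forall D, isum (a :: l) D = isum (a :: l') D.
Proof.
move=> ll' D /=; rewrite ll'; congr (_ + _)%E.
by apply: eq_eseriesr => i _; rewrite ll'.
Qed.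

Lemma isum_front l1 a l2 D : isum (l1 ++ a :: l2) D = isum (a :: l1 ++ l2) D.
Proof.
elim: l1 D => // b l1 IH D; rewrite cat_cons (isum_cons b IH).
exact: isum_swap.
Qed.

End injective_sums.

Lemma isum_perm {R : realType} {T : eqType} (w : T -> nat -> R) (l l' : seq T) D :
  (forall a i, 0 <= w a i) -> perm_eq l l' -> isum w l D = isum w l' D.
Proof.
move=> w0; elim: l l' D => [|a l IH] l' D.
  by rewrite perm_sym => /perm_nilP ->.
move=> ll'; have al' : a \in l' by rewrite -(perm_mem ll') mem_head.
case/splitPr: al' ll' => l1 l2.
rewrite perm_sym -cat1s perm_catCA perm_cons perm_sym => /IH E.
by rewrite isum_front//; apply: isum_cons => D'; exact: E.
Qed.

Lemma eq_in_isum {R : realType} {T T' : eqType} (w : T -> nat -> R)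
    (w' : T' -> nat -> R) (h : T' -> T) (l : seq T') D :
  {in l, forall a, w (h a) =1 w' a} -> isum w (map h l) D = isum w' l D.
Proof.
elim: l D => //= a l IH D E; rewrite E ?mem_head// IH; last first.
  by move=> b bl; apply: E; rewrite inE bl orbT.
congr (_ + _)%E; apply: eq_eseriesr => i _; rewrite E ?mem_head// IH//.
by move=> b bl; apply: E; rewrite inE bl orbT.
Qed.

(** * Resolving collisions of indices *)

Section collisions.
Context {R : realType} {T : Type}.
Variable w : T -> nat -> R.
Implicit Types (a b c : T) (l : seq T) (D : seq nat).
Hypothesis w_ge0 : forall a i, 0 <= w a i.
Hypothesis w_fin : forall a, (\sum_(0 <= i <oo) (w a i)%:E < +oo)%E.

Let isum_ge0 := isum_ge0 w_ge0.
Let wE_ge0 a i : (0 <= (w a i)%:E)%E. Proof. by rewrite lee_fin. Qed.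
Hint Resolve isum_ge0 wE_ge0 : core.

Definition tot a : \bar R := (\sum_(0 <= i <oo) (w a i)%:E)%E.

Lemma tot_ge0 a : (0 <= tot a)%E.
Proof. by rewrite /tot; apply: nneseries_ge0 => *; rewrite lee_fin. Qed.

Lemma tot_fin a : tot a \is a fin_num.
Proof. by rewrite ge0_fin_numE ?tot_ge0//; exact: w_fin. Qed.

Lemma tot_live a D :
  ((w a 0)%:E + \sum_(0 <= i <oo | live D i) (w a i)%:E <= tot a)%E.
Proof.
rewrite /tot (@nneseriesD1 _ _ 0%N xpredT)// leeD2l//.
by apply: subset_lee_nneseries => //= i /andP[]; case: i.
Qed.

(** The constraint of injectivity only lowers the sum. *)
Lemma isum_le l D : (isum w l D <= \prod_(a <- l) tot a)%E.
Proof.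
elim: l D => [|a l IH] D; first by rewrite big_nil.
rewrite big_cons [isum _ _ _]/=.
have t0 : (0 <= \prod_(b <- l) tot b)%E.
  by apply: prode_ge0 => b _; exact: tot_ge0.
have tf : (\prod_(b <- l) tot b)%E \is a fin_num.
  by apply: prode_fin_num => b _; exact: tot_fin.
apply: (@le_trans _ _ (((w a 0)%:E + \sum_(0 <= i <oo | live D i) (w a i)%:E)
                       * \prod_(b <- l) tot b)%E); last first.
  by apply: lee_wpmul2r => //; exact: tot_live.
rewrite ge0_muleDl//; last exact: nneseries_ge0.
apply: leeD; first exact: lee_wpmul2l.
rewrite -(fineK tf) muleC -nneseriesZl//.
apply: lee_nneseries => i _; first by rewrite mule_ge0.
by rewrite fineK// muleC; exact: lee_wpmul2r.
Qed.

Lemma isum_fin l D : isum w l D \is a fin_num.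
Proof.
rewrite ge0_fin_numE//; apply: le_lt_trans (isum_le l D) _.
by rewrite ltey_eq prode_fin_num// => b _; exact: tot_fin.
Qed.

Fixpoint bumps (C : T -> seq T) l : seq (seq T) :=
  if l is b :: l' then
    [seq c :: l' | c <- C b] ++ [seq b :: l'' | l'' <- bumps C l']
  else [::].

(** Let the index [i], weighted by [f], run first over the indices avoided by
    the other ones and then over those chosen by each of them: together this is
    a free sum over [i].  On a collision with an entry [b] the product of the two
    weights is re-expanded through [C b] and a multiple of [b] itself. *)
Lemma isum_collision (f : nat -> R) (C : T -> seq T) (k : T -> R) l D :
  (forall i, 0 <= f i) -> (forall b, 0 <= k b) ->
  (\sum_(0 <= i <oo) (f i)%:E < +oo)%E ->
  (forall b i, f i.+1 * w b i.+1 = \sum_(c <- C b) w c i.+1 + k b * w b i.+1) ->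
  (forall b, \sum_(c <- C b) w c 0%N + k b * w b 0%N = 0) ->
  (\sum_(0 <= i <oo | live D i) (f i)%:E * isum w l (i :: D) +
   \sum_(l' <- bumps C l) isum w l' D + (\sum_(b <- l) k b)%:E * isum w l D =
   (\sum_(0 <= i <oo | live D i) (f i)%:E) * isum w l D)%E.
Proof.
move=> f0 k0 ffin H H0.
have fE0 i : (0 <= (f i)%:E)%E by rewrite lee_fin.
have kE0 l' : (0 <= (\sum_(b <- l') k b)%:E)%E by rewrite lee_fin sumr_ge0.
have WD D' : (\sum_(0 <= i <oo | live D' i) (f i)%:E)%E \is a fin_num.
  rewrite ge0_fin_numE ?nneseries_ge0//; apply: le_lt_trans ffin.
  exact: subset_lee_nneseries.
have S0 (I : Type) (s : seq I) (g : I -> seq T) D' :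
    (0 <= \sum_(l' <- s) isum w (g l') D')%E by apply: sume_ge0.
elim: l D => [|b l IH] D.
  rewrite /= !big_nil mul0e !adde0 mule1.
  by apply: eq_eseriesr => i _; rewrite mule1.
set F := fun l D => (\sum_(0 <= i <oo | live D i) (f i)%:E * isum w l (i :: D))%E.
have F0 l' D' : (0 <= F l' D')%E.
  by apply: nneseries_ge0 => i _ _; rewrite mule_ge0.
have W0 D' : (0 <= \sum_(0 <= i <oo | live D' i) (f i)%:E)%E.
  exact: nneseries_ge0.
(* the three kinds of terms, split according to the index used by [b] *)
have E1 : (F (b :: l) D = (w b 0)%:E * F l D +
    \sum_(0 <= j <oo | live D j) (w b j)%:E * F l (j :: D))%E.
  rewrite -nneseriesZl; last by move=> *; rewrite mule_ge0.
  transitivity (\sum_(0 <= i <oo | live D i)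
      ((w b 0)%:E * ((f i)%:E * isum w l (i :: D)) +
       \sum_(0 <= j <oo | live (i :: D) j)
          (f i)%:E * ((w b j)%:E * isum w l (j :: i :: D))))%E.
    apply: eq_eseriesr => i _ /=; rewrite ge0_muleDr ?mule_ge0//; last first.
      by apply: nneseries_ge0 => *; rewrite mule_ge0.
    by rewrite muleCA -nneseriesZl// => *; rewrite mule_ge0.
  rewrite nneseriesD; last 2 first.
  - by move=> i _ _; rewrite !mule_ge0.
  - by move=> i _ _; apply: nneseries_ge0 => j _ _; rewrite !mule_ge0.
  congr (_ + _)%E; rewrite live_interchange; last by move=> i j; rewrite !mule_ge0.
  apply: eq_eseriesr => j _; rewrite /F -nneseriesZl; last first.
    by move=> *; rewrite mule_ge0.
  apply: eq_eseriesr => i _; rewrite muleCA; congr (_ * (_ * _))%E.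
  by apply: eq_isum => n; rewrite !inE orbCA.
have E2 : (\sum_(l' <- bumps C (b :: l)) isum w l' D + (k b)%:E * isum w (b :: l) D =
    (w b 0)%:E * \sum_(l' <- bumps C l) isum w l' D +
    \sum_(0 <= j <oo | live D j) ((w b j)%:E * \sum_(l' <- bumps C l) isum w l' (j :: D)
      + (f j * w b j)%:E * isum w l (j :: D)))%E.
  rewrite nneseriesD; last 2 first.
  - by move=> *; rewrite mule_ge0.
  - by move=> *; rewrite mule_ge0// lee_fin mulr_ge0.
  rewrite /= big_cat !big_map/=.
  have -> : (\sum_(l' <- bumps C l) isum w (b :: l') D =
     (w b 0)%:E * \sum_(l' <- bumps C l) isum w l' D +
     \sum_(0 <= j <oo | live D j) (w b j)%:E * \sum_(l' <- bumps C l) isum w l' (j :: D))%E.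
    rewrite /= big_split/= ge0_sume_distrr//; congr (_ + _)%E.
    transitivity (\sum_(l' <- bumps C l) \sum_(0 <= j <oo)
       if live D j then (w b j)%:E * isum w l' (j :: D) else 0)%E.
      by apply: eq_bigr => l' _; rewrite eseries_mkcond.
    rewrite -nneseries_sum; last by move=> l' j _; case: ifP => // _; rewrite mule_ge0.
    rewrite [RHS]eseries_mkcond; apply: eq_eseriesr => j _; case: ifP => Dj.
      by rewrite ge0_sume_distrr.
    by rewrite big1.
  rewrite addeAC [RHS]addeA [RHS]addeC; congr (_ + _)%E.
  rewrite /= ge0_muleDr ?mule_ge0//; last first.
    by apply: nneseries_ge0 => *; rewrite mule_ge0.
  rewrite big_split/= addeACA.
  have -> : (\sum_(c <- C b) (w c 0)%:E * isum w l D +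
     (k b)%:E * ((w b 0)%:E * isum w l D) = 0)%E.
    rewrite -(fineK (isum_fin l D)) -!EFinM.
    transitivity ((\sum_(c <- C b) w c 0%N + k b * w b 0%N) * fine (isum w l D))%:E.
      by rewrite mulrDl mulr_suml EFinD -sumEFin mulrA; congr (_ + _)%E.
    by rewrite H0 mul0r.
  rewrite add0e.
  transitivity (\sum_(0 <= j <oo) if live D j then
    (\sum_(c <- C b) (w c j)%:E * isum w l (j :: D)
     + (k b)%:E * ((w b j)%:E * isum w l (j :: D))) else 0)%E.
    rewrite [X in (_ + X)%E = _](_ : _ = (\sum_(0 <= j <oo)
        if live D j then (k b)%:E * ((w b j)%:E * isum w l (j :: D)) else 0)%E); last first.
      rewrite -nneseriesZl; last by move=> *; rewrite mule_ge0.
      by rewrite eseries_mkcond.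
    rewrite [X in (X + _)%E = _](_ : _ = (\sum_(0 <= j <oo)
        if live D j then \sum_(c <- C b) (w c j)%:E * isum w l (j :: D) else 0)%E); last first.
      transitivity (\sum_(c <- C b) \sum_(0 <= j <oo)
        if live D j then (w c j)%:E * isum w l (j :: D) else 0)%E.
        by apply: eq_bigr => c _; rewrite eseries_mkcond.
      rewrite -nneseries_sum; last by move=> c j _; case: ifP => // _; rewrite mule_ge0.
      by apply: eq_eseriesr => j _; case: ifP => // _; rewrite big1.
    rewrite -nneseriesD; last 2 first.
    - by move=> j _ _; case: ifP => // _; apply: sume_ge0 => *; rewrite mule_ge0.
    - by move=> j _ _; case: ifP => // _; rewrite !mule_ge0// lee_fin.
    by apply: eq_eseriesr => j _; case: ifP => // _; rewrite add0e.
  rewrite [RHS]eseries_mkcond; apply: eq_eseriesr => -[|j] _; first by [].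
  case: ifP => // _; rewrite -(fineK (isum_fin l (j.+1 :: D))).
  rewrite H -!EFinM mulrDl mulr_suml mulrA EFinD; congr (_ + _)%E.
  by rewrite -sumEFin.
have E3 : ((\sum_(c <- b :: l) k c)%:E * isum w (b :: l) D =
   (k b)%:E * isum w (b :: l) D + ((w b 0)%:E * ((\sum_(c <- l) k c)%:E * isum w l D) +
   \sum_(0 <= j <oo | live D j) (w b j)%:E * ((\sum_(c <- l) k c)%:E * isum w l (j :: D))))%E.
  rewrite big_cons EFinD ge0_muleDl ?lee_fin//; last by rewrite sumr_ge0.
  congr (_ + _)%E; rewrite /= ge0_muleDr ?mule_ge0//; last first.
    by apply: nneseries_ge0 => *; rewrite mule_ge0.
  rewrite muleCA; congr (_ + _)%E; rewrite -nneseriesZl; last first.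
    by move=> *; rewrite mule_ge0.
  by apply: eq_eseriesr => j _; rewrite muleCA.
rewrite -/(F (b :: l) D) E1 E3 [X in _ = X]/=.
have rearr (A0 A1 B K C0 C1 B0 B1 : \bar R) : (B + K = B0 + B1 ->
    A0 + A1 + B + (K + (C0 + C1)) = (A0 + B0 + C0) + (A1 + (B1 + C1)))%E.
  move=> BK; rewrite -[LHS]addeA [X in (_ + X = _)%E]addeA BK.
  by rewrite [X in (_ + X = _)%E]addeACA [LHS]addeACA [X in (X + _ = _)%E]addeA.
rewrite (rearr _ _ _ _ _ _ _ _ E2) -!ge0_muleDr ?adde_ge0 ?mule_ge0//.
rewrite IH ge0_muleDr ?mule_ge0//; last first.
  by apply: nneseries_ge0 => *; rewrite mule_ge0.
rewrite muleCA; congr (_ + _)%E.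
have FE0 j : (0 <= (f j * w b j)%:E * isum w l (j :: D))%E.
  by rewrite mule_ge0// lee_fin mulr_ge0.
rewrite -!nneseriesD; do ?by move=> *; rewrite ?adde_ge0 ?mule_ge0.
rewrite -(fineK (WD D)) -nneseriesZl; last by move=> *; rewrite mule_ge0.
apply: eq_eseriesr => j Dj; rewrite fineK// [RHS]muleCA.
(* the index [j] was avoided on the right only because of [b] *)
have -> : (\sum_(0 <= i <oo | live D i) (f i)%:E =
    (f j)%:E + \sum_(0 <= i <oo | live (j :: D) i) (f i)%:E)%E.
  rewrite (@nneseriesD1 _ _ j (live D))//; congr (_ + _)%E.
  by apply: eq_eseriesl => i; rewrite /live inE negb_or andbA andbAC -andbA andbC.
rewrite [in RHS]ge0_muleDl// -IH.
rewrite [RHS]ge0_muleDr ?mule_ge0 ?adde_ge0 ?mule_ge0//.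
rewrite [X in (_ = _ + X)%E]ge0_muleDr ?adde_ge0 ?mule_ge0//.
rewrite [X in (_ = _ + (X + _))%E]ge0_muleDr ?adde_ge0 ?mule_ge0//.
rewrite muleA -EFinM [w b j * f j]mulrC.
rewrite [RHS]addeC -!addeA; congr (_ + (_ + _))%E.
by rewrite addeC.
all: do ?exact: F0.
all: by move=> i _ _; do ?[apply: adde_ge0 => //]; by [exact: FE0|rewrite !mule_ge0].
Qed.


(** With [f := w a]: the case of an entry in front. *)
Lemma isum_cons_collision a (C : T -> seq T) (k : T -> R) l D :
  (forall b, 0 <= k b) ->
  (forall b i, w a i.+1 * w b i.+1 = \sum_(c <- C b) w c i.+1 + k b * w b i.+1) ->
  (forall b, \sum_(c <- C b) w c 0%N + k b * w b 0%N = 0) ->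
  (isum w (a :: l) D + \sum_(l' <- bumps C l) isum w l' D +
   (\sum_(b <- l) k b)%:E * isum w l D =
   ((w a 0)%:E + \sum_(0 <= i <oo | live D i) (w a i)%:E) * isum w l D)%E.
Proof.
move=> k0 H H0; rewrite ge0_muleDl//; last by apply: nneseries_ge0 => *.
by rewrite -(@isum_collision _ C k)//= -!addeA.
Qed.

End collisions.

Section comparison.
Context {R : realType} {T : Type}.
Implicit Types (w v : T -> nat -> R).

Lemma isum_scale w (s : T -> R) l D :
  (forall a i, 0 <= w a i) -> (forall a, 0 <= s a) ->
  isum (fun a i => s a * w a i) l D = ((\prod_(a <- l) s a)%:E * isum w l D)%E.
Proof.
move=> w0 s0; elim: l D => [|a l IH] D /=; first by rewrite big_nil mul1e.
have p0 : (0 <= \prod_(b <- l) s b)%R by exact: prodr_ge0.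
have wE i D' : (0 <= (w a i)%:E * isum w l D')%E.
  by rewrite mule_ge0 ?lee_fin// isum_ge0.
rewrite big_cons ge0_muleDr//; last by apply: nneseries_ge0.
rewrite IH; congr (_ + _)%E.
  by rewrite !EFinM muleACA.
rewrite -nneseriesZl//; apply: eq_eseriesr => i _.
by rewrite IH !EFinM muleACA.
Qed.

(** The weights are changed one entry at a time; all the other entries together
    contribute a factor at most 1, since every weight has total at most 1. *)
Lemma isum_compare w v (e : T -> R) l D :
  (forall a i, 0 <= v a i) -> (forall a i, v a i <= w a i) ->
  (forall a, 0 <= e a) ->
  (forall a, \sum_(0 <= i <oo) (w a i)%:E <= 1)%E ->
  (forall a, \sum_(0 <= i <oo) (w a i - v a i)%:E <= (e a)%:E)%E ->
  (isum v l D <= isum w l D <= isum v l D + (\sum_(a <- l) e a)%:E)%E.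
Proof.
move=> v0 vw e0 w1 we.
have w0 a i : 0 <= w a i by exact: le_trans (v0 a i) (vw a i).
have vE0 a i : (0 <= (v a i)%:E)%E by rewrite lee_fin.
have wE0 a i : (0 <= (w a i)%:E)%E by rewrite lee_fin.
have wfin a : (\sum_(0 <= i <oo) (w a i)%:E < +oo)%E.
  by apply: le_lt_trans (w1 a) _; rewrite ltry.
have I0 l' D' : (0 <= isum v l' D')%E by exact: isum_ge0.
have J0 l' D' : (0 <= isum w l' D')%E by exact: isum_ge0.
elim: l D => [|a l IH] D; first by rewrite big_nil adde0 /= lexx.
have I1 D' : (isum v l D' <= 1)%E.
  have /andP[/le_trans + _] := IH D'; apply.
  apply: le_trans (isum_le w0 wfin l D') _.
  elim: l {IH} => [|b l IH]; first by rewrite big_nil.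
  by rewrite big_cons -[leRHS]mule1 lee_pmul ?w1 ?prode_ge0// => *; exact: tot_ge0.
have wv0 i : (0 <= (w a i - v a i)%:E)%E by rewrite lee_fin subr_ge0.
apply/andP; split.
  rewrite /=; apply: leeD.
    by apply: lee_pmul => //; [rewrite lee_fin|case/andP: (IH D)].
  apply: lee_nneseries => [i _ _|i _]; first exact: mule_ge0.
  by apply: lee_pmul => //; [rewrite lee_fin|case/andP: (IH (i :: D))].
set E := \sum_(b <- l) e b; have E0 : (0 <= E%:E)%E by rewrite lee_fin sumr_ge0.
have step D' i : ((w a i)%:E * isum w l D' <=
  (v a i)%:E * isum v l D' + (w a i - v a i)%:E + (w a i)%:E * E%:E)%E.
  apply: (@le_trans _ _ ((w a i)%:E * (isum v l D' + E%:E))%E).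
    by apply: lee_wpmul2l => //; case/andP: (IH D').
  rewrite ge0_muleDr//; apply: leeD => //.
  have -> : (w a i)%:E = ((v a i)%:E + (w a i - v a i)%:E)%E.
    by rewrite -EFinD addrC subrK.
  rewrite ge0_muleDl//; apply: leeD => //.
  by rewrite -[leRHS]mule1; exact: lee_wpmul2l.
rewrite big_cons -/E /=.
apply: (@le_trans _ _
  (((v a 0)%:E * isum v l D + (w a 0 - v a 0)%:E + (w a 0)%:E * E%:E) +
   \sum_(0 <= i <oo | live D i) ((v a i)%:E * isum v l (i :: D) +
     (w a i - v a i)%:E + (w a i)%:E * E%:E))%E).
  apply: leeD; first exact: step.
  by apply: lee_nneseries => [i _ _|i _]; [exact: mule_ge0|exact: step].
rewrite !nneseriesD; do ?by move=> *; rewrite ?adde_ge0 ?mule_ge0.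
rewrite addeACA [X in (X + _ <= _)%E]addeACA -addeA leeD2l// [leRHS]EFinD.
apply: leeD.
  apply: le_trans (we a).
  exact: (@tot_live R unit (fun _ i => w a i - v a i) (fun _ i => wv0 i) tt D).
rewrite [X in (_ + X <= _)%E](_ : _ =
    E%:E * \sum_(0 <= i <oo | live D i) (w a i)%:E)%E; last first.
  by rewrite -nneseriesZl//; apply: eq_eseriesr => i _; rewrite muleC.
rewrite muleC -ge0_muleDr//; last by apply: nneseries_ge0.
rewrite -[leRHS]mule1 lee_wpmul2l//.
by apply: le_trans (w1 a); exact: tot_live.
Qed.

End comparison.

(** * The injective choices as functions *)

Definition live_injections r (D : seq nat) : set {ffun 'I_r -> nat} :=
  [set iota | injective iota /\ forall h, live D (iota h)].
Arguments live_injections : clear implicits.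

Section injections.
Context {R : realType} {T : Type}.
Variable w : T -> nat -> R.
Hypothesis w_ge0 : forall a i, 0 <= w a i.
Hypothesis w_0 : forall a, w a 0%N = 0.

(** An injection on [r.+1] points amounts to its first value and an injection of
    the remaining points avoiding that value. *)
Lemma live_injections_bij r D :
  set_bij (live_injections r.+1 D)
    ([set i | live D i] `*`` (fun i => live_injections r (i :: D)))
    (fun iota => (iota ord0, [ffun h => iota (lift ord0 h)])).
Proof.
split.
- move=> iota [inj lv]; split => /=; first exact: lv.
  split=> [h k|h]; rewrite !ffunE; first by move=> /inj/lift_inj.
  rewrite /live inE negb_or; have /andP[-> ->] := lv (lift ord0 h).
  by rewrite andbT /= (inj_eq inj).
- move=> f g _ _ [f0 /ffunP fg]; apply/ffunP => h.
  by case: (unliftP ord0 h) => [h' ->|->//]; have := fg h'; rewrite !ffunE.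
- move=> [i f] /= [lvi [inj lv]].
  exists [ffun h => oapp f i (unlift ord0 h)].
    split=> [h k|h]; rewrite !ffunE.
      case: (unliftP ord0 h) => [h' ->|->]; case: (unliftP ord0 k) => [k' ->|->] //=.
      + by move=> /inj ->.
      + by move=> e; have := lv h'; rewrite /live inE negb_or e eqxx andbF.
      + by move=> e; have := lv k'; rewrite /live inE negb_or -e eqxx andbF.
    case: (unliftP ord0 h) => [h' _|_] //=.
    by have := lv h'; rewrite /live inE negb_or => /andP[-> /andP[]].
  by congr pair; [rewrite ffunE unlift_none|apply/ffunP => h; rewrite !ffunE liftK].
Qed.

(** The factor [c] is there for the induction: it collects the weights of the
    indices already chosen. *)
Lemma isum_esum (t0 : T) (c : R) (l : seq T) D : 0 <= c ->
  (c%:E * isum w l D = \esum_(iota in live_injections (size l) D)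
     (c * \prod_(h < size l) w (nth t0 l h) (iota h))%:E)%E.
Proof.
elim: l c D => [|a l IH] c D c0.
  rewrite mule1 /= (_ : live_injections 0 D = [set [ffun=> 0%N]]).
    by rewrite esum_set1 big_ord0 ?mulr1 ?lee_fin.
  by apply/seteqP; split=> [f _|f ->]; [apply/ffunP; case|split; case].
rewrite [isum _ _ _]/= w_0 mul0e add0e.
rewrite -nneseriesZl; last by move=> i _; rewrite isum_term_ge0.
under eq_eseriesr => i _ do rewrite muleA -EFinM IH ?mulr_ge0//.
rewrite nneseries_esum; last first.
  by move=> i _; apply: esum_ge0 => f _; rewrite lee_fin !mulr_ge0// prodr_ge0.
rewrite esum_esum; last first.
  by move=> *; rewrite lee_fin !mulr_ge0// prodr_ge0.
rewrite (@reindex_esum _ _ _ _ _ _ _ (live_injections_bij _ D)).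
apply: eq_esum => f _ /=; rewrite big_ord_recl mulrA; congr (_ * _)%:E.
by apply: eq_bigr => h _; rewrite ffunE.
Qed.

End injections.

Section sums.
Context {R : realType} {T I : Type}.
Variable w : T -> nat -> R.
Hypothesis w_ge0 : forall a i, 0 <= w a i.

(** The dust is resummed by induction on the partition, adding one entry in front
    of all terms of a linear combination of sums. *)
Lemma isum_cons_sum (r : seq I) (P : pred I) (c : I -> R) (g : I -> seq T) a D :
  (forall s, 0 <= c s) ->
  (\sum_(s <- r | P s) (c s)%:E * isum w (a :: g s) D =
   (w a 0)%:E * \sum_(s <- r | P s) (c s)%:E * isum w (g s) D +
   \sum_(0 <= i <oo | live D i)
     (w a i)%:E * \sum_(s <- r | P s) (c s)%:E * isum w (g s) (i :: D))%E.
Proof.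
move=> c0.
have t0 s D' : (0 <= (c s)%:E * isum w (g s) D')%E.
  by rewrite mule_ge0 ?lee_fin// isum_ge0.
have p0 s i D' : (0 <= (w a i)%:E * ((c s)%:E * isum w (g s) D'))%E.
  by rewrite mule_ge0 ?lee_fin.
transitivity (\sum_(s <- r | P s) ((w a 0)%:E * ((c s)%:E * isum w (g s) D) +
  \sum_(0 <= i <oo | live D i) (w a i)%:E * ((c s)%:E * isum w (g s) (i :: D))))%E.
  apply: eq_bigr => s _ /=; rewrite ge0_muleDr.
  - rewrite muleCA -nneseriesZl; last by move=> *; exact: isum_term_ge0.
    by congr (_ + _)%E; apply: eq_eseriesr => i _; rewrite muleCA.
  - exact: isum_term_ge0.
  - by apply: nneseries_ge0 => *; exact: isum_term_ge0.
rewrite big_split/= ge0_sume_distrr//; congr (_ + _)%E.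
transitivity (\sum_(s <- r | P s) \sum_(0 <= i <oo) if live D i then
    (w a i)%:E * ((c s)%:E * isum w (g s) (i :: D)) else 0)%E.
  by apply: eq_bigr => s _; rewrite eseries_mkcond.
rewrite -nneseries_sum; last by move=> s i _; case: ifP.
rewrite [RHS]eseries_mkcond; apply: eq_eseriesr => i _; case: ifP => _.
  by rewrite ge0_sume_distrr.
by rewrite big1.
Qed.

End sums.

(** * Multi-indices, partitions and dust *)

Section indices.
Context {q : nat}.
Implicit Types (a : mindex q) (b : nzindex q) (A B C : cpart q) (j : 'I_q).

Lemma msum_idxD (a b : mindex q) : msum_idx (a + b) = (msum_idx a + msum_idx b)%N.
Proof. by rewrite /msum_idx -big_split; apply: eq_bigr => j _; rewrite ffunE. Qed.

Lemma msum_unit j : msum_idx (unit_idx j) = 1%N.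
Proof.
rewrite /msum_idx (bigD1 j)//= ffunE eqxx big1 ?addn0// => k kj.
by rewrite ffunE (negbTE kj).
Qed.

Lemma msum_idx_eq0 a : (msum_idx a == 0%N) = (a == 0).
Proof.
rewrite /msum_idx sum_nat_eq0; apply/forallP/eqP => [a0|-> j]; last first.
  by rewrite ffunE implybT.
by apply/ffunP => j; rewrite ffunE; apply/eqP; exact: a0.
Qed.

Lemma msum_idx_gt0 b : (0 < msum_idx (val b))%N.
Proof. by rewrite lt0n msum_idx_eq0; exact: (valP b). Qed.

Lemma nz_unit_inj : injective (@nz_unit q).
Proof.
move=> j k /(congr1 val) /= /ffunP/(_ j); rewrite !ffunE eqxx.
by case: eqP.
Qed.

Lemma msum_idx_eq1 b :
  (msum_idx (val b) == 1%N) = [exists j, b == nz_unit j].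
Proof.
apply/eqP/existsP => [b1|[j /eqP->]]; last exact: msum_unit.
have [j bj] : exists j, (0 < val b j)%N.
  apply/existsP; rewrite -[X in is_true X]negbK negb_exists; apply/negP => /forallP b0.
  move: b1; rewrite /msum_idx big1// => j _.
  by apply/eqP; rewrite -leqn0 leqNgt.
exists j; apply/eqP/val_inj/ffunP => k /=; rewrite ffunE.
move: b1; rewrite /msum_idx (bigD1 j)//=; case: eqP => [->|/eqP kj].
  by move: bj; case: (val b j) => // n _; rewrite addSn => -[]; case: n.
move: bj; case: (val b j) => // n _; rewrite addSn => -[] /eqP.
by rewrite addn_eq0 sum_nat_eq0 => /andP[_ /forallP/(_ k)]; rewrite kj => /eqP.
Qed.

Lemma dustE (m : mindex q) b :
  dust m b = (\sum_(j < q) (b == nz_unit j) * m j)%N.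
Proof.
rewrite /dust (big_morph (fun A : cpart q => A b) (op1 := addn) (id1 := 0%N)).
- by apply: eq_bigr => j _; rewrite msetnE; case: eqP; rewrite ?mul1n.
- by move=> A B; rewrite msetE2.
- by rewrite mset0E.
Qed.

Lemma dust_unit (m : mindex q) j : dust m (nz_unit j) = m j.
Proof.
rewrite dustE (bigD1 j)//= eqxx mul1n big1 ?addn0// => k kj.
by rewrite (inj_eq nz_unit_inj) eq_sym (negbTE kj).
Qed.

Lemma dust_nonunit (m : mindex q) b :
  ~~ [exists j, b == nz_unit j] -> dust m b = 0%N.
Proof.
rewrite negb_exists => /forallP bj; rewrite dustE big1// => j _.
by rewrite (negbTE (bj j)).
Qed.

Lemma dust_sub (m : mindex q) A :
  (dust m `<=` A)%mset = [forall j, (m j <= A (nz_unit j))%N].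
Proof.
apply/msubsetP/forallP => [mA j|mA b]; first by rewrite -dust_unit.
have [/existsP[j /eqP->]|/dust_nonunit->//] := boolP [exists j, b == nz_unit j].
by rewrite dust_unit.
Qed.

Lemma parts_perm A : perm_eq (parts A) [seq val b | b <- enum_mset A].
Proof. by rewrite /parts perm_map// perm_sort. Qed.

Lemma enum_mset_cons b A :
  perm_eq (enum_mset (b +` A)%mset) (b :: enum_mset A).
Proof.
by rewrite -{1}(seq_mset_id A) -mset_cons perm_eq_seq_mset.
Qed.

Lemma psizeE A : psize A = (\sum_(b <- enum_mset A) msum_idx (val b))%N.
Proof. by rewrite -sum_parts (perm_big _ (parts_perm A)) big_map. Qed.

Lemma psize0 : psize (mset0 : cpart q) = 0%N.
Proof. by rewrite psizeE enum_mset0 big_nil. Qed.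

Lemma psize_cons b A : psize (b +` A)%mset = (msum_idx (val b) + psize A)%N.
Proof. by rewrite !psizeE (perm_big _ (enum_mset_cons b A)) big_cons. Qed.

Lemma cpart_ind (Q : cpart q -> Prop) : Q mset0 ->
  (forall b A, Q A -> Q (b +` A)%mset) -> forall A, Q A.
Proof.
move=> Q0 QS A; rewrite -(seq_mset_id A); elim: (enum_mset A) => [|b s IH].
  rewrite (_ : seq_mset [::] = mset0)//.
  by apply/msetP => b; rewrite mset_seqE mset0E.
by rewrite mset_cons; exact: QS.
Qed.

Lemma psizeD A B : psize (A `+` B)%mset = (psize A + psize B)%N.
Proof.
elim/cpart_ind: A => [|b A IH].
  by rewrite mset0D psize0.
by rewrite -msetDA !psize_cons IH addnA.
Qed.

Lemma psize_dust (m : mindex q) : psize (dust m) = msum_idx m.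
Proof.
rewrite /dust (big_morph psize (op1 := addn) (id1 := 0%N)); last 2 first.
- exact: psizeD.
- exact: psize0.
apply: eq_bigr => j _; rewrite psizeE enum_msetn big_nseq.
by rewrite iter_addn_0 /= msum_unit mul1n.
Qed.

Lemma psizeB A B : (B `<=` A)%mset -> psize (A `\` B)%mset = (psize A - psize B)%N.
Proof. by move=> BA; rewrite -[in RHS](msetBDK BA) psizeD addnK. Qed.

End indices.

(** * The functions of the Kingman simplex as sums over injective choices *)

Section paintbox.
Context {R : realType} {q : nat}.
Implicit Types (a : mindex q) (b : nzindex q) (A B C : cpart q) (j : 'I_q).
Variable x : nat -> 'rV[R]_q.
Hypothesis x_ge0 : forall i j, 0 <= x i 0 j.

(** The weight of an index in the sums defining [phi] and [psi]; the dust, at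
    index 0, only produces singletons. *)
Definition pweight b (i : nat) : R :=
  if i is 0 then if msum_idx (val b) == 1%N then mono (x 0%N) (val b) else 0
  else mono (x i) (val b).

(** The weights in [phi], where the dust is absent. *)
Definition pweight0 b (i : nat) : R := if i is 0 then 0 else mono (x i) (val b).

Lemma mono_ge0 (u : 'rV[R]_q) a : (forall j, 0 <= u 0 j) -> 0 <= mono u a.
Proof. by move=> u0; apply: prodr_ge0 => j _; rewrite exprn_ge0. Qed.

Lemma mono_unit (u : 'rV[R]_q) j : mono u (unit_idx j) = u 0 j.
Proof.
rewrite /mono (bigD1 j)//= ffunE eqxx expr1 big1 ?mulr1// => k kj.
by rewrite ffunE (negbTE kj).
Qed.

Lemma mono_add (u : 'rV[R]_q) (a a' : mindex q) :
  mono u (a + a') = mono u a * mono u a'.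
Proof. by rewrite /mono -big_split; apply: eq_bigr => j _; rewrite ffunE exprD. Qed.

Lemma pweight_ge0 b i : 0 <= pweight b i.
Proof. by case: i => [|i] /=; [case: ifP => // _|]; exact: mono_ge0. Qed.

Lemma pweight0_ge0 b i : 0 <= pweight0 b i.
Proof. by case: i => [|i] //=; exact: mono_ge0. Qed.

(** The symmetry factor common to [phi] and [psi]. *)
Definition pf A : R :=
  \prod_(a <- finsupp A) ((mfact (val a))%:R ^+ A a * (A a)`!%:R)^-1.

Lemma phiE A : phi A x = (psize A)`!%:R * pf A *
  fine (isum pweight0 (enum_mset A) [::]).
Proof.
rewrite /phi; congr (_ * _ * fine _).
pose w (a : mindex q) i : R := if i is 0 then 0 else mono (x i) a.
have w0 a i : 0 <= w a i by case: i => [|i] //=; exact: mono_ge0.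
rewrite -(@eq_in_isum _ _ _ w _ val)// -(isum_perm _ w0 (parts_perm A)).
rewrite -[RHS]mul1e (isum_esum w0 _ 0)//.
rewrite (_ : live_injections _ _ = @pos_injections (size (parts A))); last first.
  apply/seteqP; split=> i [inj lv]; split => // h; have := lv h;
  by rewrite /live ?in_nil ?andbT.
apply: eq_esum => f [_ f0]; rewrite mul1r; congr EFin; apply: eq_bigr => h _.
by have := f0 h; case: (f h).
Qed.

(** For each color [j], the choice of the [m j] singletons that go to the dust,
    with their weight. *)
Definition dust_coef A (m : mindex q) : R :=
  \prod_(j < q) ('C(A (nz_unit j), m j)%:R * x 0%N 0 j ^+ m j).

Lemma dust_coef_ge0 A m : 0 <= dust_coef A m.
Proof. by apply: prodr_ge0 => j _; rewrite mulr_ge0 ?exprn_ge0. Qed.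

Lemma dust_coef_eq0 A m : ~~ (dust m `<=` A)%mset -> dust_coef A m = 0.
Proof.
rewrite dust_sub negb_forall => /existsP[j]; rewrite -ltnNge => mj.
by rewrite /dust_coef (bigD1 j)//= bin_small// !mul0r.
Qed.

(** A bounded range of exponents, over which finite sums can be taken. *)
Definition nat_ffun N (m : {ffun 'I_q -> 'I_N}) : mindex q := [ffun j => m j : nat].

(** Pascal's rule: an added singleton either stays away from the dust or goes
    there. *)
Lemma dust_coef_unit A (m : mindex q) j :
  dust_coef (nz_unit j +` A)%mset m = dust_coef A m +
    (if (0 < m j)%N then x 0%N 0 j * dust_coef A [ffun k => m k - (k == j)]%N else 0).
Proof.
rewrite /dust_coef (bigD1 j)//= [in RHS](bigD1 j)//=.
have E k : k != j -> ((nz_unit j +` A)%mset (nz_unit k) = A (nz_unit k)).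
  by move=> kj; rewrite mset1DE (inj_eq nz_unit_inj) (negbTE kj).
rewrite (eq_bigr (fun k => ('C(A (nz_unit k), m k)%:R * x 0%N 0 k ^+ m k))); last first.
  by move=> k kj; rewrite E.
rewrite [X in if _ then _ * X else _](bigD1 j)//=.
rewrite [X in if _ then _ * (_ * X) else _](eq_bigr
   (fun k => ('C(A (nz_unit k), m k)%:R * x 0%N 0 k ^+ m k))); last first.
  by move=> k kj; rewrite ffunE (negbTE kj) subn0.
rewrite mset1DE eqxx add1n ffunE eqxx; case: (m j) => [|k] /=.
  by rewrite addr0 !bin0.
by rewrite binS natrD subn1 /= mulrDl mulrDl exprS; congr (_ + _);
   rewrite mulrCA !mulrA.
Qed.

(** Each singleton is split between the dust and the positive indices; [m]
    counts, for each color, those taken from the dust. *)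
Lemma isum_dust (N : nat) A D : (forall j, (A (nz_unit j) <= N)%N) ->
  isum pweight (enum_mset A) D =
  (\sum_(m : {ffun 'I_q -> 'I_N.+1}) (dust_coef A (nat_ffun m))%:E *
    isum pweight0 (enum_mset (A `\` dust (nat_ffun m))%mset) D)%E.
Proof.
elim/(@cpart_ind q): A D => [|b A IH] D AN.
  rewrite enum_mset0 (bigD1 [ffun=> ord0])//= big1 => [|m m0].
    rewrite mset0B enum_mset0 adde0 /dust_coef big1 ?mul1e// => j _.
    by rewrite !ffunE expr0 mulr1 mset0E bin0.
  rewrite [dust_coef _ _]dust_coef_eq0 ?mul0e//; apply: contra m0.
  rewrite dust_sub => /forallP m0; apply/eqP/ffunP => j.
  by rewrite ffunE; apply/val_inj/eqP; have := m0 j; rewrite mset0E leqn0 ffunE.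
have AN' j : (A (nz_unit j) <= N)%N.
  by apply: leq_trans (AN j); rewrite mset1DE leq_addl.
rewrite (isum_perm _ pweight_ge0 (enum_mset_cons b A)).
(* the parts which stay away from the dust *)
have stay m : ((dust_coef A (nat_ffun m))%:E *
    isum pweight0 (enum_mset ((b +` A) `\` dust (nat_ffun (N := N.+1) m))%mset) D =
  (dust_coef A (nat_ffun m))%:E *
    isum pweight0 (b :: enum_mset (A `\` dust (nat_ffun m))%mset) D)%E.
  have [mA|/dust_coef_eq0->] := boolP (dust (nat_ffun m) `<=` A)%mset.
    by rewrite -msetDBA// (isum_perm _ pweight0_ge0 (enum_mset_cons _ _)).
  by rewrite !mul0e.
have pos : (\sum_(0 <= i <oo | live D i)
    (pweight b i)%:E * isum pweight (enum_mset A) (i :: D) =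
  \sum_(m : {ffun 'I_q -> 'I_N.+1}) (dust_coef A (nat_ffun m))%:E *
    isum pweight0 (enum_mset ((b +` A) `\` dust (nat_ffun m))%mset) D)%E.
  under [RHS]eq_bigr do rewrite stay.
  rewrite isum_cons_sum; [|exact: pweight0_ge0|by move=> m; exact: dust_coef_ge0].
  rewrite mul0e add0e; apply: eq_eseriesr => -[//|i] _.
  by rewrite IH.
(* only a singleton can go to the dust *)
rewrite [LHS]/= pos {pos} msum_idx_eq1.
have [/existsP[j /eqP bE]|b1] := boolP [exists j, b == nz_unit j]; last first.
  rewrite mul0e add0e; apply: eq_bigr => m _; congr ((_)%:E * _)%E.
  apply: eq_bigr => j _; rewrite mset1DE (_ : (_ == b) = false)//.
  by apply: contraNF b1 => /eqP jb; apply/existsP; exists j; rewrite eq_sym jb.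
subst b; rewrite IH// [in RHS](eq_bigr (fun m : {ffun 'I_q -> 'I_N.+1} =>
  (dust_coef A (nat_ffun m))%:E *
    isum pweight0 (enum_mset ((nz_unit j +` A) `\` dust (nat_ffun m))%mset) D +
  if (0 < m j)%N then
    (x 0%N 0 j * dust_coef A [ffun k => nat_ffun m k - (k == j)]%N)%:E *
    isum pweight0 (enum_mset ((nz_unit j +` A) `\` dust (nat_ffun m))%mset) D else 0)%E);
    last first.
  move=> m _; rewrite dust_coef_unit [nat_ffun m j]ffunE; case: ifP => _; last by rewrite adde0 (addr0 (dust_coef A _)).
  rewrite EFinD ge0_muleDl// lee_fin ?dust_coef_ge0// mulr_ge0// dust_coef_ge0//.
rewrite big_split/= addeC; congr (_ + _)%E.
rewrite -big_mkcond/= mono_unit ge0_sume_distrr; last first.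
  move=> m _; rewrite mule_ge0 ?lee_fin ?dust_coef_ge0//.
  exact/isum_ge0/pweight0_ge0.
(* one more singleton of color j in the dust: shift m by the unit at j *)
pose h (m : {ffun 'I_q -> 'I_N.+1}) : {ffun 'I_q -> 'I_N.+1} :=
  [ffun k => if k == j then inord (m k).+1 else m k].
pose h' (m : {ffun 'I_q -> 'I_N.+1}) : {ffun 'I_q -> 'I_N.+1} :=
  [ffun k => if k == j then inord (m k).-1 else m k].
rewrite [RHS](reindex_onto h h'); last first.
  move=> m mj; apply/ffunP => k; rewrite !ffunE; case: eqP => // ->.
  have pj : (m j).-1 = (inord (m j).-1 : 'I_N.+1) :> nat.
    by rewrite inordK// (leq_ltn_trans (leq_pred _))// ltn_ord.
  by apply/val_inj; rewrite /= inordK -pj prednK// ltn_ord.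
rewrite (bigID (fun m : {ffun 'I_q -> 'I_N.+1} => (m j < N)%N))/=.
rewrite [X in (_ + X)%E]big1 ?adde0; last first.
  move=> m; rewrite -leqNgt => mj; rewrite dust_coef_eq0 ?mul0e ?mule0//.
  rewrite dust_sub negb_forall; apply/existsP; exists j; rewrite ffunE -ltnNge.
  by apply: leq_trans mj; have := AN j; rewrite mset1DE eqxx.
apply: eq_big => m.
  rewrite ffunE eqxx; apply/idP/andP => [mj|[mj /eqP/ffunP/(_ j)]].
    rewrite inordK//; split=> //; apply/eqP/ffunP => k; rewrite !ffunE.
    by case: eqP => // ->; apply/val_inj; rewrite /= inordK inordK//= ltnW.
  rewrite !ffunE eqxx => /(congr1 val) /=.
  have [|mN] := ltnP (m j) N; first by [].
  by move: mj; rewrite /inord /insubd insubF ?ltnS// ltnNge mN.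
move=> mj; rewrite muleA -EFinM.
rewrite (_ : dust (nat_ffun (h m)) = nz_unit j +` dust (nat_ffun m))%mset; last first.
  apply/msetP => c; rewrite mset1DE !dustE.
  rewrite (bigD1 j)//= [in RHS](bigD1 j)//= !ffunE eqxx inordK//.
  rewrite mulnS addnA; congr (_ + _ + _)%N.
  by apply: eq_bigr => k kj; rewrite !ffunE (negbTE kj).
rewrite msetBDl; congr ((_ * dust_coef A _)%:E * _)%E.
apply/ffunP => k; rewrite !ffunE.
case: eqP => [->|]; last by rewrite subn0.
by rewrite inordK// subn1.
Qed.


Hypothesis x_fin : forall b, (\sum_(0 <= i <oo) (pweight0 b i)%:E < +oo)%E.

Lemma mfact_unit j : mfact (unit_idx j) = 1%N.
Proof.
by rewrite /mfact big1// => k _; rewrite ffunE; case: (k == j).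
Qed.

(** The singletons contribute inverse factorials, the other parts do not see
    the dust. *)
Lemma pf_dust A (m : mindex q) : (dust m `<=` A)%mset ->
  pf (A `\` dust m)%mset / (mfact m)%:R =
  pf A * \prod_(j < q) 'C(A (nz_unit j), m j)%:R.
Proof.
move=> mA.
pose U := [fset nz_unit j | j in 'I_q]%fset.
pose S := (finsupp A `|` U)%fset.
pose F C b : R := ((mfact (val b))%:R ^+ C b * (C b)`!%:R)^-1.
have F1 C b : b \notin finsupp C -> F C b = 1.
  rewrite msuppE -mset_eq0 /F => /eqP->.
  by rewrite expr0 mul1r fact0 invr1.
have US b : (b \in U) = [exists j, b == nz_unit j].
  apply/imfsetP/existsP => [[j _ ->]|[j /eqP->]]; first by exists j.
  by exists j.
have E C : (finsupp C `<=` S)%fset ->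
    pf C = (\prod_(b <- S | b \notin U) F C b) * \prod_(j < q) (C (nz_unit j))`!%:R^-1.
  move=> CS; rewrite /pf (big_fset_incl _ CS); last by move=> b _; exact: F1.
  rewrite (bigID (mem U)) mulrC/=; congr (_ * _).
  have -> : \prod_(b <- S | b \in U) F C b = \prod_(b <- U) F C b.
    rewrite big_fset_condE/=; apply: eq_fbigl => b; rewrite !inE/=.
    by case: (b \in U); rewrite ?orbT ?andbF.
  rewrite big_imfset/=; last by move=> j k _ _; exact: nz_unit_inj.
  rewrite big_enum/=; apply: eq_bigr => j _.
  by rewrite /F /= mfact_unit expr1n mul1r.
have SA : (finsupp A `<=` S)%fset by exact: fsubsetUl.
have SB : (finsupp (A `\` dust m)%mset `<=` S)%fset.
  apply: fsubset_trans SA; apply/fsubsetP => b; rewrite !msuppE !in_mset msetE2.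
  by move=> /leq_trans; apply; exact: leq_subr.
rewrite (E _ SB) (E _ SA) -!mulrA; congr (_ * _).
  apply: eq_bigr => b bU; rewrite /F msetE2 dust_nonunit ?subn0//.
  by rewrite -US.
rewrite /mfact natr_prod -prodfV -!big_split/=; apply: eq_bigr => j _.
rewrite msetE2 dust_unit; move: mA; rewrite dust_sub => /forallP/(_ j) mj.
have f0 n : (n`!)%:R != 0 :> R by rewrite pnatr_eq0 -lt0n fact_gt0.
have := bin_fact mj; move/(congr1 (fun n : nat => n%:R : R)); rewrite !natrM => <-.
have C0 : 'C(A (nz_unit j), m j)%:R != 0 :> R by rewrite pnatr_eq0 -lt0n bin_gt0.
by rewrite !invfM mulrAC mulVf// mul1r mulrC.
Qed.

(** The terms of [psi] are those of [isum_dust], up to the factorials, which are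
    those of [pf_dust]. *)
Lemma psiE A : psi A x = (psize A)`!%:R * pf A *
  fine (isum pweight (enum_mset A) [::]).
Proof.
pose N := size (enum_mset A).
have AN j : (A (nz_unit j) <= N)%N.
  by rewrite -count_mem_mset count_size.
rewrite (isum_dust [::] AN).
have fE C D : (isum pweight0 (enum_mset C) D)%E =
    (fine (isum pweight0 (enum_mset C) D))%:E.
  by rewrite fineK// isum_fin//; exact: pweight0_ge0.
under eq_bigr do rewrite fE -EFinM.
rewrite sumEFin /= mulr_sumr.
rewrite [RHS](bigID (fun m : {ffun 'I_q -> 'I_N.+1} => dust (nat_ffun m) `<=` A)%mset)/=.
rewrite [X in _ + X]big1 ?addr0; last first.
  by move=> m /dust_coef_eq0 ->; rewrite mul0r mulr0.
pose r := [seq nat_ffun m | m <- index_enum {ffun 'I_q -> 'I_N.+1}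
  & (dust (nat_ffun m) `<=` A)%mset].
have injN : injective (@nat_ffun N.+1).
  move=> m m' /ffunP e; apply/ffunP => j; apply/val_inj.
  by have := e j; rewrite !ffunE.
have Pr m : ((dust m `<=` A)%mset) = (m \in r).
  apply/idP/mapP => [mA|[m' + ->]]; last by rewrite mem_filter => /andP[].
  have mE : m = @nat_ffun N.+1 [ffun j => inord (m j)].
    apply/ffunP => j; rewrite !ffunE inordK// ltnS.
    by move: mA; rewrite dust_sub => /forallP/(_ j)/leq_trans; exact.
  by exists [ffun j => inord (m j)]; rewrite // mem_filter mem_index_enum -mE mA.
rewrite /psi (_ : [set m | _] = [set` r]); last first.
  by apply/seteqP; split=> m /=; rewrite Pr.
rewrite -fsbig_seq; last first.
  by rewrite map_inj_uniq// filter_uniq// index_enum_uniq.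
rewrite big_map big_filter mulr_sumr; apply: eq_bigr => m mA.
rewrite phiE psizeB// psize_dust.
have f0 n : (n`!)%:R != 0 :> R by rewrite pnatr_eq0 -lt0n fact_gt0.
rewrite -!mulrA; congr (_ * _).
rewrite [RHS]mulrA [pf A * _](_ : _ = mono (x 0%N) (nat_ffun m) *
   (pf (A `\` dust (nat_ffun m))%mset / (mfact (nat_ffun m))%:R)); last first.
  by rewrite pf_dust// /dust_coef big_split/= [LHS]mulrA [LHS]mulrC.
rewrite -!mulrA; congr (_ * _); rewrite invfM -[LHS]mulrA mulKf//.
by rewrite mulrCA.
Qed.

End paintbox.

(** * Power sums *)

Section kingman_weights.
Context {R : realType} {q : nat}.
Implicit Types (a b : nzindex q) (l : seq (nzindex q)) (u : 'rV[R]_q).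

Lemma nz_add_subproof a b : val a + val b != 0.
Proof.
by rewrite -msum_idx_eq0 msum_idxD addn_eq0 negb_and -lt0n msum_idx_gt0.
Qed.

Definition nz_add a b : nzindex q := exist _ (val a + val b) (nz_add_subproof a b).

Lemma mono_le_l1 u b : corner R q u -> mono u (val b) <= l1 u.
Proof.
move=> [u01 _]; have [j bj] : exists j, (0 < val b j)%N.
  have := msum_idx_gt0 b; rewrite lt0n sum_nat_eq0 negb_forall => /existsP[j].
  by rewrite -lt0n; exists j.
have u0 k : 0 <= u 0 k by case/andP: (u01 k).
have u1 k : u 0 k <= 1 by case/andP: (u01 k).
apply: le_trans (coord_le_l1 u j); rewrite ger0_norm//.
rewrite /mono (bigD1 j)//= -[leRHS]mulr1; apply: ler_pM.
- exact: exprn_ge0.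
- by apply: prodr_ge0 => k _; exact: exprn_ge0.
- by case: (val b j) bj => // n _; rewrite exprS ler_piMr// exprn_ile1.
- by apply: prodr_ile1 => k _; rewrite exprn_ge0 ?exprn_ile1.
Qed.

Variable x : kingman_seq R q.

Lemma kseq_ge0 i j : 0 <= sval x i 0 j.
Proof. by have [] := kingmanP x. Qed.

Lemma kseq_corner i : corner R q (sval x i).
Proof. exact/set_mem/kingman_corner. Qed.

Lemma pweight_le b i : pweight (sval x) b i <= l1 (sval x i).
Proof.
case: i => [|i] /=; last exact: mono_le_l1 (kseq_corner _).
case: ifP => _; first exact: mono_le_l1 (kseq_corner _).
exact: l1_ge0.
Qed.

Lemma pweight0_le b i : pweight0 (sval x) b i <= l1 (sval x i).
Proof.
by case: i => [|i] /=; [exact: l1_ge0|exact: mono_le_l1 (kseq_corner _)].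
Qed.

Lemma pweight_tot b : (\sum_(0 <= i <oo) (pweight (sval x) b i)%:E <= 1)%E.
Proof.
have [_ _ <-] := kingmanP x; apply: lee_nneseries => [i _ _|i _].
  by rewrite lee_fin pweight_ge0//; exact: kseq_ge0.
by rewrite lee_fin pweight_le.
Qed.

Lemma pweight_fin b : (\sum_(0 <= i <oo) (pweight (sval x) b i)%:E < +oo)%E.
Proof. by apply: le_lt_trans (pweight_tot b) _; rewrite ltry. Qed.

Lemma pweight0_fin b : (\sum_(0 <= i <oo) (pweight0 (sval x) b i)%:E < +oo)%E.
Proof.
have [_ _ x1] := kingmanP x.
apply: (@le_lt_trans _ _ 1%E); last by rewrite ltry.
rewrite -x1; apply: lee_nneseries => [i _ _|i _].
  by rewrite lee_fin pweight0_ge0//; exact: kseq_ge0.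
by rewrite lee_fin pweight0_le.
Qed.

(** The dust only contributes to the exponents of total degree 1, for which this is
    a coordinate of the total mass. *)
Definition powersum b : R := fine (\sum_(0 <= i <oo) (pweight (sval x) b i)%:E)%E.

Lemma powersumE b :
  (\sum_(0 <= i <oo) (pweight (sval x) b i)%:E)%E = (powersum b)%:E.
Proof. exact/esym/fineK/(tot_fin (pweight_ge0 kseq_ge0) pweight_fin). Qed.

Lemma isum_pweight_fin l D : isum (pweight (sval x)) l D \is a fin_num.
Proof. exact/isum_fin/pweight_fin/pweight_ge0/kseq_ge0. Qed.

End kingman_weights.

Lemma sum_live0 {R : realType} (f : nat -> R) : (forall i, 0 <= f i) ->
  ((f 0%N)%:E + \sum_(0 <= i <oo | live [::] i) (f i)%:E =
   \sum_(0 <= i <oo) (f i)%:E)%E.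
Proof.
move=> f0; rewrite [RHS](@nneseriesD1 _ _ 0%N xpredT)//; last first.
  by move=> k _; rewrite lee_fin.
by congr (_ + _)%E; apply: eq_eseriesl => -[|i]; rewrite /live ?andbT.
Qed.

Section power_polynomial.
Context {R : realType} {q : nat}.
Implicit Types (a b : nzindex q) (l : seq (nzindex q)) (g : nzindex q -> R).

(** The expression of the sum over injective choices as a polynomial in the
    power sums; [n] bounds the length of [l]. *)
Fixpoint power_poly n g l : R :=
  if n is n'.+1 then
    if l is a :: l' then
      g a * power_poly n' g l' -
        \sum_(l'' <- bumps (fun b => [:: nz_add a b]) l') power_poly n' g l''
    else 1
  else 1.

Lemma size_bumps_in a l l' :
  l' \in bumps (fun b => [:: nz_add a b]) l -> size l' = size l.
Proof.
elim: l l' => //= b l IH l'; rewrite inE => /orP[/eqP->//|/mapP[l'' /IH + ->]].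
by move=> /= ->.
Qed.

(** A free choice of the index of [a] contributes a power sum; when it collides
    with the index of [b] the two monomials merge into the one of exponent [a + b].
    Merged exponents have total degree at least 2, so they do not see the dust. *)
Lemma isum_power_poly (x : kingman_seq R q) n l : (size l <= n)%N ->
  isum (pweight (sval x)) l [::] = (power_poly n (powersum x) l)%:E.
Proof.
elim: n l => [|n IH] [|a l]//= ln.
have w0 := pweight_ge0 (kseq_ge0 x).
set C := fun b => [:: nz_add a b].
have H b i : pweight (sval x) a i.+1 * pweight (sval x) b i.+1 =
    \sum_(c <- C b) pweight (sval x) c i.+1 + 0 * pweight (sval x) b i.+1.
  by rewrite big_seq1 mul0r addr0 /= mono_add.
have H0 b : \sum_(c <- C b) pweight (sval x) c 0%N + 0 * pweight (sval x) b 0%N = 0.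
  rewrite big_seq1 mul0r addr0 /= msum_idxD ifF//.
  have := msum_idx_gt0 a; have := msum_idx_gt0 b; case: msum_idx => // k _.
  by case: msum_idx => // k' _; rewrite addnS.
have E : (isum (pweight (sval x)) (a :: l) [::] +
    \sum_(l' <- bumps C l) isum (pweight (sval x)) l' [::] =
    (powersum x a)%:E * isum (pweight (sval x)) l [::])%E.
  rewrite -powersumE -(sum_live0 (w0 a)).
  rewrite -(isum_cons_collision w0 (pweight_fin x) l [::] (fun=> lexx 0) H H0).
  by rewrite [X in (_ + X%:E * _)%E]big1// mul0e adde0.
have Eb : (\sum_(l' <- bumps C l) isum (pweight (sval x)) l' [::] =
  (\sum_(l' <- bumps C l) power_poly n (powersum x) l')%:E)%E.
  rewrite -sumEFin big_seq [RHS]big_seq; apply: eq_bigr => l' /size_bumps_in s.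
  by rewrite IH// s.
by rewrite -/(isum _ (a :: l) _) EFinB EFinM -(IH l ln) -E Eb addeK.
Qed.

Lemma cvg_power_poly (I : Type) (F : set_system I) (g : I -> nzindex q -> R)
    (g0 : nzindex q -> R) n l : Filter F ->
  (forall b, g t b @[t --> F] --> g0 b) ->
  power_poly n (g t) l @[t --> F] --> power_poly n g0 l.
Proof.
move=> FF gg0; elim: n l => [|n IH] [|a l]/=; do ?exact: cvg_cst.
apply: cvgB; first by apply: cvgM; [exact: gg0|exact: IH].
apply: cvg_big => [|l' _]; last exact: IH.
exact: add_continuous.
Qed.

End power_polynomial.

Section psi_powersum.
Context {R : realType} {q : nat}.
Implicit Types (A : cpart q) (b : nzindex q) (x : kingman_seq R q).

Definition psi_const A : R := (psize A)`!%:R * pf A.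

Lemma psi_const_gt0 A : 0 < psi_const A.
Proof.
rewrite mulr_gt0 ?ltr0n ?fact_gt0// prodr_gt0// => b _.
rewrite invr_gt0 mulr_gt0 ?ltr0n ?fact_gt0// exprn_gt0// ltr0n.
by rewrite prodn_gt0// => j; rewrite fact_gt0.
Qed.

Lemma psi_isum A x : psi A (sval x) =
  psi_const A * fine (isum (pweight (sval x)) (enum_mset A) [::]).
Proof. by rewrite psiE//; [exact: kseq_ge0|exact: pweight0_fin]. Qed.

Lemma psi_mset1 b x : psi [mset b]%mset (sval x) = psi_const [mset b]%mset * powersum x b.
Proof.
rewrite psi_isum enum_msetn; congr (_ * fine _).
rewrite /= mule1; under eq_eseriesr do rewrite mule1.
by rewrite sum_live0// => i; exact/pweight_ge0/kseq_ge0.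
Qed.

End psi_powersum.

(** * Moments of the color distribution *)

Section borel_functions.
Context {R : realType} {T : ptopologicalType}.

Lemma continuous_measurable_borel (f : T -> R) : continuous f ->
  measurable_fun setT (f : borel T -> R).
Proof.
move=> cf; apply: (measurability _ (RGenOInfty.measurableE R)).
move=> _ [_ [x ->] <-]; rewrite setTI; apply: sub_sigma_algebra.
by apply: open_comp; [move=> t _; exact: cf|exact: rray_open].
Qed.

Lemma open_measurable_borel (A : set T) : open A -> measurable (A : set (borel T)).
Proof. exact: sub_sigma_algebra. Qed.

Lemma closed_measurable_borel (A : set T) : closed A -> measurable (A : set (borel T)).
Proof.
move=> cA; rewrite -[A]setCK; apply: measurableC.
by apply: open_measurable_borel; rewrite openC.
Qed.

End borel_functions.

Section simplex_topology.
Context {R : realType} {q : nat}.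
Implicit Types u v : 'rV[R]_q.

Lemma coord_cvg (j : 'I_q) : continuous (fun u : 'rV[R]_q => u 0 j).
Proof. exact: coord_continuous. Qed.

Lemma mono_continuous (a : mindex q) : continuous (fun u : 'rV[R]_q => mono u a).
Proof.
move=> u; apply: cvg_big => [||j _]; [exact: mul_continuous|exact: nbhs_filter|].
apply: (@continuous_comp _ _ _ (fun v : 'rV[R]_q => v 0 j) (fun t : R => t ^+ a j)).
  exact: coord_cvg.
exact: exprn_continuous.
Qed.

Lemma l1_continuous : continuous (@l1 R q).
Proof.
move=> u; apply: cvg_big => [||j _]; [exact: add_continuous|exact: nbhs_filter|].
apply: (@continuous_comp _ _ _ (fun v : 'rV[R]_q => v 0 j) (fun t : R => `|t|)).
  exact: coord_cvg.
exact: norm_continuous.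
Qed.

Lemma simplex_closed : closed (simplex R q).
Proof.
have -> : simplex R q = \bigcap_(j in [set: 'I_q])
    ((fun u : 'rV[R]_q => u 0 j) @^-1` `[0, 1]) `&` (@l1 R q) @^-1` [set 1].
  apply/seteqP; split=> u; first by move=> [u01 u1]; split => // j _ /=; rewrite in_itv/= u01.
  by move=> [u01 u1]; split=> // j; have := u01 j I; rewrite /= in_itv/=.
apply: closedI.
  apply: closed_bigI => j _; apply: closed_comp; last exact: interval_closed.
  by move=> u _; exact: coord_cvg.
apply: closed_comp; first by move=> u _; exact: l1_continuous.
exact: (@closed_eq R 1).
Qed.

Lemma simplex_relint_measurable :
  measurable (simplex_relint R q : set (borel 'rV[R]_q)).
Proof.
set S := [set v : 'rV[R]_q | \sum_(j < q) v 0 j = 1 -> simplex R q v].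
have -> : simplex_relint R q = simplex R q `&` S^° by apply/seteqP; split=> u [].
apply: (@measurableI _ (borel 'rV[R]_q)).
  by apply: closed_measurable_borel; exact: simplex_closed.
by apply: open_measurable_borel; exact: open_interior.
Qed.

(** Moving mass away from a vanishing coordinate leaves the simplex. *)
Lemma simplex_relint_gt0 u j : simplex_relint R q u -> 0 < u 0 j.
Proof.
move=> [[u01 u1] /nbhs_ballP[e /= e0 be]].
have u0 k : 0 <= u 0 k by case/andP: (u01 k).
rewrite lt_neqAle u0 andbT; apply/negP => /eqP uj.
have sumu : \sum_(k < q) u 0 k = 1.
  by rewrite -u1; apply: eq_bigr => k _; rewrite ger0_norm.
have [i ij ui] : exists2 i, i != j & 0 < u 0 i.
  apply/exists2P; apply/not_existsP => H; move: sumu; rewrite big1 => [/esym/eqP|k _].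
    by rewrite oner_eq0.
  apply/eqP; rewrite eq_le u0 andbT leNgt; apply/negP => uk.
  by apply: (H k); split=> //; apply: contraTneq uk => ->; rewrite -uj ltxx.
pose d k : R := (k == i)%:R - (k == j)%:R.
pose v : 'rV[R]_q := \row_k (u 0 k + e / 2 * d k).
have /be : ball u e v.
  split=> // i0 k; rewrite ord1 /v mxE /ball/= opprD addNKr normrN normrM.
  have d1 : `|d k| <= 1.
    rewrite /d; case: eqP => [->|_]; first by rewrite (negbTE ij) subr0 normr1.
    by rewrite sub0r normrN; case: eqP; rewrite ?normr1 ?normr0.
  rewrite gtr0_norm ?divr_gt0//; apply: (@le_lt_trans _ _ (e / 2)).
    by rewrite ler_piMr// divr_ge0// ltW.
  by rewrite ltr_pdivrMr// ltr_pMr// ltr1n.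
case.
  under eq_bigr do rewrite mxE.
  rewrite big_split/= sumu -mulr_sumr.
  have s1 k : \sum_(l < q) (l == k)%:R = 1 :> R.
    by rewrite (bigD1 k)//= eqxx big1 ?addr0// => l /negbTE->.
  by rewrite /d sumrB !s1 subrr mulr0 addr0.
move=> /(_ j); rewrite mxE -uj add0r /d eqxx eq_sym (negbTE ij) sub0r mulrN1.
by rewrite oppr_ge0 leNgt divr_gt0.
Qed.

End simplex_topology.

Section moments.
Context {R : realType} {q : nat}.
Variable nu : probability (borel 'rV[R]_q) R.
Hypothesis nu_simplex : nu (simplex R q) = 1%E.
Hypothesis nu_relint : (0 < nu (simplex_relint R q))%E.
Implicit Types (a : mindex q).

Local Notation D := (simplex R q).

Let mD : measurable (D : set (borel 'rV[R]_q)).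
Proof. by apply: closed_measurable_borel; exact: simplex_closed. Qed.

Lemma mono_simplex u a : D u -> 0 <= mono u a <= 1.
Proof.
move=> [u01 _]; rewrite mono_ge0 => [|j]; last by case/andP: (u01 j).
apply: prodr_ile1 => j _; have /andP[u0 u1] := u01 j.
by rewrite exprn_ge0 ?exprn_ile1.
Qed.

Lemma mono_integrable a :
  nu.-integrable D (EFin \o (fun u : borel 'rV[R]_q => mono u a)).
Proof.
apply: measurable_bounded_integrable => //.
- by rewrite [ltLHS]nu_simplex ltry.
- apply: measurable_funTS; apply: continuous_measurable_borel.
  exact: mono_continuous.
- exists 1; split => // M M1 u /(mono_simplex a)/andP[u0 u1] /=.
  by rewrite ger0_norm// (le_trans u1)// ltW.
Qed.

(** A monomial is positive on the relative interior, which has positive mass. *)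
Lemma moment_gt0 a : 0 < moment nu a.
Proof.
have m0 : 0 <= moment nu a.
  by apply: Rintegral_ge0 => u /(mono_simplex a)/andP[].
rewrite lt_neqAle m0 andbT; apply/eqP => /esym int0.
have intE : (\int[nu]_(u in D) `|(mono u a)%:E| = 0)%E.
  rewrite -[RHS]/(0%:E) -int0 /moment fineK; last first.
    exact/integrable_fin_num/mono_integrable.
  apply: eq_integral => u; rewrite inE => /(mono_simplex a)/andP[u0 _].
  by rewrite gee0_abs// lee_fin.
have := (ae_eq_integral_abs nu mD _).1 intE; case.
  apply/measurable_EFinP/measurable_funTS; apply: continuous_measurable_borel.
  exact: mono_continuous.
move=> N [mN N0 DN]; have : (nu (simplex_relint R q) <= nu N)%E.
  apply: le_measure; rewrite ?inE//; first exact: simplex_relint_measurable.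
  move=> u ur; apply: DN => /= /(_ (ur.1)) [] /eqP.
  apply/negP; rewrite gt_eqF// prodr_gt0// => j _.
  by rewrite exprn_gt0// simplex_relint_gt0.
by rewrite N0 leNgt nu_relint.
Qed.

(** The coordinates sum to 1 on the simplex. *)
Lemma moment_split a : \sum_(j < q) moment nu (a + unit_idx j) = moment nu a.
Proof.
rewrite /moment.
transitivity (\int[nu]_(u in D) \sum_(j < q) mono u (a + unit_idx j)).
  rewrite /Rintegral.
  under [in RHS]eq_integral do rewrite -sumEFin.
  rewrite integral_sum//; last by move=> j; exact: mono_integrable.
  apply: sum_fine => j _.
  exact/integrable_fin_num/mono_integrable.
apply: eq_Rintegral => u; rewrite inE => -[u01 u1].
rewrite -[RHS]mulr1 -[in RHS]u1 mulr_sumr; apply: eq_bigr => j _.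
by rewrite mono_add mono_unit ger0_norm//; case/andP: (u01 j).
Qed.

Lemma moment_unit_sum : \sum_(j < q) moment nu (unit_idx j) = 1.
Proof.
transitivity (moment nu 0).
  by rewrite -moment_split; apply: eq_bigr => j _; rewrite add0r.
transitivity (\int[nu]_(_ in D) 1 : R).
  by apply: eq_Rintegral => u _; rewrite /mono big1// => j _; rewrite ffunE expr0.
by rewrite Rintegral_cst// mul1r [X in fine X]nu_simplex.
Qed.

End moments.

(** * Graded Markov chains *)

Section markov_paths.
Context {R : realType} {S : choiceType}.
Variables (p : S -> S -> R) (succ : S -> seq S).
Hypothesis succ_uniq : forall B, uniq (succ B).
Hypothesis succ_sum : forall B, \sum_(C <- succ B) p B C = 1.
Context {d : measure_display} {Omega : measurableType d}.
Variables (P : S -> probability Omega R) (X : nat -> Omega -> S).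
Hypothesis X_meas : forall t C, measurable (X t @^-1` [set C]).
Hypothesis X_start : forall B, P B (X 0%N @^-1` [set B]) = 1%E.
Hypothesis X_markov : forall B t (c : nat -> S),
  P B [set w | forall s, (s <= t.+1)%N -> X s w = c s] =
  (P B [set w | forall s, (s <= t)%N -> X s w = c s] *
     (p (c t) (c t.+1))%:E)%E.

(** The transition probabilities in [n] steps; finite sums, as the chain moves
    only to finitely many states. *)
Fixpoint trans (n : nat) (B A : S) : R :=
  if n is n'.+1 then \sum_(C <- succ B) p B C * trans n' C A else (B == A)%:R.

Lemma notin_measurable (E : set Omega) t (s : seq S) :
  measurable E -> measurable (E `&` [set w | X t w \notin s]).
Proof.
move=> mE; elim: s => [|D s ms].
  by rewrite (_ : _ `&` _ = E)//; apply/seteqP; split=> // w [].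
rewrite (_ : _ `&` _ = (E `&` [set w | X t w \notin s]) `\` X t @^-1` [set D]).
  exact: measurableD.
apply/seteqP; split=> w /=; rewrite inE negb_or.
  by move=> [Ew /andP[/eqP wD ws]].
by move=> [[Ew ws] wD]; split=> //; rewrite ws andbT; exact/eqP.
Qed.

Lemma measure_partition_seq (mu : probability Omega R) (E : set Omega)
    t (s : seq S) : measurable E -> uniq s ->
  mu E = (\sum_(C <- s) mu (E `&` X t @^-1` [set C]) +
          mu (E `&` [set w | X t w \notin s]))%E.
Proof.
move=> mE; elim: s => [_|C s IH /andP[Cs us]].
  by rewrite big_nil add0e; congr (mu _); apply/seteqP; split=> // w [].
have mEs := notin_measurable t s mE.
rewrite big_cons IH// [RHS]addeAC [RHS]addeC; congr (_ + _)%E.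
rewrite (measureDI mu mEs (X_meas t C)) addeC; congr (mu _ + mu _)%E.
  apply/seteqP; split=> w /=; rewrite inE negb_or.
    by move=> [[Ew ws] wC]; split=> //; rewrite ws andbT; exact/eqP.
  by move=> [Ew /andP[/eqP wC ws]]; split.
apply/seteqP; split=> w /=; first by move=> [[Ew _] wC]; split.
by move=> [Ew wC]; split=> //; split=> //; rewrite wC.
Qed.

Definition path_event t (c : nat -> S) : set Omega :=
  [set w | forall s, (s <= t)%N -> X s w = c s].

Lemma path_eventS t c :
  path_event t.+1 c = path_event t c `&` X t.+1 @^-1` [set c t.+1].
Proof.
apply/seteqP; split=> w /=; last first.
  by move=> [wc wt] s; rewrite leq_eqVlt => /predU1P[->//|]; exact: wc.
by move=> wc; split; [move=> s st; exact/wc/leqW|exact: wc].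
Qed.

Lemma path_event_meas t c : measurable (path_event t c).
Proof.
elim: t => [|t IH]; last by rewrite path_eventS; exact: measurableI.
rewrite (_ : path_event 0 c = X 0%N @^-1` [set c 0%N])//.
by apply/seteqP; split=> w /=; [exact|move=> w0 [|//]].
Qed.

(** The listed successors carry the total probability 1, so the paths which avoid
    them are negligible. *)
Lemma path_event_succ B t c (E : set Omega) : measurable E ->
  (P B (path_event t c `&` E) = \sum_(C <- succ (c t))
     P B (path_event t c `&` X t.+1 @^-1` [set C] `&` E))%E.
Proof.
move=> mE; have mp := path_event_meas t c.
have step C : P B (path_event t c `&` X t.+1 @^-1` [set C]) =
    (P B (path_event t c) * (p (c t) C)%:E)%E.
  pose c' s := if (s <= t)%N then c s else C.
  have ct s : (s <= t)%N -> c' s = c s by rewrite /c' => ->.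
  have -> : path_event t c = path_event t c'.
    by apply/seteqP; split=> w wc s st; rewrite wc// ct.
  have := X_markov B t c'; rewrite -/(path_event t.+1 c') path_eventS.
  by rewrite (ct t)// (_ : c' t.+1 = C)// /c' ltnn.
have pf : P B (path_event t c) \is a fin_num by exact: fin_num_measure.
set N := path_event t c `&` [set w | X t.+1 w \notin succ (c t)].
have mN : measurable N by exact: notin_measurable.
have null : P B N = 0%E.
  have Nf : P B N \is a fin_num by exact: fin_num_measure.
  have e := measure_partition_seq (P B) t.+1 mp (succ_uniq (c t)).
  move: e; under eq_bigr do rewrite step -(fineK pf) -EFinM.
  rewrite sumEFin -mulr_sumr succ_sum mulr1 -/N -(fineK pf) -(fineK Nf).
  rewrite -EFinD => -[] /esym/eqP; rewrite -subr_eq0 addrAC subrr add0r => /eqP ->.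
  by [].
rewrite (measure_partition_seq (P B) t.+1 _ (succ_uniq (c t))); last exact: measurableI.
rewrite [X in (_ + X)%E](_ : _ = 0%E) ?adde0; last first.
  apply/eqP; rewrite eq_le measure_ge0 andbT -null.
  apply: le_measure; rewrite ?inE//.
    rewrite (_ : _ `&` _ = N `&` E); first exact: measurableI.
    by rewrite /N setIAC.
  by move=> w [[]]; split.
by apply: eq_bigr => C _; rewrite setIAC.
Qed.

(** The Markov property along a path, iterated. *)
Lemma path_event_trans B t n c A :
  (P B (path_event t c `&` X (t + n)%N @^-1` [set A]) =
   P B (path_event t c) * (trans n (c t) A)%:E)%E.
Proof.
elim: n t c => [|n IH] t c.
  rewrite addn0 /=; case: eqP => [ctA|ctA].
    rewrite mule1; congr (P B _); apply/seteqP; split=> w; first by case.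
    by move=> wc; split=> //=; rewrite wc.
  rewrite mule0 (_ : _ `&` _ = set0) ?measure0//.
  by apply/seteqP; split=> w //= [wc wA]; apply: ctA; rewrite -wc.
rewrite path_event_succ//.
have pf : P B (path_event t c) \is a fin_num.
  by apply: fin_num_measure; exact: path_event_meas.
rewrite -(fineK pf) /= -EFinM mulr_sumr -sumEFin; apply: eq_bigr => C _.
pose c' s := if (s <= t)%N then c s else C.
have ct s : (s <= t)%N -> c' s = c s by rewrite /c' => ->.
have E : path_event t c = path_event t c'.
  by apply/seteqP; split=> w wc s st; rewrite wc// ct.
have ctS : c' t.+1 = C by rewrite /c' ltnn.
rewrite E -{1}ctS -path_eventS addnS -addSn IH.
rewrite {1}/path_event X_markov -/(path_event t c') -E -(fineK pf) (ct t)// ctS -!EFinM.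
by rewrite mulrA.
Qed.

Lemma law_trans B n A : P B (X n @^-1` [set A]) = (trans n B A)%:E.
Proof.
have := path_event_trans B 0 n (fun=> B) A; rewrite add0n.
have -> : path_event 0 (fun=> B) = X 0%N @^-1` [set B].
  by apply/seteqP; split=> w /=; [exact|move=> w0 [|//]].
rewrite X_start mul1e => <-.
rewrite (_ : P B (X n @^-1` [set A]) = P B (X n @^-1` [set A] `\` X 0%N @^-1` [set B]) +
  P B (X n @^-1` [set A] `&` X 0%N @^-1` [set B]))%E; last exact: measureDI.
rewrite [X in (X + _)%E](_ : _ = 0%E) ?add0e 1?setIC//.
apply/eqP; rewrite eq_le measure_ge0 andbT.
have <- : P B (~` (X 0%N @^-1` [set B])) = 0%E.
  by rewrite probability_setC// X_start subee.
by apply: le_measure; rewrite ?inE; [exact: measurableD|exact: measurableC|move=> w []].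
Qed.

Section graded.
Variable deg : S -> nat.
Hypothesis deg_succ : forall B C, C \in succ B -> deg C = (deg B).+1.

Lemma trans_deg n B A : deg A != (deg B + n)%N -> trans n B A = 0.
Proof.
elim: n B => [|n IH] B.
  by rewrite addn0 /=; case: (eqVneq B A) => [->|//]; rewrite eqxx.
rewrite addnS /= => AB; rewrite big_seq big1// => C /deg_succ BC.
by rewrite IH ?mulr0// BC addSn.
Qed.

(** Time is read off the degree, so a state is visited at most once. *)
Lemma potential_trans n B A : deg A = (deg B + n)%N ->
  (\sum_(0 <= t <oo) P B [set w | X t w = A /\ forall s, (s < t)%N -> X s w <> A] =
   (trans n B A)%:E)%E.
Proof.
move=> AB.
have null t : t != n -> P B (X t @^-1` [set A]) = 0%E.
  by move=> tn; rewrite law_trans trans_deg// AB eqn_add2l eq_sym.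
have meas (r : nat) t :
    measurable [set w | X t w = A /\ forall s, (s < r)%N -> X s w <> A].
  elim: r => [|r IH].
    rewrite (_ : mkset _ = X t @^-1` [set A])//.
    by apply/seteqP; split=> w; [case|move=> wA; split].
  rewrite (_ : mkset _ = [set w | X t w = A /\ forall s, (s < r)%N -> X s w <> A]
     `\` X r @^-1` [set A]); first exact: measurableD.
  apply/seteqP; split=> w /=.
    by move=> [wA ws]; split; [split=> // s sr; exact/ws/ltnW|exact: ws].
  by move=> [[wA ws] wr]; split=> // s; rewrite ltnS leq_eqVlt => /predU1P[->//|]; exact: ws.
rewrite (@nneseriesD1 _ _ n xpredT)//.
rewrite eseries0 ?adde0; last first.
  move=> t _ tn; apply/eqP; rewrite eq_le measure_ge0 andbT -(null t tn).
  by apply: le_measure; rewrite ?inE// => w [].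
rewrite -law_trans.
have drop r : (r <= n)%N -> P B (X n @^-1` [set A]) =
    P B [set w | X n w = A /\ forall s, (s < r)%N -> X s w <> A].
  elim: r => [_|r IH rn].
    by congr (P B _); apply/seteqP; split=> w; [move=> wA; split|case].
  rewrite IH ?(ltnW rn)//.
  set H := [set w | _].
  rewrite (_ : P B H = P B (H `\` X r @^-1` [set A]) + P B (H `&` X r @^-1` [set A]))%E;
    last by apply: measureDI; [exact: meas|exact: X_meas].
  rewrite [X in (_ + X)%E](_ : _ = 0%E) ?adde0.
    congr (P B _); apply/seteqP; split=> w /=.
      by move=> [[wA ws] wr]; split=> // s; rewrite ltnS leq_eqVlt => /predU1P[->//|]; exact: ws.
    by move=> [wA ws]; split; [split=> // s sr; exact/ws/ltnW|exact: ws].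
  apply/eqP; rewrite eq_le measure_ge0 andbT -(null r) ?ltn_eqF//.
  apply: le_measure; rewrite ?inE; last by move=> w [].
    by apply: measurableI; [exact: meas|exact: X_meas].
  exact: X_meas.
exact/esym/(drop n).
Qed.

End graded.
End markov_paths.

(** * Sampling without replacement *)

Lemma mindex_ind (q : nat) (Q : mindex q -> Prop) : Q 0 ->
  (forall a j, Q a -> Q (a + unit_idx j)) -> forall a, Q a.
Proof.
move=> Q0 QS a; have [n] := ubnP (msum_idx a); elim: n a => // n IH a an.
have [/eqP->//|] := boolP (a == 0); rewrite -msum_idx_eq0 sum_nat_eq0 negb_forall.
move=> /existsP[j]; rewrite -lt0n => aj.
have aE : a = [ffun k => a k - (k == j)]%N + unit_idx j.
  apply/ffunP => k; rewrite !ffunE natrDE; case: eqP => [->|_]; last by rewrite subn0 addn0.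
  by rewrite subnK.
rewrite aE; apply/QS/IH; move: an; rewrite {1}aE msum_idxD msum_unit addn1.
exact.
Qed.

Lemma big_enum_mset {R : Type} {idx : R} {op : Monoid.com_law idx} (K : choiceType)
    (A : {mset K}%mset) (F : K -> R) :
  \big[op/idx]_(b <- enum_mset A) F b =
  \big[op/idx]_(b <- finsupp A) iterop (A b) op (F b) idx.
Proof.
rewrite EnumMset.E big_flatten big_map; apply: eq_bigr => b _.
by rewrite big_nseq Monoid.iteropE.
Qed.

Section falling_weights.
Context {R : realType} {q : nat}.
Implicit Types (a : mindex q) (b : nzindex q) (A B C : cpart q) (j : 'I_q).

Variable A : cpart q.

(** The parts, numbered from 1 as the terms of a point of the Kingman simplex; the
    index 0 carries an empty part, for there is no dust. *)
Definition part (i : nat) : mindex q := if i is h.+1 then nth 0 (parts A) h else 0.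

(** The number of ways to draw an ordered sample of composition [val b] from the
    part of index [i]. *)
Definition falling (a : mindex q) (i : nat) : R :=
  \prod_(j < q) ((part i j) ^_ (a j))%:R.

Definition fweight b (i : nat) : R := falling (val b) i.

Lemma fweight_ge0 b i : 0 <= fweight b i.
Proof. exact: prodr_ge0. Qed.

Lemma fweight_part0 b i : part i = 0 -> fweight b i = 0.
Proof.
move=> p0; have := msum_idx_gt0 b; rewrite lt0n sum_nat_eq0 negb_forall.
move=> /existsP[j]; rewrite -lt0n => bj; rewrite /fweight /falling (bigD1 j)//= p0 ffunE.
by rewrite ffact_small ?mul0r.
Qed.

Lemma part_default i : (size (parts A) < i)%N -> part i = 0.
Proof. by case: i => // i; rewrite ltnS /= => iA; rewrite nth_default. Qed.

Lemma part_series (F : mindex q -> R) : (forall a, 0 <= F a) -> F 0 = 0 ->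
  (\sum_(0 <= i <oo) (F (part i))%:E = (\sum_(a <- parts A) F a)%:E)%E.
Proof.
move=> F_ge0 F0; rewrite (@nneseries_split _ _ 0 (size (parts A)).+1); last first.
  by move=> k _; rewrite lee_fin.
rewrite eseries0 ?adde0; last by move=> i iA _; rewrite part_default ?F0.
rewrite add0n big_nat_recl//= F0 add0e sumEFin; congr EFin.
by rewrite [RHS](big_nth 0).
Qed.

Lemma fweight_fin b : (\sum_(0 <= i <oo) (fweight b i)%:E < +oo)%E.
Proof.
pose F a : R := \prod_(j < q) ((a j) ^_ (val b j))%:R.
rewrite (part_series (F := F)) ?ltry//; first by move=> a; exact: prodr_ge0.
exact: (@fweight_part0 b 0%N).
Qed.

(** The number of ordered samples whose classes have the compositions listed in
    [l], one part of [A] for each class. *)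
Definition fsum (l : seq (nzindex q)) : R := fine (isum fweight l [::]).

Lemma fsumE l : isum fweight l [::] = (fsum l)%:E.
Proof. exact/esym/fineK/(isum_fin fweight_ge0 fweight_fin). Qed.

Lemma fsum_perm l l' : perm_eq l l' -> fsum l = fsum l'.
Proof. by move=> ll'; rewrite /fsum (isum_perm _ fweight_ge0 ll'). Qed.

Lemma falling_incr (a : mindex q) j i :
  falling (a + unit_idx j) i = falling a i * ((part i j)%:R - (a j)%:R).
Proof.
rewrite /falling (bigD1 j)//= [in RHS](bigD1 j)//= !ffunE eqxx natrDE addn1.
rewrite (eq_bigr (fun k => ((part i k) ^_ (a k))%:R)); last first.
  by move=> k kj; rewrite !ffunE (negbTE kj) natrDE addn0.
rewrite mulrAC; congr (_ * _); rewrite ffactnSr natrM.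
have [bp|pb] := leqP (a j) (part i j); first by rewrite natrB.
by rewrite ffact_small// !mul0r.
Qed.

Lemma fweight_unit j i : fweight (nz_unit j) i = (part i j)%:R.
Proof.
rewrite /fweight /falling (bigD1 j)//= ffunE eqxx ffactn1 big1 ?mulr1// => k kj.
by rewrite ffunE (negbTE kj).
Qed.

Definition incrs b : seq (nzindex q) := [seq nz_incr b j | j <- enum 'I_q].

(** Any element of [A] either extends a sample by a new class, or extends one of its
    classes, or has already been drawn: the three terms on the left. *)
Lemma fsum_grow l :
  \sum_(j < q) fsum (nz_unit j :: l) + \sum_(l' <- bumps incrs l) fsum l' +
    (\sum_(b <- l) msum_idx (val b))%:R * fsum l = (psize A)%:R * fsum l.
Proof.
pose f i : R := (msum_idx (part i))%:R.
have f0 i : 0 <= f i by exact: ler0n.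
have fE i : f i = \sum_(j < q) fweight (nz_unit j) i.
  by rewrite /f /msum_idx natr_sum; apply: eq_bigr => j _; rewrite fweight_unit.
have fz : f 0%N = 0 by rewrite /f /msum_idx big1// => j _; rewrite ffunE.
have ftot : (\sum_(0 <= i <oo) (f i)%:E = (psize A)%:R%:E)%E.
  rewrite (part_series (F := fun a => (msum_idx a)%:R)) //.
  by rewrite -sum_parts natr_sum.
have H b i : f i.+1 * fweight b i.+1 =
    \sum_(c <- incrs b) fweight c i.+1 + (msum_idx (val b))%:R * fweight b i.+1.
  rewrite big_map big_enum/=; under eq_bigr do rewrite [fweight _ _]falling_incr.
  rewrite -mulr_sumr sumrB mulrC [X in _ = _ + X]mulrC -mulrDr; congr (_ * _).
  by rewrite /f /msum_idx !natr_sum subrK.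
have w00 b : fweight b 0%N = 0 by rewrite fweight_part0.
have H0 b : \sum_(c <- incrs b) fweight c 0%N + (msum_idx (val b))%:R * fweight b 0%N = 0.
  by rewrite w00 mulr0 addr0 big1.
have ffin : (\sum_(0 <= i <oo) (f i)%:E < +oo)%E by rewrite ftot ltry.
pose kd b : R := (msum_idx (val b))%:R.
have := @isum_collision _ _ _ fweight_ge0 fweight_fin f incrs kd l [::] f0
  (fun=> ler0n _ _) ffin H H0.
have -> : (\sum_(0 <= i <oo | live [::] i) (f i)%:E = (psize A)%:R%:E)%E.
  by rewrite -ftot -(sum_live0 f0) fz add0e.
have -> : (\sum_(0 <= i <oo | live [::] i) (f i)%:E * isum fweight l [:: i] =
    \sum_(j < q) isum fweight (nz_unit j :: l) [::])%E.
  have t0 b i : (0 <= (fweight b i)%:E * isum fweight l [:: i])%E.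
    exact/isum_term_ge0/fweight_ge0.
  transitivity (\sum_(j < q) \sum_(0 <= i <oo) if live [::] i then
      (fweight (nz_unit j) i)%:E * isum fweight l [:: i] else 0)%E; last first.
    apply: eq_bigr => j _; rewrite [RHS]/= w00 mul0e add0e [RHS]eseries_mkcond.
    by [].
  rewrite -nneseries_sum; last by move=> j i _; case: ifP.
  rewrite eseries_mkcond; apply: eq_eseriesr => i _; case: ifP => _; last by rewrite big1.
  rewrite fE -sumEFin ge0_sume_distrl// => j _.
  by rewrite lee_fin fweight_ge0.
have sumE (I : Type) (r : seq I) (g : I -> seq (nzindex q)) :
    (\sum_(s <- r) isum fweight (g s) [::] = (\sum_(s <- r) fsum (g s))%:E)%E.
  by rewrite -sumEFin; apply: eq_bigr => s _; rewrite fsumE.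
rewrite !sumE fsumE -!EFinM -!EFinD => -[] <-.
by rewrite natr_sum.
Qed.

(** When the sample exhausts [A], it must pick every part entirely. *)
Lemma fsum_full B : psize B = psize A -> fsum (enum_mset B) != 0 -> B = A.
Proof.
move=> BA sB.
pose b0 : seq (mindex q) := [seq val b | b <- enum_mset B].
pose w (a : mindex q) i : R := \prod_(j < q) ((part i j) ^_ (a j))%:R.
pose w' (a : mindex q) i : R := if i is 0 then 0 else w a i.
have w'0 a i : 0 <= w' a i by case: i => // i; exact: prodr_ge0.
have E : isum w' b0 [::] = isum fweight (enum_mset B) [::].
  by apply: eq_in_isum => b _ [|i] //=; rewrite fweight_part0.
have [iota [[inj lv] w_neq0]] : exists iota : {ffun 'I_(size b0) -> nat},
    live_injections (size b0) [::] iota /\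
    \prod_(h < size b0) w' (nth 0 b0 h) (iota h) != 0.
  apply/not_existsP => H; move/negP: sB; apply; rewrite -eqe -fsumE -E -[isum _ _ _]mul1e.
  rewrite (isum_esum w'0 _ 0)//; apply/eqP; apply: esum1 => f fi.
  rewrite mul1r; apply/eqP; rewrite eqe; apply: contrapT => /negP f0.
  by apply: (H f).
have lv0 h : (0 < iota h)%N by have /andP[] := lv h.
(* the falling factorials do not vanish, so each class fits in its part *)
have leb (h : 'I_(size b0)) j : (nth 0%R b0 h j <= part (iota h) j)%N.
  rewrite leqNgt; apply/negP => lt; move/negP: w_neq0; apply; apply/eqP.
  rewrite (bigD1 h)//= /w'; case E' : (iota h) => [|i]; first by rewrite mul0r.
  by rewrite -E' /w (bigD1 j)//= ffact_small// !mul0r.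
pose p i : mindex q := nth 0 (parts A) i.
have pE h : part (iota h) = p (iota h).-1 by rewrite /part /p; have := lv0 h; case: (iota h).
pose k := size (parts A).
have b_gt0 (h : 'I_(size b0)) : (0 < msum_idx (nth 0%R b0 h))%N.
  have /mapP[b _ ->] : nth 0%R b0 h \in b0 by exact: mem_nth.
  exact: msum_idx_gt0.
have p_gt0 i : (i < k)%N -> (0 < msum_idx (p i))%N.
  move=> ik; have : p i \in parts A by exact: mem_nth.
  by rewrite (perm_mem (parts_perm A)) => /mapP[b _ ->]; exact: msum_idx_gt0.
pose s := [seq (iota h).-1 | h <- enum 'I_(size b0)].
have us : uniq s.
  rewrite map_inj_in_uniq ?enum_uniq// => h h' _ _ hh'.
  by apply: inj; rewrite -(prednK (lv0 h)) hh' prednK.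
have sk : {subset s <= seq.iota 0 k}.
  move=> _ /mapP[h _ ->]; rewrite mem_iota/= add0n ltnNge; apply/negP => kh.
  suff : (0 < msum_idx (p (iota h).-1))%N.
    by rewrite /p nth_default// /msum_idx big1// => j _; rewrite ffunE.
  by apply: leq_trans (b_gt0 h) _; apply: leq_sum => j _; rewrite -pE; exact: leb.
pose rest := [seq i <- seq.iota 0 k | i \notin s].
have perm_s : perm_eq (s ++ rest) (seq.iota 0 k).
  apply: uniq_perm; rewrite ?iota_uniq// ?cat_uniq ?us ?filter_uniq ?iota_uniq//.
    rewrite andbT; apply/hasPn => i; rewrite mem_filter => /andP[].
    by [].
  move=> i; rewrite mem_cat mem_filter; case: (boolP (i \in s)) => [/sk->|]//.
have sizeA : psize A = (\sum_(i <- s) msum_idx (p i) + \sum_(i <- rest) msum_idx (p i))%N.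
  rewrite -big_cat (perm_big _ perm_s)/= -sum_parts.
  by rewrite (big_nth 0%R) /index_iota subn0.
have sizeB : psize B = (\sum_(h < size b0) \sum_(j < q) nth 0%R b0 h j)%N.
  by rewrite psizeE -(big_map val xpredT (@msum_idx q)) -/b0 (big_nth 0%R) big_mkord.
have sizes : (\sum_(i <- s) msum_idx (p i) = \sum_(h < size b0) \sum_(j < q) part (iota h) j)%N.
  by rewrite big_map big_enum/=; apply: eq_bigr => h _; rewrite pE.
(* the sizes are equal, so no room is left anywhere *)
have le_tot : (psize B <= \sum_(i <- s) msum_idx (p i))%N.
  by rewrite sizes sizeB; apply: leq_sum => h _; apply: leq_sum => j _; exact: leb.
have rest0 : rest = [::].
  apply/eqP; rewrite -[_ == _]negbK; apply/negP; rewrite -size_eq0 -lt0n => rest_gt0.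
  move: le_tot; rewrite BA sizeA -[X in (_ <= X)%N]addn0 leq_add2l leqn0 => /eqP sr.
  have := mem_nth 0%N rest_gt0; set i := nth _ _ _ => ir.
  have := ir; rewrite mem_filter mem_iota/= add0n => /andP[_ /p_gt0].
  by move: sr; rewrite (big_rem i)//=; case: msum_idx.
have eqb (h : 'I_(size b0)) : nth 0%R b0 h = p (iota h).-1.
  have := leqif_sum (fun (h : 'I_(size b0)) (_ : xpredT h) =>
    leqif_sum (fun (j : 'I_q) (_ : xpredT j) => leqif_eq (leb h j))).
  move=> [_]; rewrite -sizes -sizeB BA sizeA rest0 big_nil addn0 eqxx => /esym/forallP/(_ h).
  by move=> /forallP eqj; apply/ffunP => j; rewrite -pE; apply/eqP/eqj.
have b0E : b0 = [seq p i | i <- s].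
  rewrite -map_comp -[LHS](mkseq_nth 0%R) /mkseq -val_enum_ord -map_comp.
  by apply: eq_map => h /=; exact: eqb.
have : perm_eq b0 [seq val b | b <- enum_mset A].
  apply: perm_trans (parts_perm A); rewrite b0E.
  rewrite -[X in perm_eq _ X](mkseq_nth 0%R) /mkseq perm_map//.
  by move: perm_s; rewrite rest0 cats0.
move=> /(perm_map_inj val_inj)/eq_seq_msetP.
by rewrite !seq_mset_id.
Qed.

(** The partition [A] is itself a sample, each class being the whole part. *)
Lemma fsum_self : 0 < fsum (enum_mset A).
Proof.
pose ls := sort (fun b c : nzindex q =>
  (shortlex_idx (val c) <= shortlex_idx (val b))%O) (enum_mset A).
have perm_ls : perm_eq ls (enum_mset A) by rewrite /ls perm_sort.
rewrite -(fsum_perm perm_ls) -lte_fin -fsumE -[isum _ _ _]mul1e.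
have [b0|ls0] : (exists b0 : nzindex q, b0 \in ls) \/ ls = [::].
- by case: (ls) => [|b r]; [right|left; exists b; exact: mem_head].
- case: b0 => b0 _.
  pose w' b i : R := if i is 0 then 0 else fweight b i.
  have w'0 b i : 0 <= w' b i by case: i => // i; exact: fweight_ge0.
  rewrite -[ls]map_id (@eq_in_isum _ _ _ fweight w' id); last first.
    by move=> b _ [|i] //=; rewrite fweight_part0.
  rewrite (isum_esum w'0 _ b0)//.
  pose f : {ffun 'I_(size ls) -> nat} := [ffun h => (val h).+1].
  apply: (@lt_le_trans _ _ (\prod_(h < size ls) w' (nth b0 ls h) (f h))%:E).
    rewrite lte_fin prodr_gt0// => h _; rewrite ffunE /w' prodr_gt0// => j _.
    rewrite /= /parts -/ls (nth_map b0)//.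
    by rewrite ltr0n ffactnn fact_gt0.
  apply: esum_ge; exists [set f]; last by rewrite fsbig_set1 mul1r.
  split; first exact: finite_set1.
  by move=> _ ->; split=> [h h'|h]; rewrite !ffunE// => -[/val_inj].
- by rewrite ls0 mul1e lte_fin.
Qed.

End falling_weights.

(** * The Martin kernel of the Hoppe chain *)

Section hoppe_kernel.
Context {R : realType} {q : nat} {theta : R}.
Hypothesis theta_gt0 : 0 < theta.
Variable nu : probability (borel 'rV[R]_q) R.
Hypothesis nu_simplex : nu (simplex R q) = 1%E.
Hypothesis nu_relint : (0 < nu (simplex_relint R q))%E.
Implicit Types (b : nzindex q) (A B C : cpart q) (j : 'I_q) (l : seq (nzindex q)).

Let mom := moment nu.
Let mom_gt0 a : 0 < mom a. Proof. exact: moment_gt0. Qed.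
Let step := hoppe_step theta nu.

Definition add_part B j : cpart q := (B `+` [mset nz_unit j])%mset.
Definition grow_part B b j : cpart q := ((B `\` [mset b]) `+` [mset nz_incr b j])%mset.

(** With [undup] it does not matter whether two moves can lead to the same
    partition: the transition probability adds them up. *)
Definition hoppe_succ B : seq (cpart q) :=
  undup ([seq add_part B j | j <- enum 'I_q] ++
         [seq grow_part B b j | b <- finsupp B, j <- enum 'I_q]).

Lemma add_part_succ B j : add_part B j \in hoppe_succ B.
Proof. by rewrite mem_undup mem_cat map_f ?mem_enum. Qed.

Lemma grow_part_succ B b j : b \in finsupp B -> grow_part B b j \in hoppe_succ B.
Proof.
move=> bB; rewrite mem_undup mem_cat; apply/orP; right.
by apply/allpairsP; exists (b, j); rewrite mem_enum.
Qed.

Lemma hoppe_succ_sum B (H : cpart q -> R) :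
  \sum_(C <- hoppe_succ B) step B C * H C =
  \sum_(j < q) theta * mom (unit_idx j) / (theta + (psize B)%:R) * H (add_part B j) +
  \sum_(b <- finsupp B) \sum_(j < q) (msum_idx (val b) * B b)%:R /
    (theta + (psize B)%:R) * (mom (val (nz_incr b j)) / mom (val b)) * H (grow_part B b j).
Proof.
have pick (c : R) (C0 : cpart q) : C0 \in hoppe_succ B ->
    \sum_(C <- hoppe_succ B) c * (C == C0)%:R * H C = c * H C0.
  move=> C0s; rewrite (bigD1_seq C0) ?undup_uniq//= eqxx mulr1 big1 ?addr0//.
  by move=> C /negbTE->; rewrite mulr0 mul0r.
rewrite /step /hoppe_step; under eq_bigr do rewrite mulrDl.
rewrite big_split/=; congr (_ + _).
  under eq_bigr do rewrite mulr_suml.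
  rewrite exchange_big/=; apply: eq_bigr => j _.
  by rewrite pick// add_part_succ.
under eq_bigr do rewrite mulr_suml.
rewrite exchange_big/= big_seq [RHS]big_seq; apply: eq_bigr => b bB.
under eq_bigr do rewrite mulr_suml.
rewrite exchange_big/=; apply: eq_bigr => j _.
by rewrite pick// grow_part_succ.
Qed.

Lemma sum_finsupp_psize B :
  (\sum_(b <- finsupp B) (msum_idx (val b) * B b)%:R) = (psize B)%:R :> R.
Proof. by rewrite -natr_sum; congr _%:R; apply: eq_bigr => b _; rewrite mulnC. Qed.

Lemma theta_psize_neq0 B : theta + (psize B)%:R != 0.
Proof. by rewrite gt_eqF// ltr_wpDr. Qed.

Lemma hoppe_succ_total B : \sum_(C <- hoppe_succ B) step B C = 1.
Proof.
transitivity (\sum_(C <- hoppe_succ B) step B C * 1).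
  by under [RHS]eq_bigr do rewrite mulr1.
rewrite (hoppe_succ_sum B (fun=> 1)).
under eq_bigr do rewrite mulr1.
under [X in _ + X]eq_bigr => b _.
  under eq_bigr do rewrite mulr1.
  rewrite -mulr_sumr -mulr_suml (moment_split nu_simplex) divff ?gt_eqF// mulr1.
  over.
rewrite -!mulr_suml -mulr_sumr (moment_unit_sum nu_simplex) mulr1 sum_finsupp_psize.
by rewrite -mulrDl divff// theta_psize_neq0.
Qed.

Lemma finsupp_sub B b : b \in finsupp B -> ([mset b] `<=` B)%mset.
Proof. by rewrite msuppE msub1set. Qed.

Lemma psize_mset1 b : psize [mset b]%mset = msum_idx (val b).
Proof. by rewrite psizeE enum_msetn /= big_seq1. Qed.

Lemma hoppe_succ_psize B C : C \in hoppe_succ B -> psize C = (psize B).+1.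
Proof.
rewrite mem_undup mem_cat => /orP[/mapP[j _ ->]|/allpairsP[[b j] /= [bB _ ->]]].
  by rewrite psizeD psize_mset1 msum_unit addn1.
rewrite psizeD psizeB ?finsupp_sub// !psize_mset1 /= msum_idxD msum_unit addn1 addnS.
rewrite subnK//; rewrite -(msetBDK (finsupp_sub bB)) psizeD psize_mset1.
exact: leq_addl.
Qed.

(** The constants are forced by harmonicity: each step of the chain divides by
    [theta] plus the current size, multiplies by [theta] when a part is created, by
    its size when it grows, and by a ratio of moments. *)
Definition weight_const l : R :=
  (\prod_(i < \sum_(b <- l) msum_idx (val b)) (theta + i%:R)) /
  \prod_(b <- l) (theta * (msum_idx (val b)).-1`!%:R * mom (val b)).

(** Up to [weight_const], the probability to sample the list of parts of [B] when
    [psize B] elements of [A] are drawn without replacement. *)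
Definition hfun A B : R :=
  weight_const (enum_mset B) * fsum A (enum_mset B) /
  ((psize A) ^_ (psize B))%:R.

Lemma weight_const_perm l l' : perm_eq l l' -> weight_const l = weight_const l'.
Proof. by move=> ll'; rewrite /weight_const !(perm_big _ ll'). Qed.

Lemma den_gt0 b : 0 < theta * (msum_idx (val b)).-1`!%:R * mom (val b).
Proof. by rewrite !mulr_gt0// ltr0n fact_gt0. Qed.

Lemma weight_const_gt0 l : 0 < weight_const l.
Proof.
rewrite divr_gt0 ?prodr_gt0// => [i _|b _]; first by rewrite ltr_wpDr.
exact: den_gt0.
Qed.

Lemma weight_const_unit j l (m := \sum_(b <- l) msum_idx (val b)) :
  theta * mom (unit_idx j) / (theta + m%:R) * weight_const (nz_unit j :: l) =
  weight_const l.
Proof.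
rewrite /weight_const !big_cons /= msum_unit -/m add1n big_ord_recr/= fact0 mulr1.
have s0 : theta + m%:R != 0 by rewrite gt_eqF// ltr_wpDr.
have m0 : mom (unit_idx j) != 0 by rewrite gt_eqF.
have t0 : theta != 0 by rewrite gt_eqF.
have D0 : \prod_(b <- l) (theta * (msum_idx (val b)).-1`!%:R * mom (val b)) != 0.
  by rewrite gt_eqF// prodr_gt0// => b _; exact: den_gt0.
apply/eqP; rewrite mulf_div eqr_div ?mulf_neq0//.
by rewrite !mulrA [X in X == _](ACl (3*4*1*2*5))%AC.
Qed.

Lemma weight_const_incr b j l (m := (\sum_(c <- b :: l) msum_idx (val c))%N) :
  (msum_idx (val b))%:R / (theta + m%:R) * (mom (val (nz_incr b j)) / mom (val b)) *
    weight_const (nz_incr b j :: l) = weight_const (b :: l).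
Proof.
rewrite /weight_const -/m (_ : \sum_(c <- _ :: _) _ = m.+1)%N; last first.
  by rewrite /m !big_cons /= msum_idxD msum_unit addn1 addSn.
rewrite !big_cons big_ord_recr /= msum_idxD msum_unit addn1 /=.
have s0 : theta + m%:R != 0 by rewrite gt_eqF// ltr_wpDr.
have m0 : mom (val b) != 0 by rewrite gt_eqF.
have m1 : mom (val b + unit_idx j) != 0 by rewrite gt_eqF.
have t0 : theta != 0 by rewrite gt_eqF.
have D0 : \prod_(b <- l) (theta * (msum_idx (val b)).-1`!%:R * mom (val b)) != 0.
  by rewrite gt_eqF// prodr_gt0// => c _; exact: den_gt0.
have b0 := msum_idx_gt0 b.
rewrite -[X in X`!%:R](prednK b0) factS prednK// natrM.
have f0 : (msum_idx (val b)).-1`!%:R != 0 :> R by rewrite pnatr_eq0 -lt0n fact_gt0.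
have b1 : (msum_idx (val b))%:R != 0 :> R by rewrite pnatr_eq0 -lt0n.
apply/eqP; rewrite !mulf_div eqr_div ?mulf_neq0//.
by rewrite !mulrA [X in X == _](ACl (3*4*7*5*1*6*2*8))%AC.
Qed.

(** For a symmetric [F] the place of the modified entry does not matter, and it may
    be moved to the front. *)
Lemma bumps_rem (T : eqType) (C : T -> seq T) (F : seq T -> R) (l : seq T) :
  (forall s s', perm_eq s s' -> F s = F s') ->
  \sum_(l' <- bumps C l) F l' = \sum_(b <- l) \sum_(c <- C b) F (c :: rem b l).
Proof.
elim: l F => [|b l IH] F Fp; first by rewrite !big_nil.
rewrite /= big_cat !big_map/= big_cons eqxx; congr (_ + _).
rewrite (IH (fun s => F (b :: s))); last first.
  by move=> s s' ss'; apply: Fp; rewrite perm_cons.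
apply: eq_big_seq => b' b'l; apply: eq_bigr => c _.
have sw : perm_eq [:: b, c & rem b' l] [:: c, b & rem b' l].
  exact/permPl/(perm_catCA [:: b] [:: c]).
apply: Fp; apply: perm_trans sw _; rewrite perm_cons; case: eqP => [->|//].
by rewrite perm_sym perm_to_rem.
Qed.

Lemma enum_grow_part B b j : b \in finsupp B ->
  perm_eq (enum_mset (grow_part B b j)) (nz_incr b j :: rem b (enum_mset B)).
Proof.
move=> bB; rewrite /grow_part msetDC; apply: perm_trans (enum_mset_cons _ _) _.
rewrite perm_cons -(perm_cons b); apply: (@perm_trans _ (enum_mset B)).
  rewrite perm_sym -{1}(msetBDK (finsupp_sub bB)) msetDC.
  exact: enum_mset_cons.
by apply: perm_to_rem; rewrite -msuppE.
Qed.

(** Up to the weights, one step of the chain adds an element to a sample of [A],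
    and only the elements outside the sample are available. *)
Lemma hfun_harmonic A B : (psize B < psize A)%N ->
  \sum_(C <- hoppe_succ B) step B C * hfun A C = hfun A B.
Proof.
move=> BA; rewrite hoppe_succ_sum.
set l := enum_mset B; set m := psize B; set n := psize A.
have mE : m = (\sum_(b <- l) msum_idx (val b))%N by exact: psizeE.
have add j : theta * mom (unit_idx j) / (theta + m%:R) * hfun A (add_part B j) =
    weight_const l / (n ^_ m.+1)%:R * fsum A (nz_unit j :: l).
  have pB : perm_eq (enum_mset (add_part B j)) (nz_unit j :: l).
    by rewrite /add_part msetDC; exact: enum_mset_cons.
  rewrite /hfun (weight_const_perm pB) (fsum_perm _ pB) psizeD psize_mset1 msum_unit.
  rewrite addn1 -/m -/n -(weight_const_unit j l) -mE.
  by set r := _ / (_ + _); clearbody r; rewrite !mulrA mulrAC.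
have grow b j : b \in finsupp B -> (msum_idx (val b) * B b)%:R / (theta + m%:R) *
      (mom (val (nz_incr b j)) / mom (val b)) * hfun A (grow_part B b j) =
    weight_const l / (n ^_ m.+1)%:R * ((B b)%:R * fsum A (nz_incr b j :: rem b l)).
  move=> bB; have pB := enum_grow_part j bB.
  have lb : perm_eq l (b :: rem b l) by apply: perm_to_rem; rewrite -msuppE.
  rewrite /hfun (weight_const_perm pB) (fsum_perm _ pB).
  rewrite (hoppe_succ_psize (grow_part_succ _ bB)) -/m -/n.
  rewrite (weight_const_perm lb) -(weight_const_incr b j (rem b l)).
  rewrite -(perm_big _ lb) -mE natrM.
  set w := weight_const _; set f := fsum _ _.
  set r := mom (val (nz_incr b j)) / mom (val b); clearbody w f r.
  by rewrite !mulrA [LHS](ACl (1*3*4*5*7*2*6))%AC.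
rewrite [X in X + _](eq_bigr _ (fun j _ => add j)).
rewrite [X in _ + X](_ : _ = weight_const l / (n ^_ m.+1)%:R *
    \sum_(l' <- bumps incrs l) fsum A l'); last first.
  rewrite (bumps_rem _ _ (@fsum_perm _ _ A)) big_enum_mset mulr_sumr.
  apply: eq_big_seq => b bB.
  rewrite Monoid.iteropE iter_addr_0 big_map big_enum -[_ *+ B b]mulr_natl mulr_sumr mulr_sumr.
  by apply: eq_bigr => j _; rewrite grow.
rewrite -mulr_sumr -mulrDr.
have := @fsum_grow R q A l; rewrite -mE => /eqP; rewrite -subr_eq0 -addrA -mulrBl.
rewrite addr_eq0 -mulNr opprB -natrB ?(ltnW BA)// => /eqP ->.
rewrite /hfun -/l -/m -/n ffactnSr natrM.
have nm : (n - m)%:R != 0 :> R by rewrite pnatr_eq0 -lt0n subn_gt0.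
have N0 : (n ^_ m)%:R != 0 :> R by rewrite pnatr_eq0 -lt0n ffact_gt0 ltnW.
by rewrite invfM !mulrA divfK// mulrAC.
Qed.

Lemma hfun0 A : hfun A mset0 = 1.
Proof.
by rewrite /hfun psize0 ffactn0 enum_mset0 /weight_const !big_nil big_ord0 /fsum/= !(mulr1, invr1).
Qed.

Lemma hfun_self A : 0 < hfun A A.
Proof.
apply: divr_gt0; first by apply: mulr_gt0; [exact: weight_const_gt0|exact: fsum_self].
by rewrite ltr0n ffact_gt0.
Qed.

(** Both sides are harmonic in [B] and agree, by [fsum_full], when the size of
    [A] is reached. *)
Lemma trans_hfun n A B : psize A = (psize B + n)%N ->
  trans step hoppe_succ n B A = hfun A B / hfun A A.
Proof.
elim: n B => [|n IH] B AB /=.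
  have [->|BA] := eqVneq B A; first by rewrite divff// gt_eqF// hfun_self.
  have [sB|sB] := eqVneq (fsum A (enum_mset B) : R) 0.
    by rewrite /hfun sB mulr0 !mul0r.
  by move: BA; rewrite (fsum_full _ sB) ?eqxx// AB addn0.
rewrite -(@hfun_harmonic A B); last by rewrite AB addnS ltnS leq_addr.
rewrite mulr_suml big_seq [RHS]big_seq; apply: eq_bigr => C /hoppe_succ_psize BC.
by rewrite IH ?mulrA// BC AB addnS addSn.
Qed.

Context {d : measure_display} {Omega : measurableType d}.
Variables (P : cpart q -> probability Omega R) (X : nat -> Omega -> cpart q).
Hypothesis hX : is_hoppe_chain theta nu P X.

Lemma potentialE n A B : psize A = (psize B + n)%N ->
  potential P X B A = (hfun A B / hfun A A)%:E.
Proof.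
move=> AB; have [mX X0 XM] := hX.
rewrite -(trans_hfun AB) /potential /first_hit.
have us C : uniq (hoppe_succ C) by exact: undup_uniq.
exact: (potential_trans us hoppe_succ_total mX X0 XM hoppe_succ_psize AB).
Qed.

(** The start at the empty partition normalises away the terminal value. *)
Lemma martin_kernelE A B : (psize B <= psize A)%N ->
  martin_kernel P X B A = hfun A B.
Proof.
move=> BA; rewrite /martin_kernel (@potentialE (psize A - psize B)) ?subnKC//.
rewrite (@potentialE (psize A)) ?psize0// hfun0 /= div1r invrK divfK//.
by rewrite gt_eqF// hfun_self.
Qed.

End hoppe_kernel.

(** * Sampling with and without replacement *)

Section sampling_asymptotics.
Context {R : realType} {q : nat}.
Variable A : cpart q.
Hypothesis A_gt0 : (0 < psize A)%N.
Implicit Types (b : nzindex q) (a : mindex q) (l : seq (nzindex q)).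

Let n : R := (psize A)%:R.
Let n_gt0 : 0 < n. Proof. by rewrite ltr0n. Qed.
Let x : kingman_seq R q := exist _ (part_seq R A) (mem_set (part_seq_kingman R A_gt0)).

Lemma part_seqE i j : part_seq R A i 0 j = (part A i j)%:R / n.
Proof. by case: i => [|i]; rewrite /= mxE// ffunE mul0r. Qed.

(** Sampling without replacement, against sampling with replacement. *)
Definition vweight a i : R := n^-1 ^+ msum_idx a * falling A a i.

Lemma vweight_incr a j i :
  vweight (a + unit_idx j) i = vweight a i * (part_seq R A i 0 j - (a j)%:R / n).
Proof.
rewrite /vweight falling_incr msum_idxD msum_unit addn1 exprSr part_seqE.
by rewrite -mulrBl -!mulrA; congr (_ * _); rewrite mulrC -!mulrA.
Qed.

Lemma vweight_ge0 a i : 0 <= vweight a i.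
Proof.
by rewrite mulr_ge0 ?exprn_ge0 ?invr_ge0 ?(ltW n_gt0)//; exact: prodr_ge0.
Qed.

(** Each of the [msum_idx a] draws loses at most a proportion [msum_idx a / n]. *)
Lemma vweight_bounds (a : mindex q) i : vweight a i <= mono (part_seq R A i) a /\
  mono (part_seq R A i) a - vweight a i <=
    ((msum_idx a) ^ 2)%:R / n * l1 (part_seq R A i).
Proof.
have c : corner R q (part_seq R A i) := kseq_corner x i.
have u0 j : 0 <= part_seq R A i 0 j by case/andP: (c.1 j).
have u1 j : part_seq R A i 0 j <= 1 by case/andP: (c.1 j).
have an0 (a' : mindex q) j : 0 <= (a' j)%:R / n by rewrite divr_ge0// ltW.
elim/(@mindex_ind q): a => [|a j [IH1 IH2]].
  rewrite /vweight (_ : msum_idx 0 = 0%N); last first.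
    by rewrite /msum_idx big1// => j _; rewrite ffunE.
  rewrite expr0 mul1r /mono /falling.
  rewrite [X in _ <= X /\ X - _ <= _]big1; last by move=> j _; rewrite ffunE expr0.
  rewrite big1; last by move=> j _; rewrite ffunE ffactn0.
  by rewrite subrr !mul0r lexx.
rewrite vweight_incr mono_add mono_unit; split.
  apply: (@le_trans _ _ (vweight a i * part_seq R A i 0 j)).
    by rewrite ler_wpM2l ?vweight_ge0// gerBl.
  by rewrite ler_wpM2r.
rewrite mulrBr opprB addrA addrAC -mulrBl.
have d0 : 0 <= mono (part_seq R A i) a - vweight a i by rewrite subr_ge0.
apply: (@le_trans _ _ (((msum_idx a) ^ 2)%:R / n * l1 (part_seq R A i) +
    (a j)%:R / n * l1 (part_seq R A i))).
  apply: lerD; first by apply: le_trans IH2; rewrite ler_piMr.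
  rewrite mulrC; have [a0|a0] := eqVneq a 0; first by rewrite a0 ffunE !mul0r.
  rewrite ler_wpM2l//; apply: le_trans IH1 _.
  exact: (mono_le_l1 (exist _ a a0) c).
rewrite -mulrDl ler_wpM2r ?l1_ge0// -mulrDl ler_wpM2r ?invr_ge0 ?(ltW n_gt0)//.
rewrite -natrD ler_nat msum_idxD msum_unit sqrnD -addnA leq_add2l muln1.
by apply: leq_trans (leq_addl _ _); rewrite mul2n -addnn /msum_idx (bigD1 j)//= -!addnA leq_addr.
Qed.

Lemma pweight_part_seq b i : pweight (part_seq R A) b i = mono (part_seq R A i) (val b).
Proof.
case: i => //=; case: ifP => // _.
have := msum_idx_gt0 b; rewrite lt0n sum_nat_eq0 negb_forall => /existsP[j].
rewrite -lt0n => bj; rewrite /mono (bigD1 j)//= mxE.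
by case: (val b j) bj => // k _; rewrite expr0n/= mul0r.
Qed.

(** The total of the errors in [vweight_bounds] over all indices is O(1/n), as the
    terms of [part_seq] have total mass 1. *)
Lemma fsum_compare l (m := (\sum_(b <- l) msum_idx (val b))%N) :
  let I := fine (isum (pweight (part_seq R A)) l [::]) in
  [/\ 0 <= fsum A l / n ^+ m, I <= 1 &
  fsum A l / n ^+ m <= I <=
  fsum A l / n ^+ m + (\sum_(b <- l) (msum_idx (val b) ^ 2)%N)%:R / n].
Proof.
have w0 : forall b i, 0 <= pweight (part_seq R A) b i := pweight_ge0 (kseq_ge0 x).
have xfin D : isum (pweight (part_seq R A)) l D \is a fin_num :=
  isum_pweight_fin x l D.
have vE : (isum (fun b => vweight (val b)) l [::] = (fsum A l / n ^+ m)%:E)%E.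
  rewrite (@isum_scale _ _ (fweight A) (fun b => n^-1 ^+ msum_idx (val b))); last 2 first.
  - exact: fweight_ge0.
  - by move=> b; rewrite exprn_ge0// invr_ge0 ltW.
  rewrite fsumE -EFinM mulrC; congr (_ * _)%:E.
  by rewrite -exprVn /m; elim/big_rec2: _ => [|b s y _ ->]; rewrite ?expr0 ?exprD.
move=> I.
have IE : isum (pweight (part_seq R A)) l [::] = I%:E by rewrite fineK.
have le1 : (isum (pweight (part_seq R A)) l [::] <= 1)%E.
  apply: le_trans (isum_le w0 (pweight_fin x) l _) _.
  elim: l {m vE I IE xfin} => [|b l IH]; first by rewrite big_nil.
  rewrite big_cons -[leRHS]mule1 lee_pmul ?(pweight_tot x)//; first exact: (tot_ge0 w0).
  by apply: prode_ge0 => *; exact: (tot_ge0 w0).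
pose e b : R := (msum_idx (val b) ^ 2)%:R / n.
have /andP[lo hi] : (isum (fun b => vweight (val b)) l [::] <=
    isum (pweight (part_seq R A)) l [::] <=
    isum (fun b => vweight (val b)) l [::] + (\sum_(b <- l) e b)%:E)%E.
  apply: isum_compare.
  - by move=> b i; exact: vweight_ge0.
  - by move=> b i; rewrite pweight_part_seq; case: (vweight_bounds (val b) i).
  - by move=> b; rewrite divr_ge0// ltW.
  - exact: (pweight_tot x).
  - move=> b; have [_ _ x1] := kingmanP x.
    have e0 : 0 <= e b by rewrite divr_ge0// ltW.
    rewrite -[leRHS]mule1 -x1 -nneseriesZl; last by move=> *; rewrite lee_fin l1_ge0.
    apply: lee_nneseries => [i _ _|i _]; rewrite pweight_part_seq.
      by rewrite lee_fin subr_ge0; case: (vweight_bounds (val b) i).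
    by rewrite -EFinM lee_fin; case: (vweight_bounds (val b) i).
rewrite vE IE -EFinD !lee_fin in lo hi le1.
split=> //; last first.
  by rewrite lo (le_trans hi)// lerD2l /e -mulr_suml natr_sum.
by rewrite -lee_fin -vE isum_ge0// => b i; exact: vweight_ge0.
Qed.

End sampling_asymptotics.

(** * Asymptotics of the Martin kernel *)

Section finite_partitions.
Context {q : nat}.
Implicit Types (A B : cpart q) (b : nzindex q).

Lemma finite_msum_idx N : finite_set [set b : nzindex q | (msum_idx (val b) <= N)%N].
Proof.
have fin : finite_set [set a : mindex q | (msum_idx a <= N)%N].
  apply: (@sub_finite_set _ _ ((@nat_ffun q N.+1) @` setT)); last exact: finite_image.
  move=> a /= aN; exists [ffun j => inord (a j)] => //.
  apply/ffunP => j; rewrite !ffunE inordK// ltnS; apply: leq_trans aN.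
  by rewrite /msum_idx (bigD1 j)//= leq_addr.
have [->|/set0P[b0 _]] := eqVneq [set b : nzindex q | (msum_idx (val b) <= N)%N] set0.
  exact: finite_set0.
apply: sub_finite_set (finite_image (insubd b0) fin) => b bN.
by exists (val b) => //; rewrite valKd.
Qed.

(** A partition of positive size is a part added to a smaller partition, with
    finitely many choices for both. *)
Lemma finite_psize N : finite_set [set A : cpart q | (psize A <= N)%N].
Proof.
elim: N => [|N IH].
  apply: (@sub_finite_set _ _ [set mset0]); last exact: finite_set1.
  elim/(@cpart_ind q) => //= b A _; rewrite psize_cons leqn0 addn_eq0.
  by rewrite eqn0Ngt msum_idx_gt0.
pose g (bA : nzindex q * cpart q) : cpart q := (bA.1 +` bA.2)%mset.
apply: (@sub_finite_set _ _ ([set mset0] `|`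
    g @` ([set b | (msum_idx (val b) <= N.+1)%N] `*` [set A | (psize A <= N)%N]))).
  elim/(@cpart_ind q) => [|b A _]; first by left.
  rewrite /= psize_cons => bA; right; exists (b, A) => //; split=> /=.
    exact: leq_trans (leq_addr _ _) bA.
  rewrite -ltnS; apply: leq_trans bA.
  by rewrite -[X in (X < _)%N]add0n ltn_add2r msum_idx_gt0.
rewrite finite_setU; split; first exact: finite_set1.
by apply: finite_image; apply: finite_setX => //; exact: finite_msum_idx.
Qed.

Lemma to_infinity_psize (A : nat -> cpart q) :
  to_infinity A <-> psize (A k) @[k --> \oo] --> \oo.
Proof.
split=> [Ainf|Ainf D finD].
  apply/cvgnyPge => N; near=> k; rewrite leqNgt; apply/negP => kN.
  have : ~ (psize (A k) <= N)%N by near: k; exact: Ainf _ (finite_psize N).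
  by apply; exact: ltnW.
pose M := (\sum_(B <- fset_set D) psize B)%N; near=> k => Dk.
have : (M.+1 <= psize (A k))%N by near: k; exact: (cvgnyPge _).1.
rewrite /M (big_fsetD1 (A k))/=; last by rewrite in_fset_set// inE.
by rewrite -addnS -[X in (_ <= X)%N]addn0 leq_add2l.
Unshelve. all: by end_near. Qed.

End finite_partitions.

Section kernel_asymptotics.
Context {R : realType} {q : nat} {theta : R}.
Hypothesis theta_gt0 : 0 < theta.
Variable nu : probability (borel 'rV[R]_q) R.
Hypothesis nu_simplex : nu (simplex R q) = 1%E.
Hypothesis nu_relint : (0 < nu (simplex_relint R q))%E.
Implicit Types (b : nzindex q) (A B C : cpart q) (x : kingman R q).

Local Notation wc B := (weight_const nu (theta := theta) (enum_mset B)).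

Lemma esfE B : esf theta nu B =
  (psize B)`!%:R / (\prod_(i < psize B) (theta + i%:R)) * (pf B *
    \prod_(b <- enum_mset B) (theta * (msum_idx (val b)).-1`!%:R * moment nu (val b))).
Proof.
rewrite /esf big_enum_mset /pf -big_split/=; congr (_ * _); apply: eq_bigr => b _.
have b0 := msum_idx_gt0 b.
have b1 : (msum_idx (val b))%:R != 0 :> R by rewrite pnatr_eq0 -lt0n.
have -> : (msum_idx (val b))`!%:R = (msum_idx (val b))%:R * (msum_idx (val b)).-1`!%:R :> R.
  by rewrite -[X in X`!%:R](prednK b0) factS prednK// natrM.
set F := (msum_idx (val b)).-1`!%:R; set n := (msum_idx (val b))%:R.
rewrite -[iterop _ _ _ _]/((theta * F * moment nu (val b)) ^+ B b).
rewrite invfM -exprVn [RHS]mulrAC [RHS]mulrC -exprMn; congr (_ * _ ^+ _).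
rewrite -(mulrA n) (mulrA (theta / n)) divfK// [RHS]mulrC.
by rewrite [in LHS]mulrA mulrAC.
Qed.

(** The normalisation of the extended kernel by the sampling formula agrees with
    that of the Martin kernel. *)
Lemma psi_const_esf B : psi_const B / esf theta nu B = wc B.
Proof.
rewrite /psi_const esfE /weight_const -psizeE.
set T := \prod_(i < _) _; set H := \prod_(b <- _) _; set n := _`!%:R.
have T0 : T != 0 by rewrite gt_eqF// prodr_gt0// => i _; rewrite ltr_wpDr.
have n0 : n != 0 by rewrite pnatr_eq0 -lt0n fact_gt0.
have H0 : H != 0 by rewrite gt_eqF// prodr_gt0// => b _; exact: den_gt0.
have p0 : pf B != 0 :> R by have := psi_const_gt0 (R := R) B; rewrite /psi_const pmulr_rgt0 ?ltr0n ?fact_gt0// => /gt_eqF->.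
clearbody n T H.
apply/eqP; rewrite eqr_div ?mulf_neq0 ?invr_eq0//.
by rewrite [X in _ == X]mulrA [T * _]mulrCA divff// mulr1 !mulrA.
Qed.

Lemma extended_kernelE B x : extended_kernel theta nu B x =
  wc B * fine (isum (pweight (kseq x)) (enum_mset B) [::]).
Proof.
rewrite -psi_const_esf /extended_kernel /kseq psi_isum mulrAC.
by [].
Qed.

Lemma extended_kernel_power_poly B x : extended_kernel theta nu B x =
  wc B * power_poly (size (enum_mset B)) (powersum x) (enum_mset B).
Proof. by rewrite extended_kernelE /kseq (isum_power_poly x (leqnn _)). Qed.

Context {d : measure_display} {Omega : measurableType d}.
Variables (P : cpart q -> probability Omega R) (X : nat -> Omega -> cpart q).
Hypothesis hX : is_hoppe_chain theta nu P X.
Hypothesis hq : (0 < q)%N.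

Lemma inv_nat_cvg : (n%:R : R)^-1 @[n --> \oo] --> 0.
Proof.
apply/gtr0_cvgV0; last exact: cvgr_idn.
by near=> n; rewrite ltr0n; near: n; exact: nbhs_infty_gt.
Unshelve. all: by end_near. Qed.

Lemma ffact_ratio_cvg m : (n ^_ m)%:R / n%:R ^+ m @[n --> \oo] --> (1 : R).
Proof.
elim: m => [|m IH].
  apply: cvg_near_cst; apply: nearW => n.
  by rewrite ffactn0 expr0 divr1.
have mn : 1 - m%:R / n%:R @[n --> \oo] --> (1 : R).
  rewrite -[X in _ --> X]subr0; apply: cvgB; first exact: cvg_cst.
  by rewrite -[X in _ --> X](mulr0 m%:R); apply: cvgM; [exact: cvg_cst|exact: inv_nat_cvg].
rewrite -[X in _ --> X]mulr1; apply: cvg_trans; last exact: (cvgM IH mn).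
apply: near_eq_cvg.
near=> n; have n0 : n%:R != 0 :> R.
  by rewrite pnatr_eq0 -lt0n; near: n; exact: nbhs_infty_gt.
have mlen : (m <= n)%N by near: n; exact: nbhs_infty_ge.
rewrite /= ffactnSr natrM natrB// exprSr.
have -> : 1 - m%:R / n%:R = (n%:R - m%:R) / n%:R :> R by rewrite mulrBl divff.
by rewrite mulf_div.
Unshelve. all: by end_near. Qed.

(** Sampling with and without replacement agree in the limit of a large urn. *)
Lemma kernel_asymp B (A : nat -> cpart q) : to_infinity A ->
  martin_kernel P X B (A k) - extended_kernel theta nu B (embed R hq (A k))
    @[k --> \oo] --> 0.
Proof.
move=> /to_infinity_psize Ainf.
set l := enum_mset B; set m := psize B.
pose C : R := (\sum_(b <- l) (msum_idx (val b) ^ 2)%N)%:R.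
pose r n : R := ((n ^_ m)%:R / n%:R ^+ m)^-1.
pose g n : R := wc B * (`|r n - 1| + C / n%:R).
have g0 : g n @[n --> \oo] --> (0 : R).
  rewrite -[X in _ --> X](mulr0 (wc B)); apply: cvgM; first exact: cvg_cst.
  rewrite -[X in _ --> X]addr0; apply: cvgD.
    have -> : 0 = `|1^-1 - 1| :> R by rewrite invr1 subrr normr0.
    apply: cvg_norm; apply: cvgB; last exact: cvg_cst.
    by apply: cvgV; [exact: oner_neq0|exact: ffact_ratio_cvg].
  by rewrite -[X in _ --> X](mulr0 C); apply: cvgM; [exact: cvg_cst|exact: inv_nat_cvg].
apply/norm_cvg0P; apply: (@squeeze_cvgr _ _ _ _ (cst 0) (fun k => g (psize (A k)))).
- near=> k; rewrite normr_ge0 /=.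
  have n0 : (0 < psize (A k))%N.
    by near: k; exact: (cvgnyPgt _).1.
  have mn : (m <= psize (A k))%N.
    by near: k; exact: (cvgnyPge _).1.
  rewrite (martin_kernelE theta_gt0 nu_simplex nu_relint hX mn) extended_kernelE.
  rewrite (kseq_embed _ _ n0) /hfun.
  have [y0 I1 /andP[yI Iy]] := fsum_compare (R := R) n0 l.
  rewrite -psizeE -/m -/l -/C in y0 yI Iy; rewrite -/l -/m.
  set n := psize (A k) in n0 mn y0 I1 yI Iy *.
  set I := fine _ in I1 yI Iy *.
  set y := fsum (A k) l / n%:R ^+ m in y0 yI Iy.
  have N0 : (n ^_ m)%:R != 0 :> R by rewrite pnatr_eq0 -lt0n ffact_gt0.
  have n0' : n%:R ^+ m != 0 :> R by rewrite expf_neq0// pnatr_eq0 -lt0n.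
  have -> : wc B * fsum (A k) l / (n ^_ m)%:R = wc B * (y * r n).
    rewrite /y /r invf_div -mulrA; congr (_ * _).
    by rewrite mulrA divfK.
  rewrite -mulrBr normrM ger0_norm ?ler_wpM2l ?(ltW (weight_const_gt0 _ _ _ _))//.
  have -> : y * r n - I = y * (r n - 1) - (I - y) by rewrite mulrBr mulr1 opprB addrA subrK.
  apply: le_trans (ler_normB _ _) _; apply: lerD.
    by rewrite normrM ger0_norm// ler_piMl// (le_trans yI).
  by rewrite ger0_norm ?subr_ge0// lerBlDl.
- exact: cvg_cst.
- exact: (cvg_comp _ _ Ainf g0).
Unshelve. all: by end_near. Qed.

End kernel_asymptotics.

(** * Convergence in the Kingman simplex *)

Lemma initial_cvg (S : choiceType) (T : topologicalType) (f : S -> T) (I : Type)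
    (F : set_system I) (u : I -> initial_topology f) (s : initial_topology f) :
  Filter F ->
  (u t @[t --> F] --> s) <-> (f (u t) @[t --> F] --> f s).
Proof.
move=> FF; split=> [us|fus].
  exact: (cvg_comp _ _ us (@initial_continuous _ _ f s)).
move=> A [_ [[B Bop <-] Bfs sBfA]]; have : nbhs (f s) B by exact: open_nbhs_nbhs.
move=> /fus FB; have {}FB : \forall t \near F, B (f (u t)) by exact: FB.
suff : \forall t \near F, A (u t) by [].
by apply: filterS FB => t; exact: sBfA.
Qed.

Lemma cvg_rV {R : realType} (q : nat) (I : Type) (F : set_system I)
    (u : I -> 'rV[R]_q) (v : 'rV[R]_q) : Filter F ->
  (u t @[t --> F] --> v) <-> (forall j, u t 0 j @[t --> F] --> v 0 j).
Proof.
move=> FF; split=> [uv j|uv].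
  exact: (cvg_comp _ _ uv (@coord_cvg R q j v)).
apply/cvg_ballP => e e0.
have H : \forall t \near F, forall j : 'I_q, ball (v 0 j) e (u t 0 j).
  by apply: filter_forall => j; apply: (cvg_ball (uv j)).
near=> t; split=> // i j; rewrite ord1.
by move: j; near: t.
Unshelve. all: by end_near. Qed.

Lemma cvg_ptws {R : realType} (U I : Type) (F : set_system I)
    (g : I -> {ptws U -> R}) (g0 : {ptws U -> R}) : Filter F ->
  (g t @[t --> F] --> g0) <-> (forall i, g t i @[t --> F] --> g0 i).
Proof.
move=> FF; split=> [gg0 i|gg0].
  apply/(@initial_cvg _ _ (fun f : {ptws U -> R} => f i) _ _ g g0).
  by move/cvg_sup : gg0 => /(_ i).
apply/cvg_sup => i.
exact/(@initial_cvg _ _ (fun f : {ptws U -> R} => f i) _ _ g g0)/gg0.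
Qed.

Section kingman_convergence.
Context {R : realType} {q : nat}.
Implicit Types (x : kingman R q).

(** The topology is initial for the mass and for the expectations of the bounded
    continuous functions. *)
Lemma cvg_kingman (I : Type) (F : set_system I) (u : I -> kingman R q) x : Filter F ->
  (u t @[t --> F] --> x) <->
  (forall j, kmass (u t) 0 j @[t --> F] --> kmass x 0 j) /\
  (forall f : bcfun R (cornerT R q),
     \int[kmeasure (u t)]_s (sval f : borel (cornerT R q) -> R) s @[t --> F] -->
     \int[kmeasure x]_s (sval f : borel (cornerT R q) -> R) s).
Proof.
move=> FF.
rewrite (@initial_cvg (kingman_seq R q) _ (@tau_map R q) I F u x FF).
split=> [tux|[ux fx]].
  have t1 : (tau_map (u t)).1 @[t --> F] --> (tau_map x).1.
    apply: (@cvg_comp _ _ _ (fun t => tau_map (u t)) fst F _ _ tux).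
    exact: cvg_fst.
  have t2 : (tau_map (u t)).2 @[t --> F] --> (tau_map x).2.
    apply: (@cvg_comp _ _ _ (fun t => tau_map (u t)) snd F _ _ tux).
    exact: cvg_snd.
  split.
    apply/cvg_rV.
    exact: (@initial_cvg _ _ (@set_val _ (simplex R q)) _ F _ _ _).1 t1.
  apply/(@cvg_ptws _ (bcfun R (cornerT R q)) _ F
    (fun t => expectations (kmeasure (u t))) (expectations (kmeasure x))).
  exact: (@initial_cvg _ _ (@expectations R (cornerT R q)) _ F _ _ _).1 t2.
have t1 : (tau_map (u t)).1 @[t --> F] --> (tau_map x).1.
  apply: (@initial_cvg _ _ (@set_val _ (simplex R q)) _ F _ _ _).2.
  exact/cvg_rV.
have t2 : (tau_map (u t)).2 @[t --> F] --> (tau_map x).2.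
  apply: (@initial_cvg _ _ (@expectations R (cornerT R q)) _ F _ _ _).2.
  exact/cvg_ptws.
exact: (@cvg_pair _ _ _ F (nbhs (tau_map x).1) (nbhs (tau_map x).2) _ _ _ _ _ t1 t2).
Qed.

End kingman_convergence.

(** * Expectations under the measure of a point *)

Section kingman_integrals.
Context {R : realType} {q : nat}.
Local Notation Sq := (cornerT R q).
Implicit Types (x : kingman_seq R q) (f g : Sq -> R).

Definition corner_zero : Sq := exist _ 0 (corner0 R q).

Lemma kmeasure_integral x f : continuous f -> (forall t, 0 <= f t) ->
  (\int[kmeasure x]_t (f t : R)%:E =
   (l1 (sval x 0%N) * f corner_zero)%:E +
   \sum_(0 <= i <oo) (l1 (sval x i.+1) * f (katom x i.+1))%:E)%E.
Proof.
move=> cf f0.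
have mf : measurable_fun setT (EFin \o (f : borel Sq -> R)).
  by apply/measurable_EFinP; exact: continuous_measurable_borel.
have fE0 t : (0 <= (f t)%:E)%E by rewrite lee_fin.
rewrite /kmeasure ge0_integral_measure_add//; congr (_ + _)%E.
  by rewrite ge0_integral_mscale// integral_dirac// diracT mul1e.
pose m i : {measure set (borel Sq) -> \bar R} := mscale (kweight x i.+1) (dirac (katom x i.+1)).
transitivity (\int[mseries m 0]_t (f t : R)%:E)%E.
  apply: eq_measure_integral => A mA _.
  pose u i : \bar R := mscale (kweight x i) (dirac (katom x i)) A.
  have u0 i : (0 <= u i)%E by exact: measure_ge0.
  rewrite -[LHS]/(\sum_(1 <= i <oo) u i)%E -(nneseries_addn 1 u0).
  by apply: eq_eseriesr => i _; rewrite addn1.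
rewrite ge0_integral_measure_series//; apply: eq_eseriesr => i _.
by rewrite /m ge0_integral_mscale// integral_dirac// diracT mul1e.
Qed.

Lemma bcfun_integrable (mu : probability (borel Sq) R) f :
  continuous f -> bounded_fun f -> mu.-integrable setT (EFin \o (f : borel Sq -> R)).
Proof.
move=> cf bf; apply: measurable_bounded_integrable => //.
- have e : mu setT = 1%E := probability_setT mu.
  by rewrite [ltLHS]e ltry.
- exact: continuous_measurable_borel.
Qed.


Definition hext f (u : 'rV[R]_q) : R := if insub u is Some v then f v else 0.

Lemma hext_val f (v : Sq) : hext f (val v) = f v.
Proof. by rewrite /hext valK. Qed.

Definition atom_sum (h : 'rV[R]_q -> R) (y : nat -> 'rV[R]_q) : \bar R :=
  (\sum_(0 <= i <oo) (l1 (y i.+1) * h (y i.+1))%:E)%E.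

Lemma kmeasure_atom_sum x f : continuous f -> (forall t, 0 <= f t) ->
  f corner_zero = 0 ->
  (\int[kmeasure x]_t (f t : R)%:E = atom_sum (hext f) (sval x))%E.
Proof.
move=> cf f0 fz; rewrite kmeasure_integral// fz mulr0 add0e.
by apply: eq_eseriesr => i _; rewrite -(hext_val f (katom x i.+1)).
Qed.

Lemma corner_max_continuous f g : continuous f -> continuous g ->
  continuous (fun t => Num.max (f t) (g t)).
Proof. move=> cf cg t; exact: (@continuous_max R Sq f g t (cf t) (cg t)). Qed.

(** The dust enters an expectation only through the value of [f] at 0.  Centering
    [f] there and separating signs leaves nonnegative functions vanishing at 0,
    whose expectations are sums over the atoms. *)
Lemma expectation_split x f : continuous f -> bounded_fun f ->
  \int[kmeasure x]_t (f t : R) = f corner_zero +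
    (\int[kmeasure x]_t (Num.max (f t - f corner_zero) 0 : R) -
     \int[kmeasure x]_t (Num.max (f corner_zero - f t) 0 : R)).
Proof.
move=> cf bf; set c := f corner_zero.
have cst_cont (r : R) : continuous (fun _ : Sq => r) by exact: cst_continuous.
have cfc : continuous (fun t => Num.max (f t - c) 0).
  by apply: corner_max_continuous => // t; exact: (cvgB (cf t) (cst_cont c t)).
have cfc' : continuous (fun t => Num.max (c - f t) 0).
  by apply: corner_max_continuous => // t; exact: (cvgB (cst_cont c t) (cf t)).
have [M [_ /(_ (`|M| + 1))]] := bf.
rewrite (le_lt_trans (ler_norm _)) ?ltrDl// => /(_ isT) fM.
have bounded_pos (g : Sq -> R) : (forall t, `|g t| <= `|f t| + `|c|) ->
    bounded_fun (fun t => Num.max (g t) 0).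
  move=> gf; exists (`|M| + 1 + `|c|); split => // N MN t _ /=.
  have gN : `|g t| <= N.
    by apply: le_trans (ltW MN); apply: le_trans (gf t) _; rewrite lerD2r; exact: fM.
  rewrite ger0_norm ?le_max ?lexx ?orbT// ge_max.
  by rewrite (le_trans (ler_norm _) gN) (le_trans _ gN).
have bfc : bounded_fun (fun t => Num.max (f t - c) 0).
  by apply: bounded_pos => t; exact: ler_normB.
have bfc' : bounded_fun (fun t => Num.max (c - f t) 0).
  by apply: bounded_pos => t; rewrite distrC; exact: ler_normB.
have i1 := bcfun_integrable (kmeasure x) cfc bfc.
have i2 := bcfun_integrable (kmeasure x) cfc' bfc'.
have i3 : (kmeasure x).-integrable setT (EFin \o (fun _ : borel Sq => c)).
  by apply: finite_measure_integrable_cst.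
rewrite -RintegralB//.
rewrite -[X in X + _]mulr1 -[X in c * X](_ : fine (kmeasure x setT) = 1); last first.
  by rewrite kmeasureT.
rewrite -(Rintegral_cst (kmeasure x))// -RintegralD//; last first.
  exact: (integrableB measurableT i1 i2).
apply: eq_Rintegral => t _; rewrite -[c - f t]opprB.
have -> : forall r : R, Num.max (- r) 0 = - Num.min r 0.
  by move=> r; rewrite -[in LHS]oppr0 oppr_min.
by rewrite opprK addr_max_min addr0 addrC subrK.
Qed.

End kingman_integrals.

Section power_density.
Context {R : realType} {q : nat}.
Local Notation Sq := (cornerT R q).
Implicit Types (x : kingman_seq R q) (b : nzindex q).

Lemma set_val_continuous (A : set 'rV[R]_q) : continuous (@set_val _ A).
Proof. exact: initial_continuous. Qed.

(** The density of the power sum of exponent [val b] with respect to the measure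
    of the atoms; it extends continuously by 0 at the origin. *)
Definition power_density b (t : Sq) : R := mono (val t) (val b) / l1 (val t).

Lemma cornerP (t : Sq) : corner R q (val t). Proof. exact/set_mem/(valP t). Qed.

Lemma mono_le_l1_sqr (u : 'rV[R]_q) b : corner R q u -> (1 < msum_idx (val b))%N ->
  mono u (val b) <= l1 u * l1 u.
Proof.
move=> cu; case: b => a a0 /= b1.
have [j aj] : exists j, (0 < a j)%N.
  have := ltnW b1; rewrite lt0n sum_nat_eq0 negb_forall => /existsP[j].
  by rewrite -lt0n; exists j.
have aE : a = [ffun k => a k - (k == j)]%N + unit_idx j.
  apply/ffunP => k; rewrite !ffunE natrDE; case: eqP => [->|_]; last by rewrite subn0 addn0.
  by rewrite subnK.
have c0 : [ffun k => a k - (k == j)]%N != 0 :> mindex q.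
  by move: b1; rewrite {1}aE msum_idxD msum_unit addn1 ltnS lt0n msum_idx_eq0.
rewrite aE mono_add mono_unit; have u0 k : 0 <= u 0 k by case/andP: (cu.1 k).
apply: ler_pM => //; first exact: mono_ge0.
  by have := mono_le_l1 (exist (fun c : mindex q => c != 0) _ c0 : nzindex q) cu.
by rewrite -[leLHS]ger0_norm// coord_le_l1.
Qed.

Lemma power_density_le b t : (1 < msum_idx (val b))%N -> power_density b t <= l1 (val t).
Proof.
move=> b1; rewrite /power_density; have [->|l0] := eqVneq (l1 (val t)) 0.
  by rewrite invr0 mulr0.
rewrite ler_pdivrMr; last by rewrite lt_neqAle eq_sym l0 l1_ge0.
by apply: mono_le_l1_sqr => //; exact: cornerP.
Qed.

Lemma power_density_ge0 b t : 0 <= power_density b t.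
Proof.
rewrite divr_ge0 ?l1_ge0// mono_ge0// => j.
by case/andP: ((cornerP t).1 j).
Qed.

Lemma power_density_continuous b : (1 < msum_idx (val b))%N ->
  continuous (power_density b).
Proof.
move=> b1 t.
have cl : l1 (val s) @[s --> t] --> l1 (val t).
  apply: (@cvg_comp _ _ _ (@set_val _ (corner R q)) (@l1 R q)); first exact: set_val_continuous.
  exact: l1_continuous.
have [l0|l0] := eqVneq (l1 (val t)) 0.
  rewrite /continuous_at (_ : power_density b t = 0); last first.
    by rewrite /power_density l0 invr0 mulr0.
  apply: (@squeeze_cvgr _ (nbhs t) _ _ (cst 0) (fun s : Sq => l1 (val s))).
  - apply: nearW => s; rewrite power_density_ge0 power_density_le//.
  - exact: cvg_cst.
  - by rewrite -[X in _ --> X]l0.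
have cv : (l1 (val s))^-1 @[s --> t] --> (l1 (val t))^-1 .
  by apply: (@cvgV _ _ _ _ (fun s : Sq => l1 (val s))) l0 cl.
have cm : mono (val s) (val b) @[s --> t] --> mono (val t) (val b).
  apply: (@cvg_comp _ _ _ (@set_val _ (corner R q)) (fun u => mono u (val b))).
    exact: set_val_continuous.
  exact: mono_continuous.
have FF : Filter (nbhs t) by exact: (@nbhs_filter (cornerT R q) t).
have H := cvgM cm cv. exact: (H FF).
Qed.

Lemma power_density_bounded b : (1 < msum_idx (val b))%N -> bounded_fun (power_density b).
Proof.
move=> b1; exists 1; split => // M M1 t _ /=.
rewrite ger0_norm; last exact: power_density_ge0.
apply: le_trans (ltW M1).
by apply: le_trans (power_density_le _ b1) _; case: (cornerP t).
Qed.

Lemma power_density_zero b : power_density b (corner_zero : Sq) = 0.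
Proof.
rewrite /power_density /corner_zero /= /l1 big1 ?invr0 ?mulr0// => j _.
by rewrite mxE normr0.
Qed.

Lemma l1_power_density b (v : 'rV[R]_q) : corner R q v ->
  l1 v * hext (power_density b) v = mono v (val b).
Proof.
move=> cv; rewrite -[v in hext _ v]/(val (exist _ v (mem_set cv) : Sq)) hext_val.
rewrite /power_density /=; have [l0|l0] := eqVneq (l1 v) 0; last by rewrite mulrC divfK.
rewrite l0 mul0r; apply/eqP; rewrite eq_le mono_ge0 ?andbT => [|j].
  by rewrite -[leRHS]l0; apply: mono_le_l1.
by case/andP: (cv.1 j).
Qed.

Lemma powersum_expectation x b : (1 < msum_idx (val b))%N ->
  \int[kmeasure x]_t (power_density b (t : borel Sq) : R) = powersum x b.
Proof.
move=> b1; rewrite /Rintegral kmeasure_atom_sum.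
- rewrite /powersum (nneseries_recl (P := xpredT)) //; last first.
    by move=> k _; rewrite lee_fin pweight_ge0//; exact: kseq_ge0.
  rewrite /= gtn_eqF// add0e -(nneseries_addn 1); last first.
    by move=> k; rewrite lee_fin pweight_ge0//; exact: kseq_ge0.
  congr fine; apply: eq_eseriesr => i _; rewrite addn1 /=; congr EFin.
  by rewrite l1_power_density//; exact: kseq_corner.
- exact: power_density_continuous.
- exact: power_density_ge0.
- exact: power_density_zero.
Qed.

Lemma powersum_unit x j : powersum x (nz_unit j) = kmass x 0 j.
Proof.
rewrite /powersum mxE; congr fine; apply: eq_eseriesr => -[|i] _ /=.
  by rewrite msum_unit eqxx mono_unit.
by rewrite mono_unit.
Qed.

(** Continuity of the power sums: each is a coordinate of the mass or the
    expectation of a bounded continuous function. *)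
Lemma cvg_powersum (I : Type) (F : set_system I) (u : I -> kingman R q) (x : kingman R q) :
  Filter F -> u t @[t --> F] --> x ->
  forall b, powersum (u t) b @[t --> F] --> powersum x b.
Proof.
move=> FF /cvg_kingman [mx fx] b.
have [b1|b1] := ltnP 1 (msum_idx (val b)).
  pose f : bcfun R Sq := exist _ (power_density b)
    (conj (power_density_continuous b1) (power_density_bounded b1)).
  have := fx f; rewrite powersum_expectation//.
  by under eq_cvg do rewrite powersum_expectation//.
have : (msum_idx (val b) == 1%N) by rewrite eqn_leq b1 msum_idx_gt0.
rewrite msum_idx_eq1 => /existsP[j /eqP->]; rewrite powersum_unit.
by under eq_cvg do rewrite powersum_unit; exact: mx.
Qed.

End power_density.

(** * A compact space of sequences *)

Section sequence_space.
Context {R : realType} {q : nat}.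
Implicit Types (x : kingman_seq R q) (y z : {ptws nat -> 'rV[R]_q}) (u v : 'rV[R]_q).

(** Sequences with the total mass, instead of the dust, at index 0.  The terms need
    not be sorted; what is kept from the order is the decay, which makes tails
    uniformly small.  The constant 2 leaves room for rounded sequences. *)
Definition zspace : set {ptws nat -> 'rV[R]_q} := [set y |
  [/\ forall i, corner R q (y i), simplex R q (y 0%N),
      forall i, i%:R * l1 (y i) <= 2
    & forall N j, \sum_(i < N) y i.+1 0 j <= y 0%N 0 j]].

Lemma corner_closed : closed (corner R q).
Proof.
have -> : corner R q = \bigcap_(j in [set: 'I_q])
    ((fun u : 'rV[R]_q => u 0 j) @^-1` `[0, 1]) `&` (@l1 R q) @^-1` [set t | t <= 1].
  apply/seteqP; split=> u; first by move=> [u01 u1]; split => // j _ /=; rewrite in_itv/= u01.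
  by move=> [u01 u1]; split=> // j; have := u01 j I; rewrite /= in_itv/=.
apply: closedI.
  apply: closed_bigI => j _; apply: closed_comp; last exact: itv_closed.
  by move=> u _; exact: coord_cvg.
by apply: closed_comp; [move=> u _; exact: l1_continuous|exact: closed_le].
Qed.

Lemma corner_compact : compact (corner R q).
Proof.
apply: (@subclosed_compact _ _ [set u : 'rV[R]_q | forall j, `[0, 1]%classic (u ord0 j)]).
- exact: corner_closed.
- by apply: (@rV_compact R q (fun=> `[0, 1]%classic)) => j; exact: segment_compact.
- by move=> u [u01 _] j /=; rewrite in_itv/= u01.
Qed.

Lemma ptws_eval_continuous i : continuous (fun y => y i).
Proof. exact: (@proj_continuous nat (fun=> 'rV[R]_q) i). Qed.

Lemma zspace_compact : compact zspace.
Proof.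
apply: (@subclosed_compact {ptws nat -> 'rV[R]_q} zspace
  [set y : {ptws nat -> 'rV[R]_q} | forall i : nat, corner R q (y i)]).
- pose c N j y : R := y 0%N 0 j - \sum_(i < N) y i.+1 0 j.
  have -> : zspace = (\bigcap_(i in [set: nat]) ((fun y => y i) @^-1` corner R q) `&`
      (fun y => y 0%N) @^-1` simplex R q) `&`
      (\bigcap_(i in [set: nat])
         ((fun y => i%:R * l1 (y i)) @^-1` [set t | t <= 2]) `&`
       \bigcap_(N in [set: nat]) \bigcap_(j in [set: 'I_q])
         (c N j @^-1` [set t | 0 <= t])).
    apply/seteqP; split=> y.
      move=> [y1 y2 y3 y4]; split; split => //= i _; [exact: y1|exact: y3|].
      by move=> j _ /=; rewrite /c subr_ge0.
    move=> [[y1 y2] [y3 y4]]; split=> //.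
    - by move=> i; exact: y1.
    - by move=> i; exact: y3.
    - by move=> N j; have := y4 N I j I; rewrite /= /c subr_ge0.
  have coord i j : continuous (fun y => y i 0 j).
    move=> y; apply: (@continuous_comp _ _ _ (fun y : {ptws nat -> 'rV[R]_q} => y i) (fun u : 'rV[R]_q => u 0 j)).
      exact: ptws_eval_continuous.
    exact: coord_cvg.
  have l1c i : continuous (fun y => l1 (y i)).
    move=> y; apply: (@continuous_comp _ _ _ (fun y : {ptws nat -> 'rV[R]_q} => y i) (@l1 R q)).
      exact: ptws_eval_continuous.
    exact: l1_continuous.
  apply: closedI; apply: closedI.
  + apply: closed_bigI => i _; apply: closed_comp; last exact: corner_closed.
    by move=> y _; exact: ptws_eval_continuous.
  + apply: closed_comp; last exact: simplex_closed.
    by move=> y _; exact: ptws_eval_continuous.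
  + apply: closed_bigI => i _; apply: closed_comp; last exact: closed_le.
    by move=> y _; exact: (cvgMl_tmp (l1c i y)).
  + apply: closed_bigI => N _; apply: closed_bigI => j _.
    apply: closed_comp; last exact: closed_ge.
    have sc : continuous (fun y => \sum_(i < N) y i.+1 0 j).
      move=> y; apply: cvg_big => [||i _]; [exact: add_continuous|exact: nbhs_filter|].
      exact: coord.
    by move=> y _; exact: (cvgB (coord 0%N j y) (sc y)).
- by apply: (@tychonoff nat (fun=> 'rV[R]_q) (fun=> corner R q)) => i; exact: corner_compact.
- by move=> y [].
Qed.

Lemma zspace_sum_l1 y N : zspace y -> \sum_(i < N) l1 (y i.+1) <= 1.
Proof.
move=> [y1 [_ y2] _ y4]; rewrite -y2 /l1 exchange_big/=.
apply: ler_sum => j _; apply: le_trans (ler_norm _); apply: le_trans (y4 N j).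
by apply: ler_sum => i _; rewrite ger0_norm//; case/andP: ((y1 i.+1).1 j).
Qed.

(** Functions on the corner given as functions on all vectors, so that they apply
    to arbitrary sequences. *)
Definition admissible (h : 'rV[R]_q -> R) := [/\ forall u, 0 <= h u, h 0 = 0
  & forall v, corner R q v -> h u @[u --> within (corner R q) (nbhs v)] --> h v].

Lemma admissible_small h (e : R) : admissible h -> 0 < e ->
  exists2 r, 0 < r & forall u, corner R q u -> l1 u < r -> h u <= e.
Proof.
move=> [h0 hz hc] e0; have c0 : corner R q 0 by exact/set_mem/corner0.
have /cvgr0_norm_le : h u @[u --> within (corner R q) (nbhs (0 : 'rV[R]_q))] --> 0.
  by rewrite -[X in _ --> X]hz; exact: hc.
move=> /(_ _ e0)/nbhs_ballP[r /= r0 hr]; exists r => // u cu ur.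
apply: le_trans (ler_norm _) _; apply: hr => //.
split=> // i j; rewrite /ball/= mxE sub0r normrN ord1.
exact: le_lt_trans (coord_le_l1 u j) ur.
Qed.

Definition zsum h (y : nat -> 'rV[R]_q) : R := fine (atom_sum h y).

(** Beyond index [N] all terms are so close to 0 that [h] is at most [e] there, and
    the total mass is at most 1. *)
Lemma zsum_tail h (e : R) : admissible h -> 0 < e -> exists N, forall y, zspace y ->
  atom_sum h y = (zsum h y)%:E /\
  `|zsum h y - \sum_(i < N) l1 (y i.+1) * h (y i.+1)| <= e.
Proof.
move=> ha e0; have [h0 _ _] := ha; have [r r0 hr] := admissible_small ha e0.
pose N := Num.truncn (2 / r); exists N => y zy; have [y1 _ y3 _] := zy.
have hN i : (N <= i)%N -> h (y i.+1) <= e.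
  move=> Ni; apply: hr => //; have := y3 i.+1.
  rewrite mulrC -ler_pdivlMr// => /le_lt_trans; apply.
  rewrite ltr_pdivrMr// mulrC -ltr_pdivrMr//.
  by apply: lt_le_trans (truncnS_gt _) _; rewrite ler_nat ltnS.
have t0 i : (0 <= (l1 (y i.+1) * h (y i.+1))%:E)%E.
  by rewrite lee_fin mulr_ge0 ?l1_ge0.
set tail := (\sum_(N <= i <oo) (l1 (y i.+1) * h (y i.+1))%:E)%E.
have aE : atom_sum h y = ((\sum_(i < N) l1 (y i.+1) * h (y i.+1))%:E + tail)%E.
  by rewrite /atom_sum (@nneseries_split _ _ 0 N)// add0n big_mkord sumEFin.
have tail0 : (0 <= tail)%E by apply: nneseries_ge0.
have taile : (tail <= e%:E)%E.
  apply: lime_le; first by apply: is_cvg_nneseries.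
  apply: nearW => n; rewrite sumEFin lee_fin.
  have [Nn|nN] := leqP N n; last by rewrite big_geq ?ltW// ltnW.
  apply: (@le_trans _ _ (\sum_(N <= i < n) l1 (y i.+1) * e)).
    rewrite big_nat [leRHS]big_nat; apply: ler_sum => i /andP[Ni _].
    by rewrite ler_wpM2l ?l1_ge0 ?hN.
  rewrite -mulr_suml; apply: ler_piMl; first exact: ltW. 
  apply: le_trans (zspace_sum_l1 n zy).
  rewrite -(big_mkord xpredT (fun i => l1 (y i.+1))) [leRHS](big_cat_nat _ Nn)//=.
  by rewrite lerDr sumr_ge0// => i _; exact: l1_ge0.
have tf : tail \is a fin_num by rewrite ge0_fin_numE// (le_lt_trans taile)// ltry.
have af : atom_sum h y \is a fin_num by rewrite aE fin_numD tf.
rewrite /zsum fineK//; split=> //.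
rewrite aE fineD//= addrC addKr ger0_norm ?fine_ge0//.
by rewrite -lee_fin fineK.
Qed.

Lemma zsum_cvg h (I : Type) (F : set_system I) (u : I -> {ptws nat -> 'rV[R]_q}) y :
  Filter F -> admissible h -> (\forall t \near F, zspace (u t)) -> zspace y ->
  (forall i, u t i @[t --> F] --> y i) ->
  zsum h (u t) @[t --> F] --> zsum h y.
Proof.
move=> FF ha zu zy uy; apply/cvgrPdist_le => e e0.
have e3 : 0 < e / 3 by rewrite divr_gt0.
have [N HN] := zsum_tail ha e3.
have cN : \sum_(i < N) l1 (u t i.+1) * h (u t i.+1) @[t --> F] -->
          \sum_(i < N) l1 (y i.+1) * h (y i.+1).
  apply: cvg_big => [|i _]; first exact: add_continuous.
  apply: cvgM.
    by apply: (@cvg_comp _ _ _ (fun t => u t i.+1) (@l1 R q)); [exact: uy|exact: l1_continuous].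
  have [_ _ hc] := ha; have [y1 _ _ _] := zy.
  apply: (@cvg_comp _ _ _ (fun t => u t i.+1) h); last exact: (hc _ (y1 i.+1)).
  move=> A wA; have := uy i.+1 _ wA => H.
  suff : \forall t \near F, A (u t i.+1) by [].
  apply: filterS2 zu H => t [ut1 _ _ _]; apply; exact: ut1.
have /cvgrPdist_le/(_ _ e3) {}cN := cN.
apply: filterS2 zu cN => t zt ct.
have [_ h1] := HN _ zt; have [_ h2] := HN _ zy.
set a := zsum h y in h2 *; set b := zsum h (u t) in h1 *.
set c := \sum_(_ < _) _ in h2 ct; set c' := \sum_(_ < _) _ in h1 ct.
have -> : a - b = (a - c) + (c - c') - (b - c').
  by rewrite opprB !subrKA.
have -> : e = e / 3 + e / 3 + e / 3.
  by rewrite -[LHS](@divfK _ 3) ?pnatr_eq0// -[X in _ * X = _]/(1 + (1 + 1) : R) !mulrDr !mulr1 addrA.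
apply: le_trans (ler_normB _ _) _; apply: lerD => //.
by apply: le_trans (ler_normD _ _) _; exact: lerD.
Qed.

Lemma admissible_hext (f : cornerT R q -> R) : continuous f -> (forall t, 0 <= f t) ->
  f corner_zero = 0 -> admissible (hext f).
Proof.
move=> cf f0 fz; split.
- by move=> u; rewrite /hext; case: insubP.
- by rewrite -[X in hext f X]/(val corner_zero) hext_val.
- move=> v cv A; pose v' : cornerT R q := exist _ v (mem_set cv).
  rewrite -[v]/(val v') hext_val => /(cf v').
  move=> [_ [[B Bop <-] Bv sBA]].
  have : nbhs v B by exact: open_nbhs_nbhs.
  apply: filterS => u Bu cu /=.
  rewrite -[u]/(val (exist _ u (mem_set cu) : cornerT R q)) hext_val.
  exact: sBA.
Qed.

Definition zseq x : {ptws nat -> 'rV[R]_q} := fun i => if i is 0 then kmass x else sval x i.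

End sequence_space.

(** * Sorting a sequence *)

Section shortlex_order.
Context {R : realType} {q : nat}.
Implicit Types (u v : 'rV[R]_q).

Lemma shortlex_l1 u v : (shortlex u <= shortlex v)%O -> l1 u <= l1 v.
Proof. by rewrite lexi_cons => /andP[]. Qed.

Lemma l1_shortlex u v : l1 u < l1 v -> (shortlex u <= shortlex v)%O.
Proof. by move=> uv; rewrite lexi_cons ltW//= leNgt uv. Qed.

Lemma l1_eq0 u : l1 u = 0 -> u = 0.
Proof.
move=> u0; apply/rowP => j; rewrite mxE; apply/eqP.
by rewrite -normr_le0 -u0 coord_le_l1.
Qed.

End shortlex_order.

Section zseq.
Context {R : realType} {q : nat}.
Implicit Types (x : kingman_seq R q).

Lemma kmassE x j : ((kmass x 0 j)%:E = \sum_(0 <= i <oo) (sval x i 0 j)%:E)%E.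
Proof.
rewrite -powersum_unit -powersumE; apply: eq_eseriesr => -[|i] _ /=.
  by rewrite msum_unit eqxx mono_unit.
by rewrite mono_unit.
Qed.

Lemma kseq_l1_le x i : i%:R * l1 (sval x i) <= 1.
Proof.
have [x0 xs x1] := kingmanP x; case: i => [|i]; first by rewrite mul0r.
have lx k : (k <= i)%N -> l1 (sval x i.+1) <= l1 (sval x k.+1).
  elim: i => [|i IH]; first by rewrite leqn0 => /eqP->.
  rewrite leq_eqVlt => /orP[/eqP->//|]; rewrite ltnS => /IH.
  by apply: le_trans; apply: shortlex_l1; exact: xs.
rewrite -lee_fin -[leRHS]x1 (@nneseries_split _ _ 0 i.+2); last first.
  by move=> k _; rewrite lee_fin l1_ge0.
rewrite add0n big_nat_recl// sumEFin -addeA -[leLHS]add0e; apply: leeD.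
  by rewrite lee_fin l1_ge0.
rewrite -[leLHS]adde0; apply: leeD; last first.
  by apply: nneseries_ge0 => k _ _; rewrite lee_fin l1_ge0.
rewrite lee_fin big_mkord mulr_natl -[X in _ *+ X]card_ord -sumr_const.
by apply: ler_sum => k _; apply: lx; rewrite -ltnS.
Qed.

Lemma zseq_zspace x : zspace (zseq x).
Proof.
have [x0 xs x1] := kingmanP x; split.
- case=> [|i] /=; last exact: kseq_corner.
  by have [k1 k2] := set_mem (kmass_simplex x); split => //; rewrite k2.
- exact/set_mem/kmass_simplex.
- by case=> [|i]; [rewrite mul0r|apply: le_trans (kseq_l1_le x i.+1) _; rewrite ler1n].
- move=> N j /=; rewrite -lee_fin kmassE (@nneseries_split _ _ 0 N.+1); last first.
    by move=> k _; rewrite lee_fin.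
  rewrite add0n big_nat_recl// big_mkord sumEFin -addeA -[leLHS]add0e.
  apply: leeD; first by rewrite lee_fin.
  rewrite -[leLHS]adde0; apply: leeD => //.
  by apply: nneseries_ge0 => k _ _; rewrite lee_fin.
Qed.

End zseq.

Section resort.
Context {R : realType} {q : nat}.
Variable y : nat -> 'rV[R]_q.
Hypothesis y_small : forall i, i%:R * l1 (y i) <= 2.

Let P (l : seq nat) (i : nat) := i \notin l /\
  forall k : nat, k \notin l -> (shortlex (y k.+1) <= shortlex (y i.+1))%O.

(** Outside a finite set there is a largest term: if some term is not 0, only
    finitely many terms have at least its mass. *)
Lemma largest_exists l : exists i, P l i.
Proof.
have [[i0 i0l i0p]|none] := pselect (exists2 i : nat, i \notin l & 0 < l1 (y i.+1)).
  pose M := (maxn i0.+1 (Num.truncn (2 / l1 (y i0.+1))).+1).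
  have small k : (M <= k)%N -> l1 (y k.+1) < l1 (y i0.+1).
    rewrite geq_max => /andP[_ Mk].
    have := y_small k.+1; rewrite mulrC -ler_pdivlMr// => /le_lt_trans; apply.
    rewrite ltr_pdivrMr// mulrC -ltr_pdivrMr//.
    by apply: lt_le_trans (truncnS_gt _) _; rewrite ler_nat leqW.
  have i0M : (i0 < M)%N by rewrite leq_max ltnSn.
  case: (@arg_maxP _ _ _ (Ordinal i0M) (fun i : 'I_M => (i : nat) \notin l)
    (fun i : 'I_M => shortlex (y i.+1)) i0l) => i il imax.
  exists i; split => // k kl; have [kM|Mk] := ltnP k M.
    exact: (imax (Ordinal kM)).
  apply: le_trans (imax (Ordinal i0M) i0l).
  exact/l1_shortlex/small.
pose i := (\max_(k <- l) k).+1.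
have il : i \notin l.
  apply/negP => il; have : (i <= \max_(k <- l) k)%N by exact: leq_bigmax_seq.
  by rewrite ltnn.
exists i; split => // k kl.
have z (k' : nat) : k' \notin l -> y k'.+1 = 0.
  move=> k'l; apply: l1_eq0; apply/eqP; rewrite eq_le l1_ge0 andbT leNgt.
  by apply/negP => p; apply: none; exists k'.
by rewrite !z.
Qed.

(** Repeated extraction of a largest remaining term. *)
Let pick l := proj1_sig (cid (largest_exists l)).
Let seen n := iter n (fun l => pick l :: l) [::].
Let e n := pick (seen n).

Let eP n : P (seen n) (e n).
Proof. by rewrite /e /pick; case: cid. Qed.

Let seen_mono m n : (m <= n)%N -> {subset seen m <= seen n}.
Proof.
move=> /subnKC <-; elim: (n - m)%N => [|k IH] i im; first by rewrite addn0.
by rewrite addnS /= inE IH// orbT.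
Qed.

Let e_inj : injective e.
Proof.
suff H m n : (m < n)%N -> e m != e n.
  by move=> m n emn; case: (ltngtP m n) => // /H; rewrite emn eqxx.
move=> mn; apply/eqP => emn; have [/negP en _] := eP n; apply: en.
by rewrite -emn; apply: (seen_mono mn); rewrite /= inE eqxx.
Qed.

Let e_sorted n : (shortlex (y (e n.+1).+1) <= shortlex (y (e n).+1))%O.
Proof.
have [_] := eP n; apply; have [H _] := eP n.+1.
by apply: contra H => /(seen_mono (leqnSn n)).
Qed.

(** A nonzero term that is never extracted is below all the extracted terms, which
    are infinitely many; this contradicts the decay. *)
Let e_onto k : 0 < l1 (y k.+1) -> exists n, e n = k.
Proof.
move=> kp; apply: contrapT => none.
have kseen n : k \notin seen n.
  elim: n => //= n IH; rewrite inE negb_or IH andbT.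
  by apply/eqP => kn; apply: none; exists n.
pose M := (Num.truncn (2 / l1 (y k.+1))).+1.
have eM n : (e n < M)%N.
  have [_ /(_ _ (kseen n))/shortlex_l1 kn] := eP n.
  rewrite ltnNge; apply/negP => Me; have := y_small (e n).+1.
  apply/negP; rewrite -ltNge.
  apply: (@lt_le_trans _ _ ((e n).+1%:R * l1 (y k.+1))); last by rewrite ler_wpM2l.
  rewrite -ltr_pdivrMr//; apply: lt_le_trans (truncnS_gt _) _.
  by rewrite ler_nat leqW.
have : (size (map e (iota 0 M.+1)) <= size (iota 0 M))%N.
  apply: uniq_leq_size; first by rewrite map_inj_uniq ?iota_uniq.
  by move=> _ /mapP[n _ ->]; rewrite mem_iota add0n eM.
by rewrite size_map !size_iota ltnn.
Qed.

Let resort_series (g : nat -> \bar R) : (forall i, (0 <= g i)%E) ->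
  (forall i, l1 (y i.+1) = 0 -> g i = 0%E) ->
  (\sum_(0 <= n <oo) g (e n) = \sum_(0 <= i <oo) g i)%E.
Proof.
move=> g0 gz; rewrite !nneseries_esumT//.
rewrite -(@reindex_esum _ _ _ setT (range e) e); last first.
  by split=> [n _|m n _ _ /e_inj//|k [n _ <-]]; exists n.
rewrite esum_mkcond; apply: eq_esum => i _.
case: ifPn => // ie; apply/esym/gz/eqP; rewrite eq_le l1_ge0 andbT leNgt.
apply/negP => /e_onto[n ni]; move: ie; rewrite -ni notin_setE; apply.
by exists n.
Qed.

Hypothesis y_zspace : zspace y.

(** The dust receives what the atoms leave of the total mass at index 0. *)
Lemma resort : exists x : kingman_seq R q, kmass x = y 0%N /\
  forall h : 'rV[R]_q -> R, (forall u, 0 <= h u) -> atom_sum h (sval x) = atom_sum h y.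
Proof.
have [y1 [_ y2] _ y4] := y_zspace.
have yp i j : 0 <= y i 0 j by case/andP: ((y1 i).1 j).
pose a j : \bar R := (\sum_(0 <= i <oo) (y i.+1 0 j)%:E)%E.
have a0 j : (0 <= a j)%E by apply: nneseries_ge0 => *; rewrite lee_fin.
have ale j : (a j <= (y 0%N 0 j)%:E)%E.
  apply: lime_le; first by apply: is_cvg_nneseries => *; rewrite lee_fin.
  by apply: nearW => N; rewrite big_mkord sumEFin lee_fin.
have af j : a j \is a fin_num by rewrite ge0_fin_numE// (le_lt_trans (ale j))// ltry.
pose xs n := if n is n'.+1 then y (e n').+1 else \row_j (y 0%N 0 j - fine (a j)).
have xs0 i j : 0 <= xs i 0 j.
  by case: i => [|i] //=; rewrite mxE subr_ge0 -lee_fin fineK.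
have xsa j : (\sum_(0 <= i <oo) (xs i.+1 0 j)%:E = a j)%E.
  apply: (resort_series (g := fun i => (y i.+1 0 j)%:E)) => i; first by rewrite lee_fin.
  by move=> /l1_eq0 ->; rewrite mxE.
have xsj j : (\sum_(0 <= i <oo) (xs i 0 j)%:E = (y 0%N 0 j)%:E)%E.
  rewrite (nneseries_recl (P := xpredT))//; last by move=> k _; rewrite lee_fin.
  rewrite -(nneseries_addn 1); last by move=> k; rewrite lee_fin.
  rewrite (eq_eseriesr (g := fun i => (xs i.+1 0 j)%:E)); last by move=> i _; rewrite addn1.
  by rewrite xsa mxE -{2}(fineK (af j)) -EFinD subrK.
have xsK : kingman_set xs.
  split=> //; first by case=> // n _; exact: e_sorted.
  under eq_eseriesr => i _.
    rewrite /l1 -sumEFin; under eq_bigr => j _ do rewrite ger0_norm//.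
  over.
  rewrite nneseries_sum; last by move=> j i _; rewrite lee_fin.
  under eq_bigr do rewrite xsj.
  rewrite sumEFin -y2 /l1; congr EFin; apply: eq_bigr => j _.
  by rewrite ger0_norm.
exists (exist _ xs (mem_set xsK)); split.
  by apply/rowP => j; apply: EFin_inj; rewrite kmassE xsj.
move=> h h0; apply: (resort_series (g := fun i => (l1 (y i.+1) * h (y i.+1))%:E)) => i.
  by rewrite lee_fin mulr_ge0 ?l1_ge0.
by move=> ->; rewrite mul0r.
Qed.

End resort.

(** * Expectations of polynomials *)

Section polynomial_expectations.
Context {R : realType} {q : nat}.
Local Notation Sq := (cornerT R q).
Implicit Types (x : kingman_seq R q) (g h : 'rV[R]_q -> R) (a : mindex q).

Definition mean x g : R := \int[kmeasure x]_s g (val (s : borel Sq)).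

Lemma val_continuous g : continuous g -> continuous (fun s : Sq => g (val s)).
Proof.
move=> cg s; apply: (@cvg_comp _ _ _ (@set_val _ (corner R q)) g); last exact: cg.
exact: set_val_continuous.
Qed.

Lemma mean_integrable x g : continuous g ->
  (kmeasure x).-integrable setT (EFin \o (fun s : borel Sq => g (val s))).
Proof.
move=> cg; apply: bcfun_integrable; first exact: val_continuous.
have : bounded_set (g @` corner R q).
  apply: compact_bounded; apply: continuous_compact; last exact: corner_compact.
  exact: continuous_subspaceT.
move=> [M [Mr HM]]; exists M; split=> // N MN s _ /=; apply: HM => //.
by exists (val s) => //; exact: cornerP.
Qed.

Lemma eq_mean x g h : (forall u, corner R q u -> g u = h u) -> mean x g = mean x h.
Proof. by move=> gh; apply: eq_Rintegral => s _; apply: gh; exact: cornerP. Qed.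

Lemma meanD x g h : continuous g -> continuous h ->
  mean x (fun u => g u + h u) = mean x g + mean x h.
Proof. by move=> cg ch; rewrite /mean RintegralD//; exact: mean_integrable. Qed.

Lemma meanZ x c g : continuous g -> mean x (fun u => c * g u) = c * mean x g.
Proof. by move=> cg; rewrite /mean RintegralZl//; exact: mean_integrable. Qed.

(** On the corner, multiplication by the sum of the coordinates, divided by the
    norm, does nothing: each monomial is a sum of densities of power sums. *)
Lemma mean_mono x x' a : (forall b, powersum x b = powersum x' b) ->
  mean x (fun u => mono u a) = mean x' (fun u => mono u a).
Proof.
move=> xx'.
have [->|a0] := eqVneq a 0.
  have E y : mean y (fun u => mono u 0) = 1.
    rewrite (eq_mean _ (h := fun=> 1)); last first.
      by move=> u _; rewrite /mono big1// => j _; rewrite ffunE expr0.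
    by rewrite /mean Rintegral_cst// mul1r [X in fine X]kmeasureT.
  by rewrite !E.
pose b : nzindex q := exist _ a a0.
have b1 j : (1 < msum_idx (val (nz_incr b j)))%N.
  by rewrite /= msum_idxD msum_unit addn1 ltnS (msum_idx_gt0 b).
suff E y : mean y (fun u => mono u a) = \sum_(j < q) powersum y (nz_incr b j).
  by rewrite !E; apply: eq_bigr => j _.
have ip j : (kmeasure y).-integrable setT
    (EFin \o (power_density (nz_incr b j) : borel Sq -> R)).
  apply: bcfun_integrable; [exact: power_density_continuous|exact: power_density_bounded].
transitivity (\int[kmeasure y]_s \sum_(j < q) power_density (nz_incr b j) (s : borel Sq)).
  apply: eq_Rintegral => s _; rewrite /power_density -mulr_suml /=.
  have -> : \sum_(j < q) mono (val s) (a + unit_idx j) = mono (val s) a * l1 (val s).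
    rewrite /l1 mulr_sumr; apply: eq_bigr => j _.
    by rewrite mono_add mono_unit ger0_norm//; case/andP: ((cornerP s).1 j).
  have [l0|l0] := eqVneq (l1 (val s)) 0; last by rewrite mulfK.
  rewrite l0 mulr0 mul0r; apply/eqP; rewrite eq_le.
  rewrite mono_ge0 ?andbT => [|j]; last by case/andP: ((cornerP s).1 j).
  by rewrite -[leRHS]l0; exact: (mono_le_l1 b (cornerP s)).
rewrite /Rintegral.
under [in LHS]eq_integral do rewrite -sumEFin.
rewrite integral_sum//.
rewrite -sum_fine => [|j _]; last exact/integrable_fin_num/ip.
by apply: eq_bigr => j _; rewrite -powersum_expectation.
Qed.

(** Equality of the expectations against all monomials, in a form stable under
    multiplication by the coordinates. *)
Definition agree x x' g := continuous g /\
  forall a, mean x (fun u => g u * mono u a) = mean x' (fun u => g u * mono u a).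

Variables x x' : kingman_seq R q.
Hypothesis xx' : forall b, powersum x b = powersum x' b.

Lemma monoM_continuous g a : continuous g -> continuous (fun u => g u * mono u a).
Proof. by move=> cg u; exact: (cvgM (cg u) (@mono_continuous R q a u)). Qed.

Lemma agree_cst c : agree x x' (fun=> c).
Proof.
split=> [|a]; first exact: cst_continuous.
by rewrite !meanZ ?(mean_mono _ xx')//; exact: mono_continuous.
Qed.

Lemma agreeD g h : agree x x' g -> agree x x' h -> agree x x' (fun u => g u + h u).
Proof.
move=> [cg ag] [ch ah]; split=> [u|a]; first exact: (cvgD (cg u) (ch u)).
have E y : mean y (fun u => (g u + h u) * mono u a) =
    mean y (fun u => g u * mono u a) + mean y (fun u => h u * mono u a).
  rewrite -meanD; [|exact: monoM_continuous..].
  by apply: eq_mean => u _; rewrite mulrDl.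
by rewrite !E ag ah.
Qed.

Lemma agreeZ c g : agree x x' g -> agree x x' (fun u => c * g u).
Proof.
move=> [cg ag]; split=> [u|a]; first exact: (cvgMl_tmp (cg u)).
have E y : mean y (fun u => c * g u * mono u a) = c * mean y (fun u => g u * mono u a).
  rewrite -meanZ; last exact: monoM_continuous.
  by apply: eq_mean => u _; rewrite mulrA.
by rewrite !E ag.
Qed.

Lemma agree_coord j g : agree x x' g -> agree x x' (fun u => g u * u 0 j).
Proof.
move=> [cg ag]; split=> [u|a]; first exact: (cvgM (cg u) (@coord_cvg R q j u)).
have E y : mean y (fun u => g u * u 0 j * mono u a) =
    mean y (fun u => g u * mono u (unit_idx j + a)).
  by apply: eq_mean => u _; rewrite mono_add mono_unit mulrA.
by rewrite !E ag.
Qed.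

Lemma agree_sum (I : Type) (r : seq I) (g : I -> 'rV[R]_q -> R) :
  (forall i, agree x x' (g i)) -> agree x x' (fun u => \sum_(i <- r) g i u).
Proof.
move=> ag; elim: r => [|i r IH].
  rewrite (_ : (fun u => _) = fun=> 0); first exact: agree_cst.
  by apply/funext => u; rewrite big_nil.
rewrite (_ : (fun u => _) = fun u => g i u + \sum_(k <- r) g k u); first exact: agreeD.
by apply/funext => u; rewrite big_cons.
Qed.

(** Its values on the corner lie between 0 and 1, and 1 is only attained at [t]; the
    powers thus converge to the indicator function of [t]. *)
Definition peak (t u : 'rV[R]_q) : R :=
  1 - q%:R^-1 * \sum_(j < q) (u 0 j - t 0 j) ^+ 2.

Lemma agree_peak t n : agree x x' (fun u => peak t u ^+ n).
Proof.
elim: n => [|n IH].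
  by rewrite (_ : (fun u => _) = fun=> 1); [exact: agree_cst|apply/funext => u; rewrite expr0].
rewrite (_ : (fun u => _) = fun u => peak t u ^+ n + - q%:R^-1 *
    \sum_(j < q) ((peak t u ^+ n * u 0 j) * u 0 j + (- (t 0 j *+ 2) * (peak t u ^+ n * u 0 j) +
      t 0 j ^+ 2 * peak t u ^+ n))); last first.
  apply/funext => u; rewrite exprSr {2}/peak mulrBr mulr1 mulNr; congr (_ - _).
  rewrite mulrCA mulr_sumr; congr (_ * _); apply: eq_bigr => j _.
  rewrite sqrrB mulrDr mulrBr addrA; congr (_ + _ + _); last by rewrite mulrC.
    by rewrite expr2 mulrA.
  rewrite mulNr mulrnAr mulrnAl; congr (- (_ *+ _)).
  by rewrite mulrA mulrC.
apply: agreeD => //; apply: agreeZ; apply: agree_sum => j.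
apply: agreeD; first by do 2!apply: agree_coord.
by apply: agreeD; apply: agreeZ => //; exact: agree_coord.
Qed.

End polynomial_expectations.

(** * A point is determined by its power sums *)

Section injectivity.
Context {R : realType} {q : nat}.
Local Notation Sq := (cornerT R q).
Implicit Types (x : kingman_seq R q) (t : Sq).

Lemma peak_bounds (t u : 'rV[R]_q) : corner R q t -> corner R q u -> 0 <= peak t u <= 1.
Proof.
move=> [t01 _] [u01 _]; rewrite /peak subr_ge0 lerBlDr lerDl.
apply/andP; split; last first.
  by apply: mulr_ge0; [rewrite invr_ge0|apply: sumr_ge0 => j _; exact: sqr_ge0].
apply: (@le_trans _ _ (q%:R^-1 * q%:R)); last first.
  have [->|q0] := eqVneq q 0%N; first by rewrite mulr0.
  by rewrite mulVf// pnatr_eq0.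
rewrite ler_wpM2l ?invr_ge0// -[leRHS]mulr1 mulr_natl -[X in _ *+ X]card_ord -sumr_const.
apply: ler_sum => j _; rewrite -real_normK ?num_real// exprn_ile1// ler_norml.
have /andP[t0 t1] := t01 j; have /andP[u0 u1] := u01 j.
rewrite lerBrDr lerBlDr (le_trans u1) ?lerDl// andbT.
by rewrite addrC; apply: le_trans u0; rewrite subr_le0.
Qed.

Lemma peak_lt1 (t u : 'rV[R]_q) : u != t -> peak t u < 1.
Proof.
move=> ut; rewrite /peak ltrBlDr ltrDl.
have [j utj] : exists j, u 0 j != t 0 j.
  apply: contrapT => none; case/eqP: ut; apply/rowP => j; apply: contrapT => utj.
  by apply: none; exists j; apply/eqP.
have q0 : (0 < q)%N := leq_ltn_trans (leq0n j) (ltn_ord j).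
rewrite mulr_gt0 ?invr_gt0 ?ltr0n// (bigD1 j)//= ltr_pwDl//.
  by rewrite exprn_even_gt0//= subr_eq0.
by apply: sumr_ge0 => k _; exact: sqr_ge0.
Qed.

Lemma set1_measurable t : measurable ([set t] : set (borel Sq)).
Proof.
apply: closed_measurable_borel.
have -> : [set t] = @set_val _ (corner R q) @^-1` [set val t].
  by apply/seteqP; split=> [s ->//|s /val_inj].
apply: closed_comp; last exact: (accessible_closed_set1 (hausdorff_accessible (@norm_hausdorff R _))).
by move=> s _; exact: set_val_continuous.
Qed.

Lemma mean_peak_cvg x t :
  (mean x (fun u => peak (val t) u ^+ n))%:E @[n --> \oo] --> kmeasure x [set t].
Proof.
have cb n : continuous (fun u : 'rV[R]_q => peak (val t) u ^+ n).
  by have [] := @agree_peak _ _ x x (fun=> erefl) (val t) n.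
have -> : (fun n => (mean x (fun u => peak (val t) u ^+ n))%:E) =
    (fun n => \int[kmeasure x]_s (peak (val t) (val (s : borel Sq)) ^+ n)%:E)%E.
  apply/funext => n; rewrite /mean /Rintegral fineK//.
  exact: (integrable_fin_num measurableT (mean_integrable x (cb n))).
have <- : (\int[kmeasure x]_s (\1_[set t] (s : borel Sq))%:E = kmeasure x [set t])%E.
  by rewrite integral_indic ?setIT//; exact: set1_measurable.
apply: (@dominated_cvg _ _ _ (kmeasure x) setT measurableT _ _ (EFin \o (fun _ : borel Sq => 1 : R))).
- move=> n; apply/measurable_EFinP; apply: continuous_measurable_borel.
  exact: (val_continuous (cb n)).
- move=> s _; rewrite indicE; apply: cvg_EFin; first exact: nearW.
  have [->|st] := eqVneq s t.
    rewrite mem_set// (_ : _ \o _ = fun=> 1); first exact: cvg_cst.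
    apply/funext => n /=; rewrite /peak big1 ?mulr0 ?subr0 ?expr1n// => j _.
    by rewrite subrr expr0n.
  rewrite memNset; last by move=> /eqP; rewrite (negbTE st).
  apply: cvg_expr; rewrite ger0_norm; first by apply: peak_lt1; rewrite (inj_eq val_inj).
  by case/andP: (peak_bounds (cornerP t) (cornerP s)).
- by [].
- by apply: finite_measure_integrable_cst.
- move=> n s _ /=; rewrite lee_fin.
  have /andP[b0 b1] := peak_bounds (cornerP t) (cornerP s).
  by rewrite ger0_norm ?exprn_ge0// exprn_ile1.
Qed.

Definition atom_mass x (u : 'rV[R]_q) : \bar R :=
  (\sum_(0 <= i <oo) if sval x i.+1 == u then (l1 (sval x i.+1))%:E else 0)%E.

Lemma kmeasure_set1 x t : val t != 0 -> kmeasure x [set t] = atom_mass x (val t).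
Proof.
move=> t0; rewrite /kmeasure measure_addE.
rewrite [X in (X + _)%E](_ : _ = 0%E); last first.
  rewrite -[LHS]/((l1 (sval x 0%N))%:E * (\1_[set t] corner_zero)%:E)%E indicE memNset ?mule0// => t00.
  by move: t0; rewrite -[t]t00 eqxx.
rewrite add0e; pose w i : \bar R := mscale (kweight x i) (dirac (katom x i)) [set t].
have w0 i : (0 <= w i)%E by exact: measure_ge0.
rewrite -[LHS]/(\sum_(1 <= i <oo) w i)%E -(nneseries_addn 1 w0).
apply: eq_eseriesr => i _; rewrite addn1.
rewrite -[LHS]/((l1 (sval x i.+1))%:E * (\1_[set t] (katom x i.+1))%:E)%E indicE.
have [xt|xt] := eqVneq (sval x i.+1) (val t).
  by rewrite mem_set ?mule1//; exact: val_inj.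
by rewrite memNset ?mule0// => /(congr1 val)/eqP; rewrite (negbTE xt).
Qed.

Lemma shortlex_inj : injective (@shortlex R q).
Proof.
move=> u v [_ /eq_in_map uv]; apply/rowP => j.
by apply: uv; rewrite mem_enum.
Qed.

(** If the first difference between two sorted sequences is a larger term of the
    first one, then this term has a larger total mass there. *)
Lemma atom_mass_le x x' i :
  (forall k, (k < i)%N -> sval x k.+1 = sval x' k.+1) ->
  (forall u, corner R q u -> u != 0 -> (atom_mass x u <= atom_mass x' u)%E) ->
  (shortlex (sval x i.+1) <= shortlex (sval x' i.+1))%O.
Proof.
move=> xx' le_mass; rewrite leNgt; apply/negP => lt_xx'.
set u := sval x i.+1 in lt_xx'.
have [x0 _ _] := kingmanP x; have [x'0 x's _] := kingmanP x'.
have u0 : 0 < l1 u.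
  rewrite lt_neqAle l1_ge0 andbT eq_sym; apply/negP => /eqP/l1_eq0 u0.
  have := l1_ge0 (sval x' i.+1); rewrite le_eqVlt => /orP[/eqP/esym/l1_eq0 z|z].
    by move: lt_xx'; rewrite u0 z ltxx.
  have := l1_shortlex (u := u) (v := sval x' i.+1).
  rewrite {1}u0 /l1 big1 => [|j _]; last by rewrite mxE normr0.
  by move=> /(_ z); rewrite leNgt lt_xx'.
have un0 : u != 0.
  by apply/eqP => uz; move: u0; rewrite uz /l1 big1 ?ltxx// => j _; rewrite mxE normr0.
have := le_mass u (kseq_corner x i.+1) un0; rewrite leNgt => /negP; apply.
have m0 (y : kingman_seq R q) k :
    (0 <= if sval y k.+1 == u then (l1 (sval y k.+1))%:E else 0)%E.
  by case: ifP => // _; rewrite lee_fin l1_ge0.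
rewrite /atom_mass (@nneseries_split _ _ 0 i)//.
rewrite [ltRHS](@nneseries_split _ _ 0 i)//.
rewrite !add0n [X in (_ + X < _)%E]eseries0 ?adde0; last first.
  move=> k ik _; case: eqP => // e; move: lt_xx'; rewrite ltNge -e.
  suff -> : (shortlex (sval x' k.+1) <= shortlex (sval x' i.+1))%O by [].
  elim: k ik {e} => [|k IH]; first by rewrite leqn0 => /eqP->.
  rewrite leq_eqVlt => /orP[/eqP->//|]; rewrite ltnS => /IH.
  by apply: le_trans; exact: x's.
rewrite (eq_big_nat _ _ (F2 := fun k => if sval x k.+1 == u then (l1 (sval x k.+1))%:E else 0%E)); last first.
  by move=> k /andP[_ /xx' ->].
rewrite (@nneseries_split _ _ i 1)//.
rewrite addn1 big_nat1 eqxx; set S := (\sum_(_ <= _ < _) _)%E.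
have Sf : S \is a fin_num by apply/sum_fin_numP => k _ _; case: ifP.
rewrite lteDl//.
apply: (@lt_le_trans _ _ (l1 u)%:E); first by rewrite lte_fin.
by rewrite leeDl// nneseries_ge0.
Qed.

(** Same expectations of polynomials, hence same masses of the atoms, hence same
    sorted atoms; the mass of exponent 1 then yields the dust. *)
Lemma powersum_inj x x' : (forall b, powersum x b = powersum x' b) -> x = x'.
Proof.
move=> xx'.
have mass u : corner R q u -> u != 0 -> atom_mass x u = atom_mass x' u.
  move=> cu u0; pose t : Sq := exist _ u (mem_set cu).
  have peaks n : mean x' (fun u => peak (val t) u ^+ n) = mean x (fun u => peak (val t) u ^+ n).
    have [_ /(_ 0)] := agree_peak xx' (val t) n.
    have E y : mean y (fun v => peak (val t) v ^+ n * mono v 0) =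
        mean y (fun v => peak (val t) v ^+ n).
      by apply: eq_mean => v _; rewrite /mono big1 ?mulr1// => j _; rewrite ffunE expr0.
    by rewrite !E.
  have := @mean_peak_cvg x' t.
  under eq_cvg do rewrite peaks.
  move=> /(cvg_lim (@ereal_hausdorff R)) H'.
  have /(cvg_lim (@ereal_hausdorff R)) H := @mean_peak_cvg x t.
  by rewrite -[u]/(val t) -!kmeasure_set1//; exact: etrans (esym H) H'.
have atoms i : sval x i.+1 = sval x' i.+1.
  elim/ltn_ind: i => i IH; apply: shortlex_inj; apply: le_anti.
  apply/andP; split; apply: atom_mass_le => [k ki|u cu u0]; rewrite ?IH//.
    by rewrite mass.
  by rewrite mass.
apply: val_inj; apply/funext => -[|i]; last exact: atoms.
apply/rowP => j.
have := congr1 EFin (xx' (nz_unit j)); rewrite !powersum_unit !kmassE.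
have [x0 _ _] := kingmanP x; have [x'0 _ _] := kingmanP x'.
rewrite (nneseries_recl (P := xpredT))//; last by move=> k _; rewrite lee_fin.
rewrite [in RHS](nneseries_recl (P := xpredT))//; last by move=> k _; rewrite lee_fin.
rewrite -!(nneseries_addn 1); try by move=> k; rewrite lee_fin.
rewrite (eq_eseriesr (g := fun i => (sval x' (i + 1)%N 0 j)%:E)); last first.
  by move=> i _; rewrite addn1 atoms.
set S := (\sum_(0 <= i <oo) _)%E.
have Sf : S \is a fin_num.
  rewrite ge0_fin_numE; last by apply: nneseries_ge0 => k _ _; rewrite lee_fin.
  have : ((kmass x' 0 j)%:E < +oo)%E by rewrite ltry.
  rewrite kmassE (nneseries_recl (P := xpredT))//; last by move=> k _; rewrite lee_fin.
  rewrite -(nneseries_addn 1) => [|k]; last by rewrite lee_fin.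
  by apply: le_lt_trans; rewrite leeDr// lee_fin.
by rewrite -(fineK Sf) => -[/addIr].
Qed.

End injectivity.

(** * From the power sums back to the points *)

Lemma within_continuous (T U : topologicalType) (D : set T) (f : T -> U) (y : T) :
  continuous f -> f z @[z --> within D (nbhs y)] --> f y.
Proof.
move=> cf A fyA; have yA := cf y A fyA.
suff : \forall z \near nbhs y, D z -> A (f z) by [].
exact: (filterS (fun z (Az : A (f z)) (_ : D z) => Az) yA).
Qed.

Section recovery.
Context {R : realType} {q : nat}.
Local Notation Sq := (cornerT R q).
Implicit Types (x : kingman_seq R q) (y : {ptws nat -> 'rV[R]_q}) (b : nzindex q).

Lemma zsum_zseq x (h : 'rV[R]_q -> R) : zsum h (zseq x) = zsum h (sval x).
Proof. by []. Qed.

Lemma zsum_within h y : admissible h -> zspace y ->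
  zsum h z @[z --> within zspace (nbhs y)] --> zsum h y.
Proof.
move=> ha zy; apply: (@zsum_cvg R q h {ptws nat -> 'rV[R]_q} _ (fun z => z)) => //.
  exact: withinT.
move=> i; exact: (@within_continuous {ptws nat -> 'rV[R]_q} 'rV[R]_q zspace (fun z => z i) y
  (@ptws_eval_continuous R q i)).
Qed.

(** The power sums of the point obtained by sorting. *)
Definition zpower b (y : nat -> 'rV[R]_q) : R :=
  if msum_idx (val b) == 1%N then mono (y 0%N) (val b)
  else zsum (hext (power_density b)) y.

Lemma gt1_index b : msum_idx (val b) != 1%N -> (1 < msum_idx (val b))%N.
Proof. by move=> b1; rewrite ltn_neqAle eq_sym b1 msum_idx_gt0. Qed.

Lemma power_density_admissible b : msum_idx (val b) != 1%N ->
  admissible (hext (power_density b : Sq -> R)).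
Proof.
move=> /gt1_index b1; apply: admissible_hext.
- exact: power_density_continuous.
- by move=> t; exact: power_density_ge0.
- exact: power_density_zero.
Qed.

Lemma zpower_zseq x b : zpower b (zseq x) = powersum x b.
Proof.
rewrite /zpower; case: ifPn => [|b1].
  by rewrite msum_idx_eq1 => /existsP[j /eqP->]; rewrite powersum_unit mono_unit.
rewrite -powersum_expectation ?gt1_index// /Rintegral kmeasure_atom_sum//.
- exact/power_density_continuous/gt1_index.
- by move=> t; exact: power_density_ge0.
- exact: power_density_zero.
Qed.

Lemma zpower_within b y : zspace y ->
  zpower b z @[z --> within zspace (nbhs y)] --> zpower b y.
Proof.
move=> zy; rewrite /zpower; case: ifPn => [_|b1].
  apply: (@within_continuous {ptws nat -> 'rV[R]_q} R zspace (fun z => mono (z 0%N) (val b))).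
  move=> z; apply: (@continuous_comp _ _ _ (fun z : {ptws nat -> 'rV[R]_q} => z 0%N)
    (fun u : 'rV[R]_q => mono u (val b))).
    exact: ptws_eval_continuous.
  exact: mono_continuous.
exact/zsum_within/zy/power_density_admissible.
Qed.

(** By compactness a property that holds near all sequences with power sums [g]
    holds eventually: near any other sequence some power sum stays away from its
    limit. *)
Lemma zspace_near (I : Type) (F : set_system I) (u : I -> kingman_seq R q)
    (g : nzindex q -> R) (Q : {ptws nat -> 'rV[R]_q} -> Prop) :
  Filter F -> (forall b, powersum (u t) b @[t --> F] --> g b) ->
  (forall y, zspace y -> (forall b, zpower b y = g b) ->
     \forall z \near within zspace (nbhs y), Q z) ->
  \forall t \near F, Q (zseq (u t)).
Proof.
move=> FF ug hQ.
have /compact_near_coveringP/near_covering_withinP := @zspace_compact R q.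
move=> /(_ I F (fun t y => y = zseq (u t) -> Q y) FF) cover.
suff : \forall t \near F, zspace `<=` (fun y => y = zseq (u t) -> Q y).
  by apply: filterS => t; apply; [exact: zseq_zspace|].
apply: cover => y zy.
have [yg|] := pselect (forall b, zpower b y = g b).
  have := hQ _ zy yg; rewrite near_withinE => nQ.
  exists (fun z => zspace z -> Q z, setT).
    by split => //; exact: filterT.
  by move=> [z t] [/= Qz _] zz _; exact: Qz.
move=> /existsNP[b /eqP ybg].
pose e := `|zpower b y - g b| / 2.
have e0 : 0 < e by rewrite divr_gt0// normr_gt0 subr_eq0.
have /cvgrPdist_lt/(_ _ e0) := @zpower_within b y zy.
rewrite near_withinE => ny.
have /cvgrPdist_lt/(_ _ e0) nF := ug b.
exists (fun z => zspace z -> `|zpower b y - zpower b z| < e,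
        (fun t => `|g b - powersum (u t) b| < e) : set I); first by split.
move=> [z t] [/= yz gt] /yz zyz zE; exfalso.
move: zyz; rewrite zE zpower_zseq => zyz.
have := ltrD zyz gt; rewrite /e -splitr ltNge => /negP; apply.
by rewrite [X in _ <= _ + X]distrC; apply: le_trans (ler_normD _ _); rewrite subrKA.
Qed.

Lemma resort_zpower y : zspace y -> exists x, (forall b, powersum x b = zpower b y) /\
  forall h, (forall v, 0 <= h v) -> zsum h (zseq x) = zsum h y.
Proof.
move=> zy; have [_ _ ysmall _] := zy.
have [x [xm xs]] := resort ysmall zy; exists x.
have H h : (forall v, 0 <= h v) -> zsum h (zseq x) = zsum h y.
  by move=> h0; rewrite zsum_zseq /zsum xs.
split=> // b; rewrite -zpower_zseq /zpower; case: ifPn => [_|b1].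
  by rewrite /zseq xm.
by have [h0 _ _] := power_density_admissible b1; exact: H.
Qed.

Lemma powersum_realized (I : Type) (F : set_system I) (u : I -> kingman_seq R q)
    (g : nzindex q -> R) : ProperFilter F ->
  (forall b, powersum (u t) b @[t --> F] --> g b) ->
  exists x, forall b, powersum x b = g b.
Proof.
move=> FF ug; apply: contrapT => none.
have FF' : Filter F by exact: filter_filter.
apply: (@filter_not_empty _ F FF).
apply: (zspace_near (Q := fun=> False) _ ug) => y zy yg; exfalso; apply: none.
by have [x [xp _]] := resort_zpower zy; exists x => b; rewrite xp.
Qed.

(** All the sequences with the power sums of [x] sort to [x], so they share the
    value of the limit. *)
Lemma powersum_cvg_zsum (I : Type) (F : set_system I) (u : I -> kingman_seq R q) x h :
  Filter F -> admissible h -> (forall b, powersum (u t) b @[t --> F] --> powersum x b) ->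
  zsum h (zseq (u t)) @[t --> F] --> zsum h (zseq x).
Proof.
move=> FF ha ux; apply/cvgrPdist_lt => e e0.
apply: (zspace_near (Q := fun z => `|zsum h (zseq x) - zsum h z| < e) _ ux) => y zy yx.
have [x' [x'p x's]] := resort_zpower zy.
have -> : x = x' by apply: powersum_inj => b; rewrite x'p yx.
have [h0 _ _] := ha; rewrite x's//.
by have /cvgrPdist_lt := zsum_within ha zy; apply.
Qed.

Lemma powersum_cvg_kingman (I : Type) (F : set_system I) (u : I -> kingman R q)
    (x : kingman R q) : Filter F ->
  (forall b, powersum (u t) b @[t --> F] --> powersum x b) -> u t @[t --> F] --> x.
Proof.
move=> FF ux; apply/cvg_kingman; split.
  move=> j; rewrite -powersum_unit; under eq_cvg do rewrite -powersum_unit.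
  exact: ux.
move=> [f [cf bf]] /=; rewrite (expectation_split x cf bf).
under eq_cvg do rewrite (expectation_split _ cf bf).
have H (g : Sq -> R) : continuous g -> (forall t, 0 <= g t) -> g corner_zero = 0 ->
    \int[kmeasure (u t)]_s (g s : R) @[t --> F] --> \int[kmeasure x]_s (g s : R).
  move=> cg g0 gz.
  have E (z : kingman_seq R q) : \int[kmeasure z]_s (g s : R) = zsum (hext g) (zseq z).
    by rewrite /Rintegral kmeasure_atom_sum.
  rewrite E; under eq_cvg do rewrite E.
  exact: (powersum_cvg_zsum FF (admissible_hext cg g0 gz) ux).
have cst_cont (r : R) : continuous (fun _ : Sq => r) by exact: cst_continuous.
apply: cvgD; first exact: cvg_cst.
apply: cvgB.
  apply: (H (fun t => Num.max (f t - f corner_zero) 0)).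
  - by apply: corner_max_continuous => // t; exact: (cvgB (cf t) (cst_cont _ t)).
  - by move=> t; rewrite le_max lexx orbT.
  - by rewrite subrr maxxx.
apply: (H (fun t => Num.max (f corner_zero - f t) 0)).
- by apply: corner_max_continuous => // t; exact: (cvgB (cst_cont _ t) (cf t)).
- by move=> t; rewrite le_max lexx orbT.
- by rewrite subrr maxxx.
Qed.

End recovery.

(** * Approximation by partitions *)

Section power_sums_of_partitions.
Context {R : realType} {q : nat}.
Hypothesis hq : (0 < q)%N.
Implicit Types (A : cpart q) (a : mindex q) (b : nzindex q).

Definition scaled a (N : nat) : 'rV[R]_q := \row_j ((a j)%:R / N%:R).

Lemma scaled_ge0 a N j : 0 <= scaled a N 0 j.
Proof. by rewrite mxE divr_ge0. Qed.

Lemma l1_scaled a N : l1 (scaled a N) = (msum_idx a)%:R / N%:R.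
Proof.
rewrite /l1 /msum_idx natr_sum mulr_suml; apply: eq_bigr => j _.
by rewrite ger0_norm ?scaled_ge0// mxE.
Qed.

Lemma mono_scaled0 N b : mono (scaled 0 N) (val b) = 0.
Proof.
have := msum_idx_gt0 b; rewrite lt0n sum_nat_eq0 negb_forall => /existsP[j].
rewrite -lt0n => bj; rewrite /mono (bigD1 j)//= mxE ffunE mul0r.
by case: (val b j) bj => // k _; rewrite expr0n/= mul0r.
Qed.

Lemma powersum_embed A b : (0 < psize A)%N ->
  powersum (embed R hq A : kingman_seq R q) b =
  \sum_(c <- enum_mset A) mono (scaled (val c) (psize A)) (val b).
Proof.
move=> A0; apply: EFin_inj; rewrite -powersumE -[sval _]/(kseq (embed R hq A)) kseq_embed//.
pose F a := mono (scaled a (psize A)) (val b).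
transitivity (\sum_(0 <= i <oo) (F (part A i))%:E)%E.
  apply: eq_eseriesr => i _; congr EFin; rewrite pweight_part_seq//.
  congr mono; apply/rowP => j; rewrite mxE; case: i => [|i] /=; rewrite mxE//.
  by rewrite ffunE mul0r.
rewrite part_series//; [|by move=> a; apply: mono_ge0 => j; exact: scaled_ge0|exact: mono_scaled0].
by rewrite (perm_big _ (parts_perm A)) big_map.
Qed.

(** Zero multi-indices are dropped, so that rounded sequences can be used as they
    are. *)
Definition cpart_of (L : seq (mindex q)) : cpart q := seq_mset (pmap insub L).

Lemma sum_cpart_of (V : nmodType) (L : seq (mindex q)) (F : mindex q -> V) : F 0 = 0 ->
  \sum_(c <- enum_mset (cpart_of L)) F (val c) = \sum_(a <- L) F a.
Proof.
move=> F0; rewrite (perm_big _ (perm_eq_seq_mset _)).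
elim: L => [|a L IH]; first by rewrite !big_nil.
rewrite big_cons -IH /=; case: insubP => [c _ <-|] /=; first by rewrite big_cons.
by rewrite negbK => /eqP->; rewrite F0 add0r.
Qed.

Lemma psize_cpart_of L : psize (cpart_of L) = (\sum_(a <- L) msum_idx a)%N.
Proof.
rewrite psizeE; apply: (@sum_cpart_of nat L (@msum_idx q)).
by rewrite /msum_idx big1// => j _; rewrite ffunE.
Qed.

End power_sums_of_partitions.

Section approximation.
Context {R : realType} {q : nat}.
Hypothesis hq : (0 < q)%N.
Variable x : kingman_seq R q.
Implicit Types (k i : nat) (j : 'I_q) (b : nzindex q).

(** The mass and the terms are rounded down; the singletons [D k j] restore the
    number of elements of each color. *)
Let T k : mindex q := [ffun j => Num.truncn (k%:R * kmass x 0 j)].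
Let a k i : mindex q := [ffun j => Num.truncn (k%:R * sval x i 0 j)].
Let D k : mindex q := [ffun j => (T k j - \sum_(i < k) a k i.+1 j)%N].
Let L k : seq (mindex q) := [seq a k i.+1 | i : 'I_k] ++
  flatten [seq nseq (D k j) (unit_idx j) | j : 'I_q].
Let A k := cpart_of (L k).
Let N k := msum_idx (T k).

Let kx_ge0 k i j : 0 <= k%:R * sval x i 0 j.
Proof. by rewrite mulr_ge0// kseq_ge0. Qed.

Let kmass_ge0 j : 0 <= kmass x 0 j.
Proof. by have [+ _] := set_mem (kmass_simplex x); move=> /(_ j)/andP[]. Qed.

Let a_le k j n : (n <= k)%N -> (\sum_(i < n) a k i.+1 j <= T k j)%N.
Proof.
move=> nk; rewrite [T k j]ffunE truncn_ge_nat; last by rewrite mulr_ge0.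
rewrite natr_sum; apply: (@le_trans _ _ (\sum_(i < n) k%:R * sval x i.+1 0 j)).
  by apply: ler_sum => i _; rewrite ffunE truncn_le kx_ge0.
by rewrite -mulr_sumr ler_wpM2l//; have [_ _ _] := zseq_zspace x; apply.
Qed.

Let sum_L (V : nmodType) k (F : mindex q -> V) :
  \sum_(c <- L k) F c = \sum_(i < k) F (a k i.+1) + \sum_(j < q) F (unit_idx j) *+ D k j.
Proof.
rewrite big_cat/= big_map big_enum; congr (_ + _).
rewrite big_flatten/= big_map big_enum; apply: eq_bigr => j _.
by rewrite big_nseq iter_addr addr0.
Qed.

Let psizeA k : psize (A k) = N k.
Proof.
rewrite psize_cpart_of (sum_L (V := nat)).
have -> : \sum_(j < q) msum_idx (unit_idx j) *+ D k j = (\sum_(j < q) D k j)%N.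
  by apply: eq_bigr => j _; rewrite msum_unit -[LHS]/(1%N *+ _) -[RHS]natn.
rewrite /msum_idx exchange_big/= -[LHS]big_split/=.
by apply: eq_bigr => j _; rewrite [D k j]ffunE -[LHS]/(_ + _)%N subnKC// a_le.
Qed.

Let trunc_ratio (c : R) : 0 <= c -> (Num.truncn (k%:R * c))%:R / k%:R @[k --> \oo] --> c.
Proof.
move=> c0; apply: (@squeeze_cvgr _ _ _ _ (fun k : nat => c - k%:R^-1) (cst c)).
- near=> k; have k0 : 0 < k%:R :> R by rewrite ltr0n; near: k; exact: nbhs_infty_gt.
  rewrite ler_pdivlMr// ler_pdivrMr// mulrBl mulVf ?gt_eqF//.
  rewrite [c * _]mulrC truncn_le mulr_ge0 ?(ltW k0)// andbT lerBlDr.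
  by rewrite natr1 ltW// truncnS_gt.
- rewrite -[X in _ --> X]subr0; apply: cvgB; [exact: cvg_cst|exact: inv_nat_cvg].
- exact: cvg_cst.
Unshelve. all: by end_near. Qed.

Let N_ratio : (N k)%:R / k%:R @[k --> \oo] --> (1 : R).
Proof.
have [_ m1] := set_mem (kmass_simplex x).
rewrite -[X in _ --> X]m1 /l1.
have -> : (fun k => (N k)%:R / k%:R) = (fun k => \sum_(j < q) (T k j)%:R / k%:R) :> (nat -> R).
  by apply/funext => k; rewrite /N /msum_idx natr_sum mulr_suml.
apply: cvg_big => [|j _]; first exact: add_continuous.
rewrite ger0_norm//; have := trunc_ratio (kmass_ge0 j).
by apply: cvg_trans; apply: near_eq_cvg; apply: nearW => k; rewrite ffunE.
Qed.

Let N_large : \forall k \near \oo, (0 < k)%N /\ (k <= 2 * N k)%N.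
Proof.
near=> k.
have k0 : (0 < k)%N by near: k; exact: nbhs_infty_gt.
have : 2^-1 < (N k)%:R / k%:R :> R.
  near: k; apply: (cvgr_gt (1 : R)); first exact: N_ratio.
  by rewrite invf_lt1 ?ltr1n.
rewrite ltr_pdivlMr ?ltr0n// mulrC ltr_pdivrMr// -natrM ltr_nat mulnC => /ltnW kN.
by split.
Unshelve. all: by end_near. Qed.

Let N_gt0 k : (0 < k)%N -> (k <= 2 * N k)%N -> (0 < N k)%N.
Proof. by move=> k0 kN; rewrite lt0n; apply: contraTneq kN => ->; rewrite muln0 -ltnNge. Qed.

Let trunc_cvg (c : R) : 0 <= c -> (Num.truncn (k%:R * c))%:R / (N k)%:R @[k --> \oo] --> c.
Proof.
move=> c0.
have H : (Num.truncn (k%:R * c))%:R / k%:R * ((N k)%:R / k%:R)^-1 @[k --> \oo] --> c.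
  rewrite -[X in _ --> X]mulr1 -[X in c * X]invr1.
  by apply: cvgM; [exact: trunc_ratio|apply: cvgV; [exact: oner_neq0|exact: N_ratio]].
apply: cvg_trans H; apply: near_eq_cvg; near=> k.
have k0 : k%:R != 0 :> R by rewrite pnatr_eq0 -lt0n; near: k; exact: nbhs_infty_gt.
by rewrite /= invf_div mulrA divfK.
Unshelve. all: by end_near. Qed.

(** The rounded sequence, without the singletons. *)
Let y k : nat -> 'rV[R]_q := fun i =>
  if i is i'.+1 then if (i' < k)%N then scaled (a k i) (N k) else 0 else scaled (T k) (N k).

Let y_zspace k : (0 < k)%N -> (k <= 2 * N k)%N -> zspace (y k).
Proof.
move=> k0 kN; have N0 : 0 < (N k)%:R :> R by rewrite ltr0n N_gt0.
have corner_l1 (u : 'rV[R]_q) : (forall j, 0 <= u 0 j) -> l1 u <= 1 -> corner R q u.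
  move=> u0 u1; split=> // j; rewrite u0/=.
  exact: le_trans (ler_norm _) (le_trans (coord_le_l1 u j) u1).
have T1 : l1 (scaled (T k) (N k)) = 1 :> R by rewrite l1_scaled divff// gt_eqF.
have cT : corner R q (scaled (T k) (N k)).
  by apply: corner_l1; [move=> j; exact: scaled_ge0|rewrite T1].
have y0 i j : 0 <= y k i 0 j.
  case: i => [|i]; first exact: scaled_ge0.
  by rewrite /y; case: ifP => _; [exact: scaled_ge0|rewrite mxE].
have l10 : l1 (0 : 'rV[R]_q) = 0 by rewrite /l1 big1// => j _; rewrite mxE normr0.
have ySum n j : \sum_(i < n) y k i.+1 0 j = (\sum_(i < minn n k) a k i.+1 j)%:R / (N k)%:R.
  elim: n => [|n IH]; first by rewrite min0n !big_ord0 mul0r.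
  rewrite big_ord_recr/= IH; case: ltnP => [nk|kn].
    rewrite (minn_idPl nk) big_ord_recr/= natrD mulrDl.
    by rewrite [scaled _ _ _ _]mxE.
  by rewrite (minn_idPr (leqW kn)) mxE addr0.
have ySum_le n j : \sum_(i < n) y k i.+1 0 j <= y k 0%N 0 j.
  rewrite ySum [leRHS]mxE ler_wpM2r ?invr_ge0 ?(ltW N0)// ler_nat.
  by apply: a_le; exact: geq_minr.
split=> //.
- case=> [|i]; first exact: cT.
  apply: corner_l1 => //; rewrite -T1 /l1; apply: ler_sum => j _.
  rewrite !ger0_norm ?scaled_ge0//; apply: le_trans (ySum_le i.+1 j).
  by rewrite big_ord_recr /= lerDr; apply: sumr_ge0 => m _; exact: (y0 m.+1 j).
- by split=> [j|//]; exact: (cT.1 j).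
- case=> [|i]; first by rewrite mul0r.
  rewrite /y; case: ifP => _; last by rewrite l10 mulr0.
  rewrite l1_scaled mulrA ler_pdivrMr//.
  apply: (@le_trans _ _ (i.+1%:R * (k%:R * l1 (sval x i.+1)))).
    rewrite ler_wpM2l// /msum_idx natr_sum /l1 mulr_sumr; apply: ler_sum => j _.
    by rewrite ffunE ger0_norm ?kseq_ge0// truncn_le.
  rewrite mulrCA; apply: (@le_trans _ _ k%:R); last by rewrite -natrM ler_nat.
  by rewrite ler_piMr// kseq_l1_le.
Qed.

Let y_cvg i : y k i @[k --> \oo] --> zseq x i.
Proof.
apply/cvg_rV => j; case: i => [|i] /=.
  have := trunc_cvg (kmass_ge0 j); apply: cvg_trans; apply: near_eq_cvg.
  by apply: nearW => k; rewrite /y [scaled _ _ _ _]mxE ffunE.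
have := trunc_cvg (kseq_ge0 x i.+1 j); apply: cvg_trans; apply: near_eq_cvg.
near=> k; have -> : (i < k)%N by near: k; exact: nbhs_infty_gt.
by rewrite [scaled _ _ _ _]mxE ffunE.
Unshelve. all: by end_near. Qed.

(** The singletons are at most [N k], each of weight at most the inverse square of
    [N k] for exponents of degree 2 or more. *)
Let y_powersum k b : (0 < k)%N -> (k <= 2 * N k)%N ->
  zpower b (y k) <= powersum (embed R hq (A k) : kingman_seq R q) b <=
  zpower b (y k) + (N k)%:R^-1.
Proof.
move=> k0 kN; have [yc _ _ _] := y_zspace k0 kN.
have N0 : 0 < (N k)%:R :> R by rewrite ltr0n N_gt0.
pose F c : R := mono (scaled c (N k)) (val b).
rewrite powersum_embed psizeA ?N_gt0// (@sum_cpart_of _ _ (L k) F (mono_scaled0 _ b)) sum_L.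
have F0 c : 0 <= F c by apply: mono_ge0 => j; exact: scaled_ge0.
rewrite /zpower; case: ifPn => [|b1].
  rewrite msum_idx_eq1 => /existsP[j /eqP bj].
  have FE c : F c = (c j)%:R / (N k)%:R by rewrite /F bj mono_unit mxE.
  rewrite -/(F _) !FE.
  have -> : \sum_(i < k) F (a k i.+1) + \sum_(j0 < q) F (unit_idx j0) *+ D k j0 =
      (T k j)%:R / (N k)%:R.
    rewrite (eq_bigr (fun i : 'I_k => (a k i.+1 j)%:R / (N k)%:R)) => [|i _]; last exact: FE.
    rewrite (bigD1 j)//= [X in _ + (_ + X)]big1 => [|i ij]; last first.
      by rewrite FE ffunE eq_sym (negbTE ij) mul0r mul0rn.
    rewrite FE ffunE eqxx addr0 -mulr_suml -natr_sum -mulrnAl -mulrDl -[_ *+ D k j]/((D k j)%:R) -natrD.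
    by rewrite [D k j]ffunE subnKC// a_le.
  by rewrite lexx lerDl invr_ge0 ltW.
have -> : zsum (hext (power_density b)) (y k) = \sum_(i < k) F (a k i.+1).
  rewrite /zsum /atom_sum (@nneseries_split _ _ 0 k) => [|i _]; last first.
    rewrite lee_fin mulr_ge0 ?l1_ge0//.
    by have [+ _ _] := power_density_admissible (R := R) b1; apply.
  rewrite eseries0 ?adde0 => [|i ki _]; last first.
    by rewrite /y ltnNge ki /= /l1 big1 ?mul0r// => j _; rewrite mxE normr0.
  rewrite add0n big_mkord sumEFin /=; apply: eq_bigr => i _.
  by rewrite (@l1_power_density _ _ b _ (yc i.+1)) /y ltn_ord.
have u1 j : F (unit_idx j) <= (N k)%:R^-1 * (N k)%:R^-1.
  have -> : (N k)%:R^-1 = l1 (scaled (unit_idx j) (N k)) :> R by rewrite l1_scaled msum_unit div1r.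
  apply: mono_le_l1_sqr; last exact: gt1_index.
  have l1u : l1 (scaled (unit_idx j) (N k)) <= 1 :> R.
    by rewrite l1_scaled msum_unit ler_pdivrMr// mul1r ler_nat N_gt0.
  split=> // i; rewrite scaled_ge0/=.
  exact: le_trans (ler_norm _) (le_trans (coord_le_l1 _ i) l1u).
rewrite lerDl sumr_ge0/= => [|j _]; last by rewrite mulrn_wge0.
rewrite lerD2l; apply: (@le_trans _ _ (\sum_(j < q) ((N k)%:R^-1 * (N k)%:R^-1) * (T k j)%:R)).
  apply: ler_sum => j _; rewrite -[F _ *+ _]mulr_natr ler_pM// ler_nat ffunE.
  exact: leq_subr.
by rewrite -mulr_sumr -natr_sum -/(msum_idx _) -/(N k) divfK// gt_eqF.
Qed.

Lemma dense_embed : exists2 B : nat -> cpart q, to_infinity B &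
  embed R hq (B k) @[k --> \oo] --> (x : kingman R q).
Proof.
have Ninf : N k @[k --> \oo] --> \oo.
  apply/cvgnyPge => M; near=> k.
  have [_] : (0 < k)%N /\ (k <= 2 * N k)%N by near: k; exact: N_large.
  have : (2 * M <= k)%N by near: k; exact: nbhs_infty_ge.
  by move=> Mk kN; have := leq_trans Mk kN; rewrite leq_pmul2l.
exists A; first by apply/to_infinity_psize; under eq_cvg do rewrite psizeA.
apply: powersum_cvg_kingman => b.
have yb : zpower b (y k) @[k --> \oo] --> powersum x b.
  rewrite -zpower_zseq /zpower; case: ifPn => [_|b1].
    by apply: (@cvg_comp _ _ _ (fun k => y k 0%N) (fun u : 'rV[R]_q => mono u (val b)));
      [exact: y_cvg|exact: mono_continuous].
  apply: (@zsum_cvg R q _ nat _ y) => //; first exact: power_density_admissible.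
  - by apply: filterS N_large => k []; exact: y_zspace.
  - exact: zseq_zspace.
apply: (@squeeze_cvgr _ _ _ _ (fun k => zpower b (y k)) (fun k => zpower b (y k) + (N k)%:R^-1)).
- by apply: filterS N_large => k []; exact: y_powersum.
- exact: yb.
- rewrite -[X in _ --> X]addr0; apply: cvgD => //.
  exact: (cvg_comp _ _ Ninf (inv_nat_cvg (R := R))).
Unshelve. all: by end_near. Qed.

End approximation.

(** * The Martin boundary *)

Section martin_boundary.
Context {R : realType} {q : nat}.
Hypothesis hq : (0 < q)%N.
Context {theta : R}.
Hypothesis theta_gt0 : 0 < theta.
Variable nu : probability (borel 'rV[R]_q) R.
Hypothesis nu_simplex : nu (simplex R q) = 1%E.
Hypothesis nu_relint : (0 < nu (simplex_relint R q))%E.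
Context {d : measure_display} {Omega : measurableType d}.
Variables (P : cpart q -> probability Omega R) (X : nat -> Omega -> cpart q).
Hypothesis hX : is_hoppe_chain theta nu P X.
Implicit Types (x : kingman R q) (b : nzindex q) (A : nat -> cpart q).

Local Notation K := (martin_kernel P X).
Local Notation Kx := (extended_kernel theta nu).
Local Notation wc B := (weight_const nu (theta := theta) (enum_mset B)).

Lemma wc_gt0 B : 0 < wc B.
Proof. exact: weight_const_gt0. Qed.

Lemma extended_kernel_mset1 b x :
  Kx [mset b]%mset x = wc [mset b]%mset * powersum (x : kingman_seq R q) b.
Proof.
rewrite -(psi_const_esf theta_gt0 nu_simplex nu_relint) /extended_kernel.
by rewrite -[kseq x]/(sval (x : kingman_seq R q)) psi_mset1 mulrAC.
Qed.

Lemma extended_kernel_inj x x' : (forall B, Kx B x = Kx B x') -> x = x'.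
Proof.
move=> xx'; apply: (@powersum_inj R q x x') => b.
have := xx' [mset b]%mset; rewrite !extended_kernel_mset1.
by apply: mulfI; rewrite gt_eqF// wc_gt0.
Qed.

Lemma extended_kernel_cvg (I : Type) (F : set_system I) (u : I -> kingman R q) x :
  Filter F -> u t @[t --> F] --> x -> forall B, Kx B (u t) @[t --> F] --> Kx B x.
Proof.
move=> FF ux B; rewrite (extended_kernel_power_poly theta_gt0 nu_simplex nu_relint).
under eq_cvg do rewrite (extended_kernel_power_poly theta_gt0 nu_simplex nu_relint).
by apply: cvgMl_tmp; apply: cvg_power_poly; exact: cvg_powersum.
Qed.

Lemma kernel_cvg A x : to_infinity A -> embed R hq (A k) @[k --> \oo] --> x ->
  forall B, K B (A k) @[k --> \oo] --> Kx B x.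
Proof.
move=> Ainf Ax B.
have H : K B (A k) - Kx B (embed R hq (A k)) + Kx B (embed R hq (A k)) @[k --> \oo] --> Kx B x.
  rewrite -[X in _ --> X]add0r; apply: cvgD; last exact: extended_kernel_cvg.
  exact: (kernel_asymp theta_gt0 nu_simplex nu_relint hX hq).
by apply: cvg_trans H; apply: near_eq_cvg; apply: nearW => k /=; rewrite subrK.
Qed.

Lemma kernel_lim A x : to_infinity A -> embed R hq (A k) @[k --> \oo] --> x ->
  forall B, lim (K B (A k) @[k --> \oo]) = Kx B x.
Proof. by move=> Ainf Ax B; apply: cvg_lim => //; exact: kernel_cvg. Qed.

(** The Martin kernels converge, hence so do the extended kernels, and among them
    the power sums. *)
Lemma convergent_embed A : martin_convergent K A ->
  exists x, embed R hq (A k) @[k --> \oo] --> x.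
Proof.
move=> [Ainf Acvg].
pose g b := (wc [mset b]%mset)^-1 * lim (K [mset b]%mset (A k) @[k --> \oo]).
have pg b : powersum (embed R hq (A k) : kingman_seq R q) b @[k --> \oo] --> g b.
  have H : K [mset b]%mset (A k) - (K [mset b]%mset (A k) - Kx [mset b]%mset (embed R hq (A k)))
      @[k --> \oo] --> lim (K [mset b]%mset (A k) @[k --> \oo]).
    rewrite -[X in _ --> X]subr0; apply: cvgB; first exact: Acvg.
    exact: (kernel_asymp theta_gt0 nu_simplex nu_relint hX hq).
  have H' : (wc [mset b]%mset)^-1 * (K [mset b]%mset (A k) -
      (K [mset b]%mset (A k) - Kx [mset b]%mset (embed R hq (A k)))) @[k --> \oo] --> g b.
    exact: (cvgMl_tmp H).
  apply: cvg_trans H'; apply: near_eq_cvg; apply: nearW => k.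
  by rewrite opprB addrCA subrr addr0 extended_kernel_mset1 mulKf// gt_eqF// wc_gt0.
have [x xg] := powersum_realized (u := fun k => embed R hq (A k)) _ pg.
exists x; apply: powersum_cvg_kingman => b; rewrite xg; exact: pg.
Qed.

Lemma extended_kernel_boundary x : martin_boundary K (Kx^~ x).
Proof.
have [A Ainf Ax] := dense_embed hq x; exists A.
  by split=> // B; apply/cvg_ex; exists (Kx B x); exact: kernel_cvg.
by move=> B; rewrite (kernel_lim Ainf Ax).
Qed.

Definition boundary_map x : set_type (martin_boundary K) :=
  exist _ (Kx^~ x) (mem_set (extended_kernel_boundary x)).

Lemma boundary_map_homeomorphism : homeomorphism boundary_map.
Proof.
split.
  move=> x; apply: (@initial_cvg _ _ (@set_val _ (martin_boundary K)) _ (nbhs x) _ _ _).2.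
  apply/(@cvg_ptws R (cpart q) _ (nbhs x) (fun z => Kx^~ z) (Kx^~ x)) => B.
  exact: (extended_kernel_cvg (u := fun z => z)).
have inv (f : set_type (martin_boundary K)) : {x | forall B, val f B = Kx B x}.
  apply: cid; have [A Acvg fA] := set_mem (valP f).
  have [x Ax] := convergent_embed Acvg; exists x => B.
  by rewrite -[val f]/(sval f) fA (kernel_lim Acvg.1 Ax).
exists (fun f => sval (inv f)); split.
- by move=> x; apply: extended_kernel_inj => B; rewrite -(svalP (inv (boundary_map x))).
- by move=> f; apply: val_inj; apply/funext => B; rewrite /= -(svalP (inv f)).
- move=> f; apply: (powersum_cvg_kingman (F := nbhs f) (nbhs_filter f)) => b.
  have E g : powersum (sval (inv g) : kingman_seq R q) b =
      (wc [mset b]%mset)^-1 * val g [mset b]%mset.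
    by rewrite (svalP (inv g)) extended_kernel_mset1 mulKf// gt_eqF// wc_gt0.
  rewrite E; under eq_cvg do rewrite E.
  have vf := @initial_continuous _ _ (@set_val _ (martin_boundary K)) f.
  have {}vf : val g [mset b]%mset @[g --> f] --> val f [mset b]%mset.
    exact: (@cvg_ptws R (cpart q) _ (nbhs f) _ _ (nbhs_filter f)).1 vf [mset b]%mset.
  exact: (cvgMl_tmp vf).
Qed.

End martin_boundary.

Theorem proposition5p25 (R : realType) (q : nat) (hq : (0 < q)%N)
    (theta : R) (theta_gt0 : 0 < theta)
    (nu : probability (borel 'rV[R]_q) R)
    (nu_simplex : nu (simplex R q) = 1%E)
    (nu_relint : (0 < nu (simplex_relint R q))%E)
    (d : measure_display) (Omega : measurableType d)
    (P : cpart q -> probability Omega R) (X : nat -> Omega -> cpart q)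
    (hX : is_hoppe_chain theta nu P X) :
  let K := martin_kernel P X in
  let Kx := extended_kernel theta nu in
  [/\ forall A : nat -> cpart q, to_infinity A ->
        (martin_convergent K A <->
         exists x : kingman R q, embed R hq (A k) @[k --> \oo] --> x),
      forall (A : nat -> cpart q) (x : kingman R q), to_infinity A ->
        embed R hq (A k) @[k --> \oo] --> x ->
        forall B : cpart q, K B (A k) @[k --> \oo] --> Kx B x,
      forall (A A' : nat -> cpart q) (x x' : kingman R q),
        martin_convergent K A -> martin_convergent K A' ->
        embed R hq (A k) @[k --> \oo] --> x ->
        embed R hq (A' k) @[k --> \oo] --> x' ->
        (martin_equiv K A A' <-> x = x')
    & exists Theta : kingman R q -> set_type (martin_boundary K),
        (forall x B, val (Theta x) B = Kx B x) /\ homeomorphism Theta].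
Proof.
move=> K Kx.
have cvgK A x (Ainf : to_infinity A) (Ax : embed R hq (A k) @[k --> \oo] --> x) :=
  kernel_cvg theta_gt0 nu_simplex nu_relint hX Ainf Ax.
have limK A x (Ainf : to_infinity A) (Ax : embed R hq (A k) @[k --> \oo] --> x) :=
  kernel_lim theta_gt0 nu_simplex nu_relint hX Ainf Ax.
split.
- move=> A Ainf; split.
    exact: (convergent_embed hq theta_gt0 nu_simplex nu_relint hX).
  by move=> [x Ax]; split=> // B; apply/cvg_ex; exists (Kx B x); exact: cvgK.
- exact: cvgK.
- move=> A A' x x' [Ainf _] [A'inf _] Ax A'x'; split=> [AA'|xx'] => [|B].
    apply: (extended_kernel_inj theta_gt0 nu_simplex nu_relint) => B.
    by rewrite -(limK _ _ Ainf Ax) -(limK _ _ A'inf A'x') AA'.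
  by rewrite (limK _ _ Ainf Ax) (limK _ _ A'inf A'x') xx'.
- exists (boundary_map hq theta_gt0 nu_simplex nu_relint hX); split=> //.
  exact: boundary_map_homeomorphism.
Qed.
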